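(* Let $K$ be a field of characteristic $0$, let $n>d>0$ be integers, let $R=R_{[n]}$, and let $U\subset R_{[n-d-1]}$ be a shifted order ideal of monomials of degree at most $\lfloor\frac d2\rfloor$, so that $S_d(U)$ is an S-squeezed $(d-1)$-sphere on $[n]$. Let $I(U)\subset R$ be the ideal generated by all monomials $u\in R_{[n-d-1]}$ with $u\notin U$. Then for all $i$ and $j$ $$\beta^R_{i,i+j}(R/I_{S_d(U)})=\begin{cases}\beta^R_{i,i+j}(R/I(U)), & \text{for } j<\frac d2,\\ \beta^R_{i,i+j}(R/I(U))+\beta^R_{n-d-i,\,n-i-j}(R/I(U)), & \text{for } j=\frac d2,\\ \beta^R_{n-d-i,\,n-i-j}(R/I(U)), & \text{for } j>\frac d2.\end{cases}$$
   Context: $R_{[n]}=K[x_1,\dots,x_n]$ with each $\deg x_i=1$ ($R_{[0]}=K$), and $[n]=\{1,\dots,n\}$. For a finitely generated graded $R$-module $M$, $\beta^R_{i,j}(M)=\dim_K\mathrm{Tor}^R_i(M,K)_j$ are the graded Betti numbers (zero when $i<0$ or $j<0$). The Stanley--Reisner ideal $I_\Gamma\subset R_{[n]}$ of a simplicial complex $\Gamma$ on $[n]$ is generated by all squarefree monomials $x_{i_1}\cdots x_{i_k}$ with $\{i_1,\dots,i_k\}\notin\Gamma$. For monomials $u=x_{i_1}\cdots x_{i_k}$, $v=x_{j_1}\cdots x_{j_k}$ of the same degree with $i_1\le\cdots\le i_k$, $j_1\le\cdots\le j_k$, write $u\preceq v$ if $i_p\le j_p$ for all $p$. A set $U$ of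 monomials of $R_{[m]}$ is a shifted order ideal of monomials if (i) $\{1,x_1,\dots,x_m\}\subset U$; (ii) $u\in U$ and $v$ divides $u$ imply $v\in U$; (iii) $u\in U$, $v\in R_{[m]}$ a monomial and $u\preceq v$ imply $v\in U$. It is ''of degree at most $k$'' if all its elements have degree at most $k$. Squeezed balls and spheres: with $m=n-d-1$ and $U\subset R_{[m]}$ a shifted order ideal of monomials of degree at most $\lfloor\frac{d+1}{2}\rfloor$, for $u=x_{i_1}\cdots x_{i_k}\in U$ with $i_1\le\cdots\le i_k$ put $$F_d(u)=\{i_1,i_1+1\}\cup\{i_2+2,i_2+3\}\cup\cdots\cup\{i_k+2(k-1),i_k+2k-1\}\cup\{n+2k-d,n+2k-d+1,\dots,n\},$$ a $(d+1)$-subset of $[n]$ (with $F_d(1)=\{n-d,\dots,n\}$). The squeezed $d$-ball $B_d(U)$ is the simplicial complex generated by $\{F_d(u):u\in U\}$; it is a shellable $d$-ball, and the squeezed $(d-1)$-sphere $S_d(U)$ is its boundary, i.e. the complex generated by the $d$-subsets of $[n]$ contained in exactly one facet of $B_d(U)$. If moreover $U$ has degree at most $\lfloor\frac d2\rfloor$, $S_d(U)$ is called an S-squeezed $(d-1)$-sphere. *)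

(* Defs.v *)
From HB Require Import structures.
From Stdlib Require Import ClassicalEpsilon.
From mathcomp Require Import all_boot all_order all_algebra.
From mathcomp Require Import mpoly.

Set Implicit Arguments.
Unset Strict Implicit.
Unset Printing Implicit Defensive.

Import GRing.Theory.
Local Open Scope ring_scope.

(* Vertices and variables are numbered 1, ..., n in the mathematics; the
   ordinal v : 'I_n stands for the vertex v.+1 and 'X_v for the variable
   x_(v.+1). *)

(** * Monomials *)

(* The weakly increasing list i_1 <= ... <= i_k of (1-based) indices such that
   u = x_{i_1} ... x_{i_k}. *)
Definition mnm_indices (m : nat) (u : 'X_{1..m}) : seq nat :=
  flatten [seq nseq (u i) (i : nat).+1 | i <- enum 'I_m].

(* [all2] also requires the two lists to have the same length, that is, u and
   v to have the same degree. *)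
Definition mnm_prec (m : nat) (u v : 'X_{1..m}) : bool :=
  all2 leq (mnm_indices u) (mnm_indices v).

Record shifted_order_ideal (m : nat) (U : {pred 'X_{1..m}}) : Prop :=
  ShiftedOrderIdeal {
    soi_one : 0%MM \in U;
    soi_var : forall i : 'I_m, U_(i)%MM \in U;
    soi_dvd : forall u v : 'X_{1..m}, u \in U -> (v <= u)%MM -> v \in U;
    soi_prec : forall u v : 'X_{1..m}, u \in U -> mnm_prec u v -> v \in U
  }.

Definition mnm_deg_at_most (m : nat) (k : nat) (U : {pred 'X_{1..m}}) : Prop :=
  forall u : 'X_{1..m}, u \in U -> (mdeg u <= k)%N.

(** * Simplicial complexes on [n] *)

Definition generated_complex (n : nat) (G : {set 'I_n} -> Prop)
    (F : {set 'I_n}) : Prop :=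
  exists2 H, G H & F \subset H.

Definition facet (n : nat) (D : {set 'I_n} -> Prop) (F : {set 'I_n}) : Prop :=
  D F /\ forall H, D H -> F \subset H -> H = F.

(* The position p : 'I_k is 0-based: it contributes the pair
   {i_(p+1) + 2p, i_(p+1) + 2p + 1}. *)
Definition squeezed_facet (n d m : nat) (u : 'X_{1..m}) : {set 'I_n} :=
  let s := mnm_indices u in
  let k := size s in
  [set v : 'I_n |
     [exists p : 'I_k, (v.+1 == nth 0 s p + 2 * p)%N
                    || (v.+1 == nth 0 s p + 2 * p + 1)%N]
     || (n + 2 * k - d <= v.+1)%N].

Definition squeezed_ball (n d : nat) (U : {pred 'X_{1..(n - d - 1)}}) :
    {set 'I_n} -> Prop :=
  generated_complex
    (fun F => exists2 u, u \in U & F = squeezed_facet n d u).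

Definition squeezed_sphere (n d : nat) (U : {pred 'X_{1..(n - d - 1)}}) :
    {set 'I_n} -> Prop :=
  generated_complex
    (fun G => #|G| = d /\ exists! F, facet (squeezed_ball U) F /\ G \subset F).

(** * Ideals of K[x_1, ..., x_n] *)

Definition ideal_generated (K : fieldType) (n : nat)
    (G : {mpoly K[n]} -> Prop) (p : {mpoly K[n]}) : Prop :=
  exists s : seq ({mpoly K[n]} * {mpoly K[n]}),
    (forall q, q \in s -> G q.2) /\ p = \sum_(q <- s) q.1 * q.2.

Definition stanley_reisner (K : fieldType) (n : nat)
    (D : {set 'I_n} -> Prop) : {mpoly K[n]} -> Prop :=
  ideal_generated (fun p => exists2 F : {set 'I_n}, ~ D F & p = \prod_(v in F) 'X_v).

(* The inclusion of the monomials in x_1, ..., x_m into those in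
   x_1, ..., x_n, for m <= n. *)
Definition mnm_extend (m n : nat) (u : 'X_{1..m}) : 'X_{1..n} :=
  [multinom oapp u 0%N (insub (i : nat)) | i < n].

Definition non_member_ideal (K : fieldType) (n m : nat)
    (U : {pred 'X_{1..m}}) : {mpoly K[n]} -> Prop :=
  ideal_generated
    (fun p => exists2 u : 'X_{1..m}, u \notin U & p = 'X_[mnm_extend n u]).

(** * Graded Betti numbers of R/I, for R = K[x_1, ..., x_n] *)

(* A homogeneous map from the free module with basis degrees a to the one with
   basis degrees b, acting on row vectors: a nonzero entry (k, l) is
   homogeneous of degree a k - b l. *)
Definition homogeneous_mx (K : fieldType) (n r s : nat)
    (a : 'I_r -> int) (b : 'I_s -> int) (A : 'M[{mpoly K[n]}]_(r, s)) : Prop :=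
  forall k l (w : 'X_{1..n}), w \in msupp (A k l) -> (mdeg w)%:Z + b l = a k.

(* A graded resolution of R/I by free modules of finite rank
     ... -> F_2 -> F_1 -> F_0 -> R/I -> 0,
   where F_i is the direct sum of the R(- gr_deg i k) for k < gr_rank i, the
   differential F_(i+1) -> F_i is v |-> v *m gr_diff i, and F_0 -> R/I is
   v |-> v *m gr_aug modulo I. *)
Record graded_resolution (K : fieldType) (n : nat) (I : {mpoly K[n]} -> Prop) :=
  GradedResolution {
    gr_rank : nat -> nat;
    gr_deg : forall i, 'I_(gr_rank i) -> int;
    gr_aug : 'M[{mpoly K[n]}]_(gr_rank 0, 1);
    gr_diff : forall i, 'M[{mpoly K[n]}]_(gr_rank i.+1, gr_rank i);
    gr_aug_homogeneous : homogeneous_mx (@gr_deg 0%N) (fun=> 0) gr_aug;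
    gr_diff_homogeneous :
      forall i, homogeneous_mx (@gr_deg i.+1) (@gr_deg i) (gr_diff i);
    gr_aug_surjective :
      forall p, exists v : 'rV_(gr_rank 0), I (p - (v *m gr_aug) 0 0);
    gr_exact0 : forall v : 'rV_(gr_rank 0),
      I ((v *m gr_aug) 0 0) <-> exists w, v = w *m gr_diff 0;
    gr_exactS : forall i (v : 'rV_(gr_rank i.+1)),
      v *m gr_diff i = 0 <-> exists w, v = w *m gr_diff i.+1
  }.

Section Tor.
Variables (K : fieldType) (n : nat) (I : {mpoly K[n]} -> Prop).
Variable F : graded_resolution I.

(* K is R/(x_1, ..., x_n), so F_i (x) K is K^(gr_rank i), and tensoring a
   matrix with K replaces its entries by their constant coefficients. *)
Definition tensor_diff (i : nat) : 'M[K]_(gr_rank F i.+1, gr_rank F i) :=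
  map_mx (mcoeff 0%MM) (gr_diff F i).

(* The row space of this matrix is the degree j component of F_i (x) K. *)
Definition tensor_component (i : nat) (j : int) : 'M[K]_(gr_rank F i) :=
  diag_mx (\row_k (gr_deg k == j)%:R).

Definition tensor_cycles (i : nat) (j : int) : 'M[K]_(gr_rank F i) :=
  match i with
  | 0 => tensor_component 0 j
  | i'.+1 => (tensor_component i'.+1 j :&: kermx (tensor_diff i'))%MS
  end.

Definition tensor_boundaries (i : nat) (j : int) :
    'M[K]_(gr_rank F i.+1, gr_rank F i) :=
  tensor_component i.+1 j *m tensor_diff i.

Definition tor_dim (i : nat) (j : int) : nat :=
  (\rank (tensor_cycles i j) - \rank (tensor_boundaries i j))%N.

End Tor.

(* dim_K Tor_i(R/I, K)_j, computed from a graded free resolution of R/I; the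
   value does not depend on the resolution. *)
Definition betti (K : fieldType) (n : nat) (I : {mpoly K[n]} -> Prop)
    (i j : int) : nat :=
  match i with
  | Posz i' =>
      epsilon (inhabits 0%N)
        (fun b => exists F : graded_resolution I, tor_dim F i' j = b)
  | Negz _ => 0%N
  end.

(* Main.v *)
Require Import Defs.
From mathcomp Require Import all_boot all_order all_algebra.
From mathcomp Require Import mpoly.
From mathcomp Require Import zify ring.
From Stdlib Require Import ClassicalEpsilon.

Set Implicit Arguments.
Unset Strict Implicit.
Unset Printing Implicit Defensive.

Import GRing.Theory.

(** Why the theorem holds.  Put m = n - d - 1 and r = floor(d/2), and let S be
    the squeezed sphere, the boundary of the squeezed ball B.

    For a monomial ideal J, the multidegree a part of Tor_i(R/J, K) is computed
    by the Koszul complex: it is the homology in size i, under the simplicial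
    boundary, of the family of all sets tau <= a such that x^(a - tau) lies
    outside J.  Betti numbers thus become dimensions of homology groups of
    finite families of sets ([betti_monomial]).  Reaching them from resolutions
    takes two steps: any two graded resolutions give the same numbers
    ([tor_dim_unique]), and in each multidegree the Taylor resolution and the
    Koszul complex are both quotients, by acyclic subcomplexes, of one complex
    of pairs ([taylor_koszul]).

    Three facts then give the theorem.

    The ideals I_B and I(U) have the same Betti numbers
    ([koszul_betti_stretch]).  A minimal generator x_{i_1} x_{i_2} ... x_{i_k}
    of I(U) stretches to x_{i_1} x_{i_2 + 2} ... x_{i_k + 2(k-1)}, and the
    stretched monomials generate I_B.  Listed by degree and then by index sum,
    both systems of generators have linear quotients, with the same number
    i_k - 1 of variables in the colon ideal at each step; and for linear
    quotients in nondecreasing degree no cancellation occurs, so that the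
    degrees and these numbers determine the Betti numbers
    ([linear_quotients_koszul_betti]).  As the generators have degree at most
    r + 1, R/I(U) has regularity at most r; its projective dimension is at
    most m, for i_k <= m.

    The module I_S/I_B, spanned by the monomials whose support is an interior
    face of B, is dual to R/I_B, as the canonical module should be: inside a
    vertex set W, the homology of interior faces in size i is dual to the
    homology of ball faces inside the complement of W in size m - i
    ([interior_duality]).  The duality pairs two faces whose union is a facet.
    It is a chain map because an interior ridge lies in two facets that induce
    opposite orientations on it, and its mapping cone is acyclic because of
    the shelling: B is the disjoint union of the intervals [R(F), F] over its
    facets F, its interior that of the intervals [F - R(F), F], and this
    yields a perfect acyclic matching.

    Inside W and in size i the ball has homology only if |W| <= i + r, hence by
    duality and n > m + 2r the interior only if |W| > i + r.  So the inclusion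
    of I_S/I_B into R/I_B is zero on Tor, the long exact sequence of
    I_S/I_B -> R/I_B -> R/I_S breaks up, and
    beta_{i,k}(R/I_S) = beta_{i,k}(R/I(U)) + beta_{n-d-i,n-k}(R/I(U))
    for all i and k ([betti_sphere_decomposition]).  With k = i + j, the bound
    on the regularity makes the second term vanish for j < d/2 and the first
    one for j > d/2. *)

(** * Based complexes over a field *)

Local Open Scope ring_scope.

Section FinMatrix.
Variable K : fieldType.

(** Rows and columns are indexed by finite types, through their enumerations:
    the boundary maps of all subfamilies of a based complex then have one and
    the same shape, and their ranks can be compared directly. *)
Definition fun_mx (X Y : finType) (g : X -> Y -> K) : 'M[K]_(#|X|, #|Y|) :=
  \matrix_(i, j) g (enum_val i) (enum_val j).

Definition fun_row (X : finType) (z : X -> K) : 'rV[K]_#|X| :=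
  \row_i z (enum_val i).

Lemma fun_mx_mul (X Y Z : finType) (g : X -> Y -> K) (h : Y -> Z -> K) :
  fun_mx g *m fun_mx h = fun_mx (fun x z => \sum_y g x y * h y z).
Proof.
apply/matrixP=> i j; rewrite !mxE [RHS](reindex (enum_val (A := Y))) /=.
  by apply: eq_bigr => l _; rewrite !mxE.
by exists enum_rank => x _; rewrite ?enum_valK ?enum_rankK.
Qed.

Lemma eq_fun_mx (X Y : finType) (g h : X -> Y -> K) :
  (forall x y, g x y = h x y) -> fun_mx g = fun_mx h.
Proof. by move=> e; apply/matrixP=> i j; rewrite !mxE e. Qed.

Lemma fun_mx_add (X Y : finType) (g h : X -> Y -> K) :
  fun_mx g + fun_mx h = fun_mx (fun x y => g x y + h x y).
Proof. by apply/matrixP=> i j; rewrite !mxE. Qed.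

Lemma fun_mx0 (X Y : finType) : fun_mx (fun (_ : X) (_ : Y) => 0) = 0.
Proof. by apply/matrixP=> i j; rewrite !mxE. Qed.

Lemma fun_mx_inj (X Y : finType) (g h : X -> Y -> K) :
  fun_mx g = fun_mx h -> forall x y, g x y = h x y.
Proof.
move=> e x y; have := congr1 (fun M : 'M_(_, _) => M (enum_rank x) (enum_rank y)) e.
by rewrite !mxE !enum_rankK.
Qed.

Lemma fun_mx_tr (X Y : finType) (g : X -> Y -> K) :
  (fun_mx g)^T = fun_mx (fun y x => g x y).
Proof. by apply/matrixP=> i j; rewrite !mxE. Qed.

Definition fun_rank (X Y : finType) (g : X -> Y -> K) : nat := \rank (fun_mx g).

Lemma eq_fun_rank (X Y : finType) (g h : X -> Y -> K) :
  (forall x y, g x y = h x y) -> fun_rank g = fun_rank h.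
Proof. by move=> e; rewrite /fun_rank (eq_fun_mx e). Qed.

(** Zero rows and columns do not contribute to the rank. *)
Lemma fun_rank_reindex (X Y X' Y' : finType) (f : X' -> X) (f' : Y' -> Y)
    (g : X -> Y -> K) :
  injective f -> injective f' ->
  (forall x y, g x y != 0 -> x \in codom f /\ y \in codom f') ->
  fun_rank (fun x y => g (f x) (f' y)) = fun_rank g.
Proof.
move=> fI f'I supp; apply/eqP; rewrite eqn_leq; apply/andP; split.
  have -> : fun_rank (fun x y => g (f x) (f' y)) =
      \rank (fun_mx (fun x' x => (f x' == x)%:R) *m fun_mx g *m
             fun_mx (fun y y' => (f' y' == y)%:R)).
    rewrite !fun_mx_mul; apply: eq_fun_rank => x' y'.
    rewrite (bigD1 (f' y')) //= eqxx mulr1 (bigD1 (f x')) //= eqxx mul1r.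
    rewrite !big1 ?addr0 // => [y /negbTE ny|x /negbTE nx].
      by rewrite eq_sym ny mulr0.
    by rewrite eq_sym nx mul0r.
  exact: leq_trans (mxrankM_maxl _ _) (mxrankM_maxr _ _).
have -> : fun_rank g =
    \rank (fun_mx (fun x x' => (f x' == x)%:R) *m
           fun_mx (fun x y => g (f x) (f' y)) *m
           fun_mx (fun y' y => (f' y' == y)%:R)).
  rewrite !fun_mx_mul; apply: eq_fun_rank => x y.
  have [g0|/supp [/codomP [x' ->] /codomP [y' ->]]] := eqVneq (g x y) 0.
    rewrite g0 big1 // => y' _; case: eqP => [e|_]; last by rewrite mulr0.
    rewrite mulr1 big1 // => x' _; case: eqP => [e'|_]; last by rewrite mul0r.
    by rewrite mul1r e e'.
  rewrite (bigD1 y') //= eqxx mulr1 (bigD1 x') //= eqxx mul1r.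
  rewrite !big1 ?addr0 // => [y'' ny|x'' nx].
    by rewrite (inj_eq f'I) (negbTE ny) mulr0.
  by rewrite (inj_eq fI) (negbTE nx) mul0r.
exact: leq_trans (mxrankM_maxl _ _) (mxrankM_maxr _ _).
Qed.

(** The projection onto the coordinates in [A]. *)
Definition ind_mx (X : finType) (A : {set X}) : 'M[K]_#|X| :=
  fun_mx (fun x y : X => ((x == y) && (x \in A))%:R).

Lemma ind_mx_mul (X Y : finType) (A : {set X}) (g : X -> Y -> K) :
  ind_mx A *m fun_mx g = fun_mx (fun x y => (x \in A)%:R * g x y).
Proof.
rewrite fun_mx_mul; apply: eq_fun_mx => x y.
rewrite (bigD1 x) //= eqxx big1 ?addr0 // => z /negbTE nz.
by rewrite eq_sym nz mul0r.
Qed.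

Lemma mul_ind_mx (X Y : finType) (A : {set Y}) (g : X -> Y -> K) :
  fun_mx g *m ind_mx A = fun_mx (fun x y => g x y * (y \in A)%:R).
Proof.
rewrite fun_mx_mul; apply: eq_fun_mx => x y.
rewrite (bigD1 y) //= eqxx big1 ?addr0 // => z /negbTE nz.
by rewrite nz mulr0.
Qed.

Lemma rank_ind_mx (X : finType) (A : {set X}) : \rank (ind_mx A) = #|A|.
Proof.
rewrite -[\rank _]/(fun_rank _).
have -> : fun_rank (fun x y : X => ((x == y) && (x \in A))%:R : K) =
          fun_rank (fun x y : {x | x \in A} => (x == y)%:R : K).
  rewrite -(@fun_rank_reindex _ _ {x | x \in A} {x | x \in A} val val) //.
  - by apply: eq_fun_rank => x y; rewrite (valP x) andbT.
  - exact: val_inj.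
  - exact: val_inj.
  - move=> x y; have [<-|_] := eqVneq x y; last by rewrite /= eqxx.
    case: (boolP (x \in A)) => [xA _|_]; last by rewrite /= eqxx.
    by split; apply/codomP; exists (exist _ x xA).
rewrite /fun_rank (_ : fun_mx _ = 1%:M) ?mxrank1 ?card_sig //.
by apply/matrixP=> i j; rewrite !mxE (inj_eq enum_val_inj).
Qed.

End FinMatrix.

Section BasedComplex.
Variables (K : fieldType) (X : finType) (deg : X -> nat) (D : X -> X -> K).
Implicit Types A G H : {set X}.

(** A subset [A] of the basis carries the restriction of the matrix [D], which
    need not square to zero: this is a condition on [A], satisfied by
    differences of subcomplexes. *)
Definition is_complex A := forall x z, x \in A -> z \in A ->
  \sum_(y in A) D x y * D y z = 0.

Definition bd_coef A (i : nat) (x y : X) : K :=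
  ([&& x \in A, y \in A & deg x == i])%:R * D x y.

Definition slice A (i : nat) : {set X} := [set x in A | deg x == i].

Definition bd_rank A (i : nat) : nat := fun_rank (bd_coef A i).

(** The dimension of the homology of [A] in degree [i].  By [bd_rank_le] the
    truncated subtractions are exact as soon as [A] is a complex. *)
Definition hdim A (i : nat) : nat := (#|slice A i| - bd_rank A i - bd_rank A i.+1)%N.

Hypothesis D_deg : forall x y, D x y != 0 -> deg x = (deg y).+1.

Lemma d_eq0 x y : deg x != (deg y).+1 -> D x y = 0.
Proof. by move=> ne; apply/eqP/negPn/negP => /D_deg e; rewrite e eqxx in ne. Qed.

Lemma bd_rank0 A : bd_rank A 0 = 0%N.
Proof.
rewrite /bd_rank (@eq_fun_rank _ _ _ _ (fun _ _ => 0)) ?/fun_rank ?fun_mx0 ?mxrank0 // => x y.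
rewrite /bd_coef; case: and3P => [[_ _ /eqP dx]|_]; last by rewrite mul0r.
by rewrite d_eq0 ?mulr0 // dx.
Qed.

Lemma bd_out A i x y : y \notin slice A i -> bd_coef A i.+1 x y = 0.
Proof.
rewrite inE negb_and /bd_coef => /orP [/negbTE ->|dy]; first by rewrite andbF mul0r.
have [dx|] := eqVneq (deg x) i.+1; last by rewrite !andbF mul0r.
by rewrite d_eq0 ?mulr0 // dx eqSS eq_sym.
Qed.

Lemma bd_bd A i : is_complex A -> fun_mx (bd_coef A i.+1) *m fun_mx (bd_coef A i) = 0.
Proof.
move=> cA; rewrite fun_mx_mul -(fun_mx0 K X X); apply: eq_fun_mx => x z.
have [zA|zA] := boolP (z \in A); last first.
  by rewrite big1 // => y _; rewrite /bd_coef (negbTE zA) andbF mul0r mulr0.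
have [xA|xA] := boolP (x \in A); last first.
  by rewrite big1 // => y _; rewrite /bd_coef (negbTE xA) !mul0r.
have [dx|dx] := boolP (deg x == i.+1); last first.
  by rewrite big1 // => y _; rewrite /bd_coef (negbTE dx) !andbF !mul0r.
rewrite (bigID (mem A)) /= [X in _ + X]big1 ?addr0; last first.
  by move=> y /negbTE yA; rewrite /bd_coef yA andbF mul0r mul0r.
rewrite -[RHS](cA x z xA zA); apply: eq_bigr => y yA.
rewrite /bd_coef xA yA zA dx /= mul1r.
have [_|dy] := eqVneq (deg y) i; first by rewrite mul1r.
by rewrite (@d_eq0 x y) ?mul0r // (eqP dx) eqSS eq_sym.
Qed.

Lemma bd_le_slice A i : (fun_mx (bd_coef A i.+1) <= ind_mx K (slice A i))%MS.
Proof.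
suff -> : fun_mx (bd_coef A i.+1) = fun_mx (bd_coef A i.+1) *m ind_mx K (slice A i).
  exact: submxMl.
rewrite mul_ind_mx; apply: eq_fun_mx => x y.
by case: (boolP (y \in slice A i)) => [_|/bd_out ->]; rewrite ?mulr1 ?mul0r.
Qed.

Lemma ind_mx_bd A i : ind_mx K (slice A i) *m fun_mx (bd_coef A i) = fun_mx (bd_coef A i).
Proof.
rewrite ind_mx_mul; apply: eq_fun_mx => x y; rewrite /bd_coef inE.
by case: (x \in A) => /=; case: (deg x == i); rewrite ?andbF ?mul1r ?mul0r.
Qed.

Lemma rank_cycles A i :
  (\rank (ind_mx K (slice A i) :&: kermx (fun_mx (bd_coef A i))) + bd_rank A i = #|slice A i|)%N.
Proof.
rewrite addnC -(rank_ind_mx K) -(mxrank_mul_ker (ind_mx K (slice A i)) (fun_mx (bd_coef A i))).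
by rewrite ind_mx_bd.
Qed.

Lemma bd_cycles A i : is_complex A ->
  (fun_mx (bd_coef A i.+1) <= ind_mx K (slice A i) :&: kermx (fun_mx (bd_coef A i)))%MS.
Proof.
by move=> cA; rewrite sub_capmx bd_le_slice; apply/sub_kermxP; exact: bd_bd.
Qed.

Lemma bd_rank_le A i : is_complex A -> (bd_rank A i + bd_rank A i.+1 <= #|slice A i|)%N.
Proof.
move=> cA; rewrite -(rank_cycles A i) addnC leq_add2r.
exact: mxrankS (bd_cycles i cA).
Qed.

Lemma hdimE A i : is_complex A -> (hdim A i + bd_rank A i + bd_rank A i.+1 = #|slice A i|)%N.
Proof. by move=> cA; rewrite /hdim; have := bd_rank_le i cA; lia. Qed.

(** Equality of dimensions forces boundaries and cycles to coincide: this turns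
    the numerical vanishing of homology into the existence of preimages. *)
Lemma acyclic_exact A i (z : X -> K) : is_complex A -> hdim A i = 0%N ->
  (forall x, x \notin slice A i -> z x = 0) ->
  (forall y, y \in A -> \sum_(x in A) z x * D x y = 0) ->
  exists w : X -> K, (forall x, x \notin slice A i.+1 -> w x = 0) /\
    (forall y, y \in A -> \sum_(x in A) w x * D x y = z y).
Proof.
move=> cA hA zs zc.
have eqr : (fun_mx (bd_coef A i.+1) == ind_mx K (slice A i) :&: kermx (fun_mx (bd_coef A i)))%MS.
  rewrite -(geq_leqif (mxrank_leqif_eq (bd_cycles i cA))).
  by have := rank_cycles A i; have := hdimE i cA; rewrite /bd_rank /fun_rank; lia.
have zin : (fun_row z <= ind_mx K (slice A i) :&: kermx (fun_mx (bd_coef A i)))%MS.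
  rewrite sub_capmx; apply/andP; split.
    suff -> : fun_row z = fun_row z *m ind_mx K (slice A i) by exact: submxMl.
    apply/rowP=> j; rewrite !mxE (bigD1 j) //= big1 => [|l nl]; rewrite !mxE.
      rewrite eqxx /= addr0; case: (boolP (enum_val j \in _)) => [_|/zs ->].
        by rewrite mulr1.
      by rewrite mul0r.
    by rewrite (inj_eq enum_val_inj) (negbTE nl) mulr0.
  apply/sub_kermxP/rowP=> j; rewrite !mxE.
  rewrite (eq_bigr (fun l => z (enum_val l) * bd_coef A i (enum_val l) (enum_val j)));
    last by move=> l _; rewrite !mxE.
  rewrite -(reindex (enum_val (A := X)) (P := xpredT)
      (F := fun x => z x * bd_coef A i x (enum_val j))) /=; last first.
    by exists enum_rank => x _; rewrite ?enum_valK ?enum_rankK.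
  have [jA|jA] := boolP (enum_val j \in A); last first.
    by rewrite big1 // => x _; rewrite /bd_coef (negbTE jA) andbF mul0r mulr0.
  rewrite -[RHS](zc _ jA) [RHS]big_mkcond; apply: eq_bigr => x _.
  rewrite /bd_coef jA /=; have [xs|/[dup] xs /zs ->] := boolP (x \in slice A i).
    by move: xs; rewrite inE => /andP [-> ->]; rewrite mul1r.
  by rewrite !mul0r; case: ifP.
have /submxP [w ew] : (fun_row z <= fun_mx (bd_coef A i.+1))%MS by rewrite (eqmxP eqr).
pose w' x := (x \in slice A i.+1)%:R * w 0 (enum_rank x).
exists w'; split=> [x /negbTE nx|y yA]; first by rewrite /w' nx mul0r.
have := congr1 (fun M : 'rV_ _ => M 0 (enum_rank y)) ew.
rewrite !mxE enum_rankK => ->.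
rewrite big_mkcond [RHS](reindex enum_rank) /=; last first.
  by exists enum_val => x _; rewrite ?enum_valK ?enum_rankK.
apply: eq_bigr => x _; rewrite !mxE !enum_rankK /w' /bd_coef yA inE /=.
case: (x \in A); rewrite /= ?mul0r ?mulr0 //.
by rewrite mulrA [w _ _ * _]mulrC.
Qed.

Section LongExactSequence.
Variables G H : {set X}.
Let A := G :|: H.
Hypothesis dis : [disjoint G & H].
Hypothesis cA : is_complex A.
Hypothesis GH : forall g h, g \in G -> h \in H -> D g h = 0.

Lemma sub_notin_quo x : x \in G -> x \in H = false.
Proof. by move=> xG; rewrite (disjointFr dis xG). Qed.

Lemma sum_sub_quo (F : X -> K) :
  \sum_(y in A) F y = \sum_(y in G) F y + \sum_(y in H) F y.
Proof. by rewrite -bigU //; apply: eq_bigl => y; rewrite !inE. Qed.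

Lemma complex_sub : is_complex G.
Proof.
move=> x z xG zG; have := cA (x := x) (z := z).
rewrite !inE xG zG => /(_ isT isT); rewrite sum_sub_quo.
rewrite [X in _ + X = 0]big1 ?addr0 // => y yH.
by rewrite (GH xG yH) mul0r.
Qed.

Lemma complex_quo : is_complex H.
Proof.
move=> x z xH zH; have := cA (x := x) (z := z).
rewrite !inE xH zH !orbT => /(_ isT isT); rewrite sum_sub_quo.
rewrite [X in X + _ = 0]big1 ?add0r // => y yG.
by rewrite (GH yG zH) mulr0.
Qed.

Lemma card_slice i : #|slice A i| = (#|slice G i| + #|slice H i|)%N.
Proof.
rewrite -cardsUI (_ : slice G i :&: slice H i = set0) ?cards0 ?addn0.
  by apply: eq_card => x; rewrite !inE andb_orl.
apply/setP=> x; rewrite !inE; case xG: (x \in G) => //=.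
by rewrite (sub_notin_quo xG) andbF.
Qed.

Let N i := fun_mx (bd_coef A i).

Lemma bd_proj i : N i *m ind_mx K H = fun_mx (bd_coef H i).
Proof.
rewrite mul_ind_mx; apply: eq_fun_mx => x y; rewrite /bd_coef /A !inE.
have [yH|yH] := boolP (y \in H); last by rewrite mulr0 andbF mul0r.
rewrite mulr1 orbT; have [xG|xG] := boolP (x \in G).
  by rewrite (sub_notin_quo xG) (GH xG yH) !mulr0.
by [].
Qed.

Lemma bd_subE i : fun_mx (bd_coef G i) = ind_mx K G *m N i.
Proof.
rewrite ind_mx_mul; apply: eq_fun_mx => x y; rewrite /bd_coef /A !inE.
have [xG|xG] := boolP (x \in G); last by rewrite !mul0r.
rewrite mul1r /=; have [yG|yG] := boolP (y \in G); first by [].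
have [yH|yH] := boolP (y \in H); last by [].
by rewrite (GH xG yH) !mulr0.
Qed.

Lemma bd_rank_split i : (bd_rank A i = bd_rank H i + \rank (N i :&: kermx (ind_mx K H)))%N.
Proof. by rewrite /bd_rank /fun_rank -(mxrank_mul_ker (N i) (ind_mx K H)) bd_proj. Qed.

Lemma bd_rank_ge i : (bd_rank G i + bd_rank H i <= bd_rank A i)%N.
Proof.
rewrite bd_rank_split addnC leq_add2l; apply: mxrankS.
rewrite sub_capmx bd_subE submxMl /=; apply/sub_kermxP.
rewrite -bd_subE mul_ind_mx -(fun_mx0 K X X); apply: eq_fun_mx => x y.
rewrite /bd_coef; have [yH|yH] := boolP (y \in H); last by rewrite mulr0.
rewrite (_ : y \in G = false) ?andbF ?mul0r //.
by apply/negbTE/negP => /sub_notin_quo; rewrite yH.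
Qed.

(** In the next two lemmas the excess of the rank of the boundary of the total
    complex over those of the subcomplex [G] and the quotient [H] is the rank
    of the connecting homomorphism.  The boundaries of the total complex that
    vanish in [H] are cycles of [G], so the excess is at most the dimension of
    the homology of the subcomplex. *)
Lemma gap_le_sub i : (bd_rank A i.+1 <= bd_rank G i.+1 + bd_rank H i.+1 + hdim G i)%N.
Proof.
rewrite bd_rank_split; have := rank_cycles G i; have := hdimE i complex_sub.
suff: (\rank (N i.+1 :&: kermx (ind_mx K H)) <=
       \rank (ind_mx K (slice G i) :&: kermx (fun_mx (bd_coef G i))))%N by lia.
apply: mxrankS; set Z := (_ :&: _)%MS.
have /andP [ZN /sub_kermxP ZH] : (Z <= N i.+1)%MS && (Z <= kermx (ind_mx K H))%MS.
  by rewrite /Z capmxSl capmxSr.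
have ZE : Z *m ind_mx K (slice G i) = Z.
  have ZA : Z *m ind_mx K (slice A i) = Z.
    have /submxP [T eT] := submx_trans ZN (bd_le_slice A i).
    rewrite eT -mulmxA mul_ind_mx; congr (_ *m _); apply: eq_fun_mx => x y.
    by case: eqP => [->|] /=; rewrite ?mul0r //; case: (y \in _); rewrite ?mulr1 ?mulr0.
  rewrite -[RHS]ZA (_ : ind_mx K (slice A i) =
     ind_mx K (slice G i) + ind_mx K H *m ind_mx K (slice H i)).
    by rewrite mulmxDr mulmxA ZH mul0mx addr0.
  rewrite ind_mx_mul fun_mx_add; apply: eq_fun_mx => x y; rewrite !inE.
  case: eqP => [->|_] /=; rewrite ?mulr0 ?addr0 //.
  have [yG|yG] := boolP (y \in G); first by rewrite (sub_notin_quo yG) /= mul0r addr0.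
  by case: (y \in H) => /=; rewrite ?mul1r ?mul0r add0r.
rewrite sub_capmx; apply/andP; split; first by rewrite -ZE submxMl.
apply/sub_kermxP; rewrite -ZE -mulmxA.
have -> : ind_mx K (slice G i) *m fun_mx (bd_coef G i) = ind_mx K (slice G i) *m N i.
  rewrite !ind_mx_mul; apply: eq_fun_mx => x y; rewrite inE.
  have [xG|xG] := boolP (x \in G); last by rewrite !mul0r.
  congr (_ * _); rewrite /bd_coef /A !inE xG /=.
  have [yG|yG] := boolP (y \in G); first by [].
  by case: (boolP (y \in H)) => // yH; rewrite (GH xG yH) !mulr0.
rewrite mulmxA ZE; have /submxP [T ->] := ZN.
by rewrite -mulmxA bd_bd ?mulmx0.
Qed.

(** Modulo boundaries of [G], the boundary map depends on a chain of [H] only up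
    to boundaries of [H]; so a complement of these in the chains of [H]
    suffices to produce the image. *)
Lemma gap_le_quo i : (bd_rank A i <= bd_rank G i + bd_rank H i + hdim H i)%N.
Proof.
pose E := ind_mx K (slice H i); pose B := fun_mx (bd_coef H i.+1).
have NE : (N i <= fun_mx (bd_coef G i) + E *m N i)%MS.
  have e : N i = fun_mx (bd_coef G i) + E *m N i.
    rewrite bd_subE !ind_mx_mul fun_mx_add; apply: eq_fun_mx => x y; rewrite inE.
    have [xG|xG] := boolP (x \in G); first by rewrite (sub_notin_quo xG) mul1r mul0r addr0.
    rewrite mul0r add0r /bd_coef /A !inE (negbTE xG) /=.
    case: (x \in H); rewrite ?mul0r ?mulr0 //=.
    by case: (deg x == i); rewrite ?andbF ?mul0r ?mul1r.
  by rewrite {1}e addmx_sub_adds ?submx_refl.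
have BE : (B <= E)%MS by exact: bd_le_slice.
(* the total boundary of a chain of [H] is its boundary in [H] plus a chain
   [C] of [G]; applying the boundary again shows that the boundary in [H] is
   sent by the total boundary to minus the boundary of [C] *)
have BN : (B *m N i <= fun_mx (bd_coef G i))%MS.
  pose C := fun_mx (fun x y => ([&& x \in H, y \in G & deg x == i.+1])%:R * D x y).
  have eC : B = fun_mx (fun x y => (x \in H)%:R * bd_coef A i.+1 x y) - C.
    apply/matrixP=> a b; rewrite !mxE /bd_coef /A !inE.
    set x := enum_val a; set y := enum_val b.
    have [yG|yG] := boolP (y \in G).
      rewrite (sub_notin_quo yG) andbF mul0r /=.
      case: (boolP (x \in H)) => xH; rewrite ?mul0r ?subr0 //=.
      by rewrite mul1r orbT subrr.
    rewrite andbF mul0r subr0 /=; case: (x \in H); rewrite ?mul0r //=.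
    by rewrite orbT mul1r.
  rewrite eC mulmxBl -ind_mx_mul -mulmxA bd_bd // mulmx0 sub0r.
  have -> : C = C *m ind_mx K G.
    rewrite mul_ind_mx; apply: eq_fun_mx => x y.
    by case: (y \in G); rewrite ?mulr1 // andbF mul0r mul0r.
  by rewrite -mulmxA -bd_subE eqmx_opp submxMl.
have le1 : (N i <= fun_mx (bd_coef G i) + (E :\: B)%MS *m N i)%MS.
  apply: submx_trans NE _; rewrite addsmx_sub addsmxSl /=.
  have EB : (E <= (E :\: B) + B)%MS.
    by rewrite -{1}(addsmx_diff_cap_eq E B) addsmxS ?capmxSr.
  apply: submx_trans (submxMr (N i) EB) _; rewrite addsmxMr addsmx_sub addsmxSr /=.
  exact: submx_trans BN (addsmxSl _ _).
have := leq_trans (mxrankS le1) (leq_trans (mxrank_adds_leqif _ _) (leqnn _)).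
have := mxrankM_maxl (E :\: B)%MS (N i).
have := mxrank_cap_compl E B; rewrite (capmx_idPr BE) => e1.
have e2 : \rank E = #|slice H i| := rank_ind_mx K _.
have e3 := hdimE i complex_quo; move: e1; rewrite e2 -e3 {2}/bd_rank /fun_rank -/B => e1 l1 l2.
apply: leq_trans l2 _; rewrite -addnA leq_add2l.
by move: l1 e1; rewrite /bd_rank /fun_rank -/B; lia.
Qed.

End LongExactSequence.
End BasedComplex.

(** * The long exact sequence and acyclic matchings *)

Section Homology.
Variables (K : fieldType) (X : finType) (deg : X -> nat) (D : X -> X -> K).
Hypothesis D_deg : forall x y, D x y != 0 -> deg x = (deg y).+1.
Implicit Types A G H : {set X}.
Local Notation is_complex := (is_complex D).
Local Notation hdim := (hdim deg D).
Local Notation bd_rank := (bd_rank deg D).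

Section TwoPieces.
Variables G H : {set X}.
Hypothesis dis : [disjoint G & H].
Hypothesis cA : is_complex (G :|: H).
Hypothesis GH : forall g h, g \in G -> h \in H -> D g h = 0.

(** The numerical content of the long exact homology sequence: [gap i] is the
    rank of the connecting homomorphism from degree [i] of the quotient [H] to
    degree [i.-1] of the subcomplex [G]. *)
Lemma long_exact : exists gap : nat -> nat,
  [/\ gap 0%N = 0%N,
      forall i, (hdim (G :|: H) i + gap i + gap i.+1 = hdim G i + hdim H i)%N,
      forall i, (gap i <= hdim H i)%N
    & forall i, (gap i.+1 <= hdim G i)%N].
Proof.
have cG := complex_sub dis cA GH; have cH := complex_quo dis cA GH.
exists (fun i => bd_rank (G :|: H) i - bd_rank G i - bd_rank H i)%N.
split=> [|i|i|i]; first by rewrite bd_rank0.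
- have := hdimE D_deg i cA; have := hdimE D_deg i cG; have := hdimE D_deg i cH.
  rewrite (card_slice _ dis).
  have := bd_rank_ge deg dis GH i; have := bd_rank_ge deg dis GH i.+1; lia.
- by have := gap_le_quo D_deg dis cA GH i; lia.
- by have := gap_le_sub D_deg dis cA GH i; lia.
Qed.

Lemma hdim_sub0 : (forall i, hdim G i = 0%N) ->
  forall i, hdim (G :|: H) i = hdim H i.
Proof.
move=> G0 i; have [gap [g0 e _ le]] := long_exact.
have := e i; rewrite G0; have := le i; rewrite G0.
by case: i => [|i]; rewrite ?g0; [|have := le i; rewrite G0]; lia.
Qed.

Lemma hdim_quo0 : (forall i, hdim H i = 0%N) ->
  forall i, hdim (G :|: H) i = hdim G i.
Proof.
move=> H0 i; have [gap [_ e le _]] := long_exact.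
have := e i; have := le i; have := le i.+1; rewrite !H0; lia.
Qed.

(** The connecting homomorphism is an isomorphism if the total complex is
    acyclic. *)
Lemma hdim_connect : (forall i, hdim (G :|: H) i = 0%N) ->
  forall i, hdim H i.+1 = hdim G i.
Proof.
move=> A0 i; have [gap [_ e le le']] := long_exact.
have := e i; have := e i.+1; have := le i; have := le i.+1; have := le' i.
have := le' i.+1; rewrite !A0; lia.
Qed.

(** The inclusion of the subcomplex is zero in homology, its source or its
    target being zero in each degree, so the long exact sequence breaks into
    short ones. *)
Lemma hdim_quotient : (forall i, hdim G i = 0%N \/ hdim (G :|: H) i = 0%N) ->
  forall i, hdim H i =
    (hdim (G :|: H) i + (if i is i'.+1 then hdim G i' else 0))%N.
Proof.
move=> zero; have [gap [g0 e le le']] := long_exact.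
have gapE i : gap i.+1 = hdim G i.
  have := e i; have := le i; have := le' i.
  by case: (zero i) => ->; lia.
move=> i; have := e i; rewrite gapE.
by case: i => [|i]; rewrite ?g0 ?gapE; lia.
Qed.

Lemma hdim_direct :
  (forall g h, g \in G -> h \in H -> D h g = 0) ->
  forall i, hdim (G :|: H) i = (hdim G i + hdim H i)%N.
Proof.
move=> HG i.
have cG := complex_sub dis cA GH; have cH := complex_quo dis cA GH.
have rhoD j : bd_rank (G :|: H) j = (bd_rank G j + bd_rank H j)%N.
  apply/eqP; rewrite eqn_leq (bd_rank_ge deg dis GH) andbT.
  rewrite {1}/bd_rank /fun_rank.
  have -> : fun_mx (bd_coef deg D (G :|: H) j) =
            fun_mx (bd_coef deg D G j) + fun_mx (bd_coef deg D H j).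
    rewrite fun_mx_add; apply: eq_fun_mx => x y; rewrite /bd_coef !inE.
    case xG: (x \in G); case yG: (y \in G); rewrite ?(sub_notin_quo dis xG) ?(sub_notin_quo dis yG) /=.
    - by rewrite mul0r addr0.
    - case yH: (y \in H); last by rewrite !mul0r addr0.
      by rewrite (GH xG yH) !mulr0 addr0.
    - case xH: (x \in H); last by rewrite !mul0r addr0.
      by rewrite (HG _ _ yG xH) !mulr0 addr0.
    - by rewrite mul0r add0r.
  exact: mxrank_add.
have := hdimE D_deg i cA; have := hdimE D_deg i cG; have := hdimE D_deg i cH.
rewrite (card_slice _ dis) !rhoD; lia.
Qed.

End TwoPieces.

Lemma hdim_pair a b : is_complex [set a; b] -> D b a != 0 ->
  forall i, hdim [set a; b] i = 0%N.
Proof.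
move=> cA Dba i; have degb := D_deg Dba.
have rb : (0 < bd_rank [set a; b] (deg b))%N.
  rewrite lt0n mxrank_eq0; apply: contraNneq Dba.
  rewrite -(fun_mx0 K X X) => /fun_mx_inj /(_ b a).
  by rewrite /bd_coef !inE !eqxx orbT mul1r => ->.
have sl1 c j : (#|[set x in [set c] | deg x == j]| <= (deg c == j))%N.
  have [cj|cj] := boolP (deg c == j).
    apply: (@leq_trans #|[set c]|); last by rewrite cards1.
    by rewrite subset_leq_card // setIdE subsetIl.
  rewrite leqn0 cards_eq0; apply/eqP/setP => x; rewrite !inE.
  by apply/andP => -[/eqP ->]; apply/negP.
have sl j : (#|slice deg [set a; b] j| <= (deg a == j) + (deg b == j))%N.
  have -> : slice deg [set a; b] j =
    [set x in [set a] | deg x == j] :|: [set x in [set b] | deg x == j].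
    by apply/setP=> x; rewrite !inE andb_orl.
  apply: leq_trans (leq_card_setU _ _) _; exact: leq_add.
have := hdimE D_deg i cA; have := sl i.
have [ei|ni] := eqVneq (deg b) i; first by move: rb; rewrite ei; lia.
have [ei|ni'] := eqVneq (deg a) i; last by lia.
by move: rb; rewrite degb ei; lia.
Qed.

Lemma hdim_set0 i : hdim set0 i = 0%N.
Proof.
rewrite /hdim; apply/eqP; rewrite -leqn0; apply: leq_trans (leq_subr _ _) _.
apply: leq_trans (leq_subr _ _) _.
by rewrite (_ : slice _ _ _ = set0) ?cards0 //; apply/setP=> x; rewrite !inE.
Qed.

Lemma hdim_set1 x i : hdim [set x] i = (deg x == i) :> nat.
Proof.
have sl : slice deg [set x] i = if deg x == i then [set x] else set0.
  by apply/setP=> y; rewrite inE; case: ifP => xi; rewrite !inE; case: eqP => [->|].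
have r0 j : bd_rank [set x] j = 0%N.
  rewrite /bd_rank (@eq_fun_rank _ _ _ _ (fun _ _ => 0)) ?/fun_rank ?fun_mx0 ?mxrank0 // => y z.
  rewrite /bd_coef !inE; case: and3P => [[/eqP -> /eqP -> _]|_]; last by rewrite mul0r.
  by rewrite (d_eq0 D_deg) ?mulr0 //; lia.
by rewrite /hdim !r0 !subn0 sl; case: ifP; rewrite ?cards1 ?cards0.
Qed.

(** A weak form of algebraic discrete Morse theory.  No arrow leads from another
    element into the matched pair of largest weight, so this pair is a quotient
    complex; it is acyclic, and induction applies to the rest. *)
Lemma matching_acyclic A (mu : X -> X) (w : X -> nat) : is_complex A ->
  (forall x, x \in A -> [/\ mu x \in A, mu (mu x) = x, w (mu x) = w x
                          & (D x (mu x) != 0) || (D (mu x) x != 0)]) ->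
  (forall x y, x \in A -> y \in A -> D x y != 0 -> y != mu x -> (w y < w x)%N) ->
  forall i, hdim A i = 0%N.
Proof.
move: {2}#|A| (leqnn #|A|) => N; elim: N A => [|N IH] A.
  rewrite leqn0 cards_eq0 => /eqP -> _ _ _ i; exact: hdim_set0.
move=> cardA cA muA wA.
have [->|/set0Pn [x0 x0A]] := eqVneq A set0; first by move=> i; exact: hdim_set0.
have [x xA xmax] : exists2 x, x \in A & forall y, y \in A -> (w y <= w x)%N.
  by case: (arg_maxnP w x0A) => x xA xm; exists x.
have [mA mK wm Dm] := muA x xA.
pose P := [set x; mu x]; pose G := A :\: P.
have PA : P \subset A by apply/subsetP=> y; rewrite !inE => /orP [] /eqP ->.
have dis : [disjoint G & P] by rewrite -setI_eq0 setIDAC setDIl setDv setI0.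
have AE : A = G :|: P by rewrite /G setUC -{1}(setID A P) (setIidPr PA).
have muG y : y \in G -> mu y \in G.
  rewrite !inE !negb_or => /andP [/andP [yx ym] yA].
  have [-> e _ _] := muA y yA; rewrite andbT; apply/andP; split.
    by apply: contraNneq ym => <-; rewrite e.
  by apply: contraNneq yx => e'; rewrite -e e' mK.
have GP g p : g \in G -> p \in P -> D g p = 0.
  move=> gG pP; apply/eqP/negPn/negP => Dne.
  have gA : g \in A by rewrite AE inE gG.
  have pA : p \in A := subsetP PA p pP.
  have pne : p != mu g.
    apply: contraTneq (muG g gG) => <-; rewrite inE pP //.
  have := wA g p gA pA Dne pne; rewrite ltnNge => /negP []; apply: leq_trans (xmax g gA) _.
  by move: pP; rewrite !inE => /orP [] /eqP ->; rewrite ?wm.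
have cA' : is_complex (G :|: P) by rewrite -AE.
have P0 : forall i, hdim P i = 0%N.
  have cP := complex_quo dis cA' GP.
  case/orP: Dm => Dm; last exact: hdim_pair.
  by move=> i; rewrite /P setUC hdim_pair // setUC.
move=> i; rewrite AE (hdim_quo0 dis cA' GP P0).
apply: (IH G _ (complex_sub dis cA' GP)) => [|y yG|y z yG zG].
- rewrite -ltnS; apply: leq_trans cardA; apply: proper_card.
  rewrite properE subsetDl /=; apply/subsetPn; exists x => //.
  by rewrite !inE eqxx.
- have [] := muA y; first by rewrite AE inE yG.
  by move=> _ ? ? ?; split=> //; exact: muG.
- by apply: wA; rewrite AE inE ?yG ?zG.
Qed.

(** The complex is the direct sum of its parts of constant label. *)
Lemma hdim_labels (L : finType) (lab : X -> L) A : is_complex A ->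
  (forall x y, x \in A -> y \in A -> D x y != 0 -> lab x = lab y) ->
  forall i, hdim A i = (\sum_l hdim [set x in A | lab x == l] i)%N.
Proof.
move=> cA labA i.
suff H s : uniq s -> is_complex [set x in A | lab x \in s] /\
    hdim [set x in A | lab x \in s] i =
    (\sum_(l <- s) hdim [set x in A | lab x == l] i)%N.
  have [_ e] := H (index_enum L) (index_enum_uniq L).
  rewrite -e; congr (hdim _ i); apply/setP=> x.
  by rewrite inE mem_index_enum andbT.
have cS (t : seq L) : is_complex [set x in A | lab x \in t].
  move=> x z; rewrite !inE => /andP [xA xs] /andP [zA zs].
  rewrite -[RHS](cA x z xA zA) big_mkcond [RHS]big_mkcond.
  apply: eq_bigr => y _; rewrite inE; case yA: (y \in A) => //=.
  case: ifP => // ys; have [->|/labA e] := eqVneq (D x y) 0; first by rewrite mul0r.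
  by rewrite -e ?xs // in ys.
elim: s => [|l s IHs] /=.
  move=> _; split=> //; rewrite big_nil.
  by rewrite -[RHS](hdim_set0 i); congr (hdim _ i); apply/setP=> x; rewrite !inE andbF.
case/andP=> ls /IHs [_ e]; split=> //; rewrite big_cons -e.
have AE : [set x in A | lab x \in l :: s] =
  [set x in A | lab x == l] :|: [set x in A | lab x \in s].
  by apply/setP=> x; rewrite !inE andb_orr.
rewrite AE hdim_direct //.
- rewrite -setI_eq0; apply/eqP/setP=> x; rewrite !inE.
  by case: eqP => [->|_]; rewrite ?(negbTE ls) ?andbF.
- by rewrite -AE.
- move=> g h; rewrite !inE => /andP [gA /eqP gl] /andP [hA hs].
  by apply/eqP/negPn/negP => /labA e'; rewrite -e' // gl (negbTE ls) in hs.
- move=> g h; rewrite !inE => /andP [gA /eqP gl] /andP [hA hs].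
  by apply/eqP/negPn/negP => /labA e'; rewrite e' // gl (negbTE ls) in hs.
Qed.

End Homology.

Section Transport.
Variables (K : fieldType) (X X' : finType).
Variables (deg : X -> nat) (D : X -> X -> K).
Variables (deg' : X' -> nat) (D' : X' -> X' -> K).
Hypothesis D_deg : forall x y, D x y != 0 -> deg x = (deg y).+1.
Hypothesis D'_deg : forall x y, D' x y != 0 -> deg' x = (deg' y).+1.
Variables (f : X' -> X) (fI : injective f) (A : {set X'}).

Lemma bd_image_supp i x y : bd_coef deg D (f @: A) i x y != 0 ->
  x \in codom f /\ y \in codom f.
Proof.
rewrite /bd_coef; case: and3P => [[/imsetP [x' _ ->] /imsetP [y' _ ->] _] _|_].
  by rewrite !codom_f.
by rewrite mul0r eqxx.
Qed.

Lemma hdim_image s i :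
  (forall x, deg (f x) = deg' x + s)%N ->
  {in A &, forall x y, D (f x) (f y) = D' x y} ->
  hdim deg D (f @: A) (i + s) = hdim deg' D' A i.
Proof.
move=> degE DE.
have rhoE j : bd_rank deg D (f @: A) (j + s) = bd_rank deg' D' A j.
  rewrite /bd_rank -(fun_rank_reindex fI fI (@bd_image_supp _)); apply: eq_fun_rank => x y.
  rewrite /bd_coef !mem_imset // degE eqn_add2r.
  by case: and3P => [[xA yA _]|_]; [rewrite DE | rewrite !mul0r].
rewrite /hdim -addSn !rhoE; congr (_ - _ - _)%N.
rewrite -(card_imset _ fI); apply: eq_card => x; apply/idP/imsetP.
  rewrite inE => /andP [/imsetP [y yA ->]]; rewrite degE eqn_add2r => dy.
  by exists y; rewrite // inE yA.
case=> y; rewrite inE => /andP [yA dy] ->.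
by rewrite inE mem_imset // yA degE eqn_add2r.
Qed.

(** Reversing the arrows of a complex gives the dual complex, whose homology has
    the same dimensions because a matrix and its transpose have the same
    rank. *)
Lemma hdim_reverse (m i j : nat) :
  (forall x, deg (f x) + deg' x = m)%N ->
  {in A &, forall x y, D (f x) (f y) = D' y x} ->
  (i + j = m)%N -> hdim deg D (f @: A) i = hdim deg' D' A j.
Proof.
move=> degE DE ijm.
have rhoE a b : (a + b = m.+1)%N -> bd_rank deg D (f @: A) a = bd_rank deg' D' A b.
  move=> abm; rewrite /bd_rank -(fun_rank_reindex fI fI (@bd_image_supp _)).
  rewrite /fun_rank -mxrank_tr fun_mx_tr; apply: (@eq_fun_rank K) => x y.
  rewrite /bd_coef !mem_imset //.
  case xA: (x \in A); case yA: (y \in A); rewrite ?mul0r //= DE //.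
  have [->|/D'_deg e] := eqVneq (D' x y) 0; first by rewrite !mulr0.
  by congr (_%:R * _); have := degE y; lia.
rewrite /hdim (rhoE i j.+1) ?(rhoE i.+1 j); try lia.
rewrite subnAC; congr (_ - _ - _)%N.
rewrite -(card_imset _ fI); apply: eq_card => x; apply/idP/imsetP.
  rewrite inE => /andP [/imsetP [y yA ->]] dy.
  by exists y; rewrite // inE yA /=; have := degE y; lia.
case=> y; rewrite inE => /andP [yA dy] ->.
by rewrite inE mem_imset // yA /=; have := degE y; lia.
Qed.

End Transport.

(** * Families of sets with the simplicial boundary *)

Section Simplicial.
Variables (K : fieldType) (n : nat).
Implicit Types T S : {set 'I_n}.

Definition face_sgn T (v : 'I_n) : K := (-1) ^+ #|[set x in T | (x < v)%N]|.

Definition simplex_d T S : K := \sum_(v in T | T :\ v == S) face_sgn T v.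

Lemma face_sgn_neq0 T v : face_sgn T v != 0.
Proof. by rewrite signr_eq0. Qed.

Lemma simplex_d_neq0 T S : simplex_d T S != 0 -> exists2 v, v \in T & S = T :\ v.
Proof.
move=> ne; have [v /andP [vT /eqP e]|none] := pickP [pred v | v \in T & T :\ v == S].
  by exists v.
by rewrite /simplex_d big1 ?eqxx // in ne => v; have /= := none v => ->.
Qed.

Lemma simplex_d_deg T S : simplex_d T S != 0 -> #|T| = #|S|.+1.
Proof. by case/simplex_d_neq0 => v vT ->; rewrite [LHS](cardsD1 v) vT. Qed.

Lemma setD1_inj T u v : u \in T -> v \in T -> T :\ u = T :\ v -> u = v.
Proof.
move=> uT vT /setP /(_ u); rewrite !inE eqxx uT /= andbT => /esym/negbFE/eqP //.
Qed.

Lemma simplex_dD1 T v : v \in T -> simplex_d T (T :\ v) = face_sgn T v.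
Proof.
move=> vT; rewrite /simplex_d (bigD1 v) ?vT ?eqxx //= big1 ?addr0 // => u.
by case/andP=> /andP [uT /eqP e] /eqP []; apply: (setD1_inj uT vT e).
Qed.

Lemma sum_simplex_d T (f : {set 'I_n} -> K) :
  \sum_S simplex_d T S * f S = \sum_(v in T) face_sgn T v * f (T :\ v).
Proof.
rewrite (eq_bigr (fun S => \sum_(v in T | T :\ v == S) face_sgn T v * f (T :\ v))).
  by rewrite -(partition_big (fun v => T :\ v) xpredT).
move=> S _; rewrite mulr_suml; apply: eq_bigr => v /andP [_ /eqP ->] //.
Qed.

Lemma face_sgnD1 T v w : v \in T ->
  face_sgn (T :\ v) w = face_sgn T w * (-1) ^+ (v < w)%N.
Proof.
move=> vT; rewrite /face_sgn [in RHS](cardsD1 v) !inE vT /=.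
rewrite (_ : [set x in T :\ v | (x < w)%N] = [set x in T | (x < w)%N] :\ v).
  by case: (v < w)%N; rewrite /= ?add0n ?add1n ?exprS ?expr0 ?mulr1 // mulrC mulrA mulrNN !mul1r.
by apply/setP=> x; rewrite !inE andbA.
Qed.

(** Deleting [v] and then [w] cancels against deleting [w] and then [v]. *)
Lemma simplex_dd T S : \sum_R simplex_d T R * simplex_d R S = 0.
Proof.
rewrite sum_simplex_d.
(* [F v w] is the term of first deleting [v] and then [w] *)
pose F (v w : 'I_n) : K :=
  if [&& v \in T, w \in T, v != w & T :\ v :\ w == S]
  then face_sgn T v * (face_sgn T w * (-1) ^+ (v < w)%N) else 0.
have FE v : v \in T -> face_sgn T v * simplex_d (T :\ v) S = \sum_w F v w.
  move=> vT; rewrite /simplex_d mulr_sumr big_mkcond; apply: eq_bigr => w _.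
  by rewrite /F vT !inE eq_sym; case: eqVneq; case: (w \in T) => //=; rewrite face_sgnD1.
rewrite (eq_bigr _ FE) big_mkcond /=.
rewrite (eq_bigr (fun v => \sum_w F v w)); last first.
  by move=> v _; case: ifP => // vT; rewrite big1 // => w _; rewrite /F vT.
have F0 v w : (v == w) -> F v w = 0 by rewrite /F => ->; rewrite !andbF.
have anti (v w : 'I_n) : (v < w)%N -> F w v = - F v w.
  move=> vw; rewrite /F eq_sym setDDl setUC -setDDl.
  have -> : (w < v)%N = false by lia.
  rewrite vw; case: (v \in T); case: (w \in T); rewrite ?oppr0 //=.
  by case: ifP; rewrite ?oppr0 // expr0 expr1 mulr1 !mulrN1 mulrN opprK mulrC.
rewrite (eq_bigr (fun v : 'I_n => \sum_(w : 'I_n | (v < w)%N) F v w + \sum_(w : 'I_n | (w < v)%N) F v w)).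
  rewrite big_split /= [X in _ + X](exchange_big_dep xpredT) //= -big_split /=.
  rewrite big1 // => v _; rewrite -big_split /= big1 // => w vw.
  by rewrite (anti v w vw) subrr.
move=> v _; rewrite (bigID (fun w : 'I_n => (v < w)%N)) /=; congr (_ + _).
rewrite (bigID (fun w => w == v)) /= big1 ?add0r.
  by apply: eq_bigl => w; rewrite -(inj_eq val_inj) /=; lia.
by move=> w /andP [_ /eqP ->]; rewrite F0.
Qed.

Definition convex (A : {set {set 'I_n}}) := forall R S T,
  R \in A -> T \in A -> R \subset S -> S \subset T -> S \in A.

(** A convex family is the difference of two simplicial complexes. *)
Lemma convex_complex A : convex A -> is_complex simplex_d A.
Proof.
move=> cA T R TA RA; rewrite -[RHS](simplex_dd T R) big_mkcond /=.
apply: eq_bigr => S _; case: ifP => // SA.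
have [->|/simplex_d_neq0 [v _ eS]] := eqVneq (simplex_d T S) 0; first by rewrite mul0r.
have [->|/simplex_d_neq0 [w _ eR]] := eqVneq (simplex_d S R) 0; first by rewrite mulr0.
by rewrite (cA R S T) ?eR ?eS ?subsetDl // -?eS -?eR in SA.
Qed.

End Simplicial.

Section PairComplex.
Variables (K : fieldType) (r n : nat).
Local Notation simplex_d := (simplex_d K).
Local Notation X := ({set 'I_r} * {set 'I_n})%type.

Definition prod_deg (x : X) : nat := (#|x.1| + #|x.2|)%N.

(** The differential of the tensor product of the complexes of two simplices. *)
Definition prod_d (x y : X) : K :=
  simplex_d x.1 y.1 * (x.2 == y.2)%:R + (-1) ^+ #|x.1| * ((x.1 == y.1)%:R * simplex_d x.2 y.2).

Lemma prod_d_neq0 x y : prod_d x y != 0 ->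
  (exists2 l, l \in x.1 & y = (x.1 :\ l, x.2)) \/
  (exists2 v, v \in x.2 & y = (x.1, x.2 :\ v)).
Proof.
case: x y => [T S] [T' S'] /=; rewrite /prod_d /=.
have [->|/simplex_d_neq0 [l lT ->]] := eqVneq (simplex_d T T') 0; last first.
  have [->|_] := eqVneq S S'; first by left; exists l.
  rewrite mulr0 add0r (_ : (T == T :\ l) = false) ?mul0r ?mulr0 ?eqxx //.
  by apply/eqP => /setP /(_ l); rewrite !inE eqxx lT.
rewrite mul0r add0r; have [->|_] := eqVneq T T'; last by rewrite mul0r mulr0 eqxx.
have [->|/simplex_d_neq0 [l lT ->]] := eqVneq (simplex_d S S') 0; first by rewrite !mulr0 eqxx.
by right; exists l.
Qed.

Lemma prod_d_deg x y : prod_d x y != 0 -> prod_deg x = (prod_deg y).+1.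
Proof.
rewrite /prod_deg; case/prod_d_neq0 => [] [v vx ->] /=.
  by rewrite (cardsD1 v x.1) vx.
by rewrite (cardsD1 v x.2) vx addnS.
Qed.

Lemma prod_d_l (x : X) l : l \in x.1 -> prod_d x (x.1 :\ l, x.2) != 0.
Proof.
move=> lx; rewrite /prod_d /= eqxx mulr1 simplex_dD1 // (_ : (x.1 == x.1 :\ l) = false).
  by rewrite mul0r mulr0 addr0 face_sgn_neq0.
by apply/eqP => /setP /(_ l); rewrite !inE eqxx lx.
Qed.

Lemma prod_d_r (x : X) v : v \in x.2 -> prod_d x (x.1, x.2 :\ v) != 0.
Proof.
move=> vx; rewrite /prod_d /= eqxx mul1r simplex_dD1 // (_ : (x.2 == x.2 :\ v) = false).
  by rewrite mulr0 add0r mulf_neq0 ?signr_eq0 ?face_sgn_neq0.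
by apply/eqP => /setP /(_ v); rewrite !inE eqxx vx.
Qed.

Lemma prod_dd x z : \sum_y prod_d x y * prod_d y z = 0.
Proof.
case: x z => [T S] [T' S']; rewrite /prod_d /=.
pose a T1 := simplex_d T T1 * simplex_d T1 T'.
pose b S1 := simplex_d S S1 * simplex_d S1 S'.
rewrite (eq_bigr (fun y : X =>
   a y.1 * ((S == y.2)%:R * (y.2 == S')%:R) +
   (T == y.1)%:R * (y.1 == T')%:R * b y.2 +
   ((y.1 == T')%:R * (S == y.2)%:R *
      (simplex_d T y.1 * (-1) ^+ #|y.1| * simplex_d y.2 S') +
    (T == y.1)%:R * (y.2 == S')%:R * ((-1) ^+ #|T| * simplex_d S y.2 * simplex_d y.1 T')))); last first.
  move=> [T1 S1] _ /=; rewrite /a /b.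
  have [->|_] := eqVneq T T1; last by rewrite !(mul0r, mulr0, addr0); ring.
  have e : (-1) ^+ #|T1| * (-1) ^+ #|T1| = 1 :> K by rewrite -expr2 sqrr_sign.
  rewrite mulrDl !mulrDr; rewrite !mul1r.
  rewrite (_ : (-1) ^+ #|T1| * simplex_d S S1 * ((-1) ^+ #|T1| * ((T1 == T')%:R * simplex_d S1 S'))
     = ((-1) ^+ #|T1| * (-1) ^+ #|T1|) * ((T1 == T')%:R * (simplex_d S S1 * simplex_d S1 S'))); last by ring.
  by rewrite e; ring.
rewrite big_split /= [X in X + _]big_split /= [X in _ + X]big_split /=.
have p (F : {set 'I_r} -> {set 'I_n} -> K) :
  \sum_(y : X) F y.1 y.2 = \sum_T1 \sum_S1 F T1 S1 by rewrite pair_bigA.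
rewrite (p (fun T1 S1 => a T1 * ((S == S1)%:R * (S1 == S')%:R))).
rewrite (p (fun T1 S1 => (T == T1)%:R * (T1 == T')%:R * b S1)).
rewrite (p (fun T1 S1 => (T1 == T')%:R * (S == S1)%:R * (simplex_d T T1 * (-1) ^+ #|T1| * simplex_d S1 S'))).
rewrite (p (fun T1 S1 => (T == T1)%:R * (S1 == S')%:R * ((-1) ^+ #|T| * simplex_d S S1 * simplex_d T1 T'))).
have k1 (Z : finType) (z0 : Z) (f : Z -> K) : \sum_z (z == z0)%:R * f z = f z0.
  rewrite (bigD1 z0) //= eqxx mul1r big1 ?addr0 // => z /negbTE ->.
  by rewrite mul0r.
have k2 (Z : finType) (z0 : Z) (f : Z -> K) : \sum_z (z0 == z)%:R * f z = f z0.
  by rewrite -[RHS]k1; apply: eq_bigr => z _; rewrite eq_sym.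
rewrite exchange_big /= [X in X + _ + _]big1 ?add0r; last first.
  by move=> S1 _; rewrite -mulr_suml simplex_dd mul0r.
rewrite [X in X + _]big1 ?add0r; last first.
  by move=> T1 _; rewrite -mulr_sumr simplex_dd mulr0.
rewrite (eq_bigr (fun T1 => (T1 == T')%:R * (simplex_d T T1 * (-1) ^+ #|T1| * simplex_d S S'))); last first.
  by move=> T1 _; under eq_bigr do rewrite -mulrA; rewrite -mulr_sumr k2.
rewrite k1 [X in _ + X](eq_bigr (fun T1 => (T == T1)%:R * ((-1) ^+ #|T| * simplex_d S S' * simplex_d T1 T'))); last first.
  by move=> T1 _; under eq_bigr do rewrite -mulrA; rewrite -mulr_sumr k1.
rewrite k2; have [->|/simplex_d_deg ->] := eqVneq (simplex_d T T') 0.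
  by rewrite !mulr0 !mul0r addr0.
by rewrite exprS; ring.
Qed.

End PairComplex.

(** * Taylor and Koszul complexes in one multidegree *)

Section Toggle.
Variables (n : nat).
Implicit Types (S : {set 'I_n}) (v : 'I_n).

Definition toggle v S := if v \in S then S :\ v else v |: S.

Lemma toggleK v : involutive (toggle v).
Proof.
move=> S; rewrite /toggle; case: (boolP (v \in S)) => vS.
  by rewrite !inE eqxx /= setD1K.
by rewrite setU11 setU1K.
Qed.

Lemma toggleD1 v S : toggle v S :\ v = S :\ v.
Proof.
rewrite /toggle; case: ifP => vS.
  by apply/setP=> x; rewrite !inE; case: eqP.
by apply/setP=> x; rewrite !inE; case: eqP.
Qed.

Lemma in_toggle v S u : (u \in toggle v S) = (u \in S) (+) (u == v).
Proof.
rewrite /toggle; case: (boolP (v \in S)) => vS; rewrite !inE.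
  by case: eqP => [->|]; rewrite ?vS ?addbF.
by case: eqP => [->|]; rewrite ?(negbTE vS) ?addbF.
Qed.

Lemma simplex_d_toggle (K : fieldType) v S :
  (simplex_d K S (toggle v S) != 0) || (simplex_d K (toggle v S) S != 0).
Proof.
rewrite /toggle; case: ifP => vS; first by rewrite simplex_dD1 // face_sgn_neq0.
apply/orP; right; have := @simplex_dD1 K _ (v |: S) v (setU11 _ _).
by rewrite setU1K ?vS // => ->; exact: face_sgn_neq0.
Qed.

Lemma toggle_decr u v S : u \in S -> S :\ u != toggle v S ->
  (#|S :\ u :\ v| < #|S :\ v|)%N.
Proof.
move=> uS ne; apply: proper_card.
have uv : u != v by apply: contraNneq ne => e; move: uS; rewrite e /toggle => ->.
rewrite properE setSD ?subsetDl //=.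
by apply/subsetPn; exists u; rewrite !inE uS uv ?eqxx.
Qed.

(** A family closed under adding and deleting [v] is a cone with apex [v]. *)
Lemma toggle_acyclic (K : fieldType) v (A : {set {set 'I_n}}) :
  is_complex (@simplex_d K n) A -> (forall S, S \in A -> toggle v S \in A) ->
  forall i, hdim (fun S : {set 'I_n} => #|S|) (@simplex_d K n) A i = 0%N.
Proof.
move=> cA tA.
apply: (matching_acyclic (@simplex_d_deg _ _) (mu := toggle v) (w := fun T => #|T :\ v|)).
- exact: cA.
- by move=> T TA; split; rewrite ?toggleK ?toggleD1 ?simplex_d_toggle ?tA.
- by move=> T S _ _ /simplex_d_neq0 [u uT ->]; exact: toggle_decr.
Qed.

End Toggle.

Section Monomials.
Variable n : nat.
Implicit Types (a u w : 'X_{1..n}) (S : {set 'I_n}).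

Definition sqfree_mnm S : 'X_{1..n} := [multinom ((i \in S) : nat) | i < n].

Lemma sqfree_mnmE S i : sqfree_mnm S i = (i \in S) :> nat.
Proof. by rewrite mnmE. Qed.

Lemma mdeg_sqfree S : mdeg (sqfree_mnm S) = #|S|.
Proof.
rewrite mdegE -sum1_card [RHS]big_mkcond; apply: eq_bigr => i _.
by rewrite sqfree_mnmE; case: (i \in S).
Qed.

Lemma sqfree_mnmS S (T : {set _}) : S \subset T -> (sqfree_mnm S <= sqfree_mnm T)%MM.
Proof.
by move=> ST; apply/mnm_lepP => i; rewrite !sqfree_mnmE; case iS: (i \in S); rewrite // (subsetP ST).
Qed.

Definition up_closed (J : pred 'X_{1..n}) := forall u w, (u <= w)%MM -> J u -> J w.

(** The basis of the multidegree [a] part of the Koszul complex over the quotient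
    by [J]: the set [S] stands for the monomial of exponent [a - S] times the
    exterior product of the variables in [S]. *)
Definition koszul_fam (J : pred 'X_{1..n}) a : {set {set 'I_n}} :=
  [set S | (sqfree_mnm S <= a)%MM && ~~ J (a - sqfree_mnm S)%MM].

Lemma koszul_fam_convex J a : up_closed J -> convex (koszul_fam J a).
Proof.
move=> upJ R S T; rewrite !inE => /andP [Ra RJ] /andP [Ta TJ] RS ST.
apply/andP; split; first exact: lepm_trans (sqfree_mnmS ST) Ta.
apply: contra RJ; apply: upJ; apply/mnm_lepP => i; rewrite !mnmBE leq_sub2l //.
by have /mnm_lepP := sqfree_mnmS RS; apply.
Qed.

Section Generators.
Variables (r : nat) (m : 'I_r -> 'X_{1..n}).

Definition lcmm (T : {set 'I_r}) : 'X_{1..n} :=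
  [multinom (\max_(l in T) m l i)%N | i < n].

Definition in_ideal w : bool := [exists l, (m l <= w)%MM].

Lemma in_ideal_up : up_closed in_ideal.
Proof.
by move=> u w uw /existsP [l lu]; apply/existsP; exists l; apply: lepm_trans uw.
Qed.

Lemma lcmm_leP (T : {set 'I_r}) a : reflect (forall l, l \in T -> (m l <= a)%MM) (lcmm T <= a)%MM.
Proof.
apply: (iffP idP) => [/mnm_lepP H l lT|H].
  apply/mnm_lepP=> i; apply: leq_trans (H i); rewrite mnmE.
  exact: (@leq_bigmax_cond _ (mem T) (fun l => m l i) l lT).
apply/mnm_lepP=> i; rewrite mnmE; apply/bigmax_leqP => l /H /mnm_lepP; exact.
Qed.

Lemma lcmmS (T T' : {set 'I_r}) : T \subset T' -> (lcmm T <= lcmm T')%MM.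
Proof.
move=> TT'; apply/lcmm_leP=> l lT; apply/(lcmm_leP T'); rewrite ?lepm_refl //.
exact: (subsetP TT').
Qed.

Lemma lcmm0 : lcmm set0 = 0%MM.
Proof. by apply/mnmP=> i; rewrite mnmE big_set0 mnm0E. Qed.

End Generators.
End Monomials.

Section TaylorKoszul.
Variables (K : fieldType) (n r : nat) (m : 'I_r -> 'X_{1..n}) (a : 'X_{1..n}).
Local Notation X := ({set 'I_r} * {set 'I_n})%type.
Local Notation lcmm := (lcmm m).
Local Notation J := (in_ideal m).
Local Notation cd := (fun S : {set _} => #|S|).
Local Notation hd := (hdim (@prod_deg r n) (@prod_d K r n)).

(** The multidegree [a] part of the tensor product of the Taylor complex and the
    Koszul complex, a double complex which computes Tor on both sides. *)
Definition taylor_koszul_fam : {set X} := [set x | (lcmm x.1 + sqfree_mnm x.2 <= a)%MM].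

Lemma taylor_koszul_complex : is_complex (@prod_d K r n) taylor_koszul_fam.
Proof.
move=> x z xA zA; rewrite -[RHS](prod_dd K x z) big_mkcond /=.
apply: eq_bigr => y _; case: ifP => // /negbT yA.
have [->|/prod_d_neq0 H] := eqVneq (prod_d K x y) 0; first by rewrite mul0r.
case/negP: yA; move: xA; rewrite !inE; apply: lepm_trans.
apply/mnm_lepP => i; rewrite !mnmDE.
have /mnm_lepP /(_ i) l1 : (lcmm y.1 <= lcmm x.1)%MM.
  by apply: lcmmS; case: H => [] [v vx ->] //=; rewrite subsetDl.
have /mnm_lepP /(_ i) l2 : (sqfree_mnm y.2 <= sqfree_mnm x.2)%MM.
  by apply: sqfree_mnmS; case: H => [] [v vx ->] //=; rewrite subsetDl.
exact: leq_add.
Qed.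

Lemma tk_split (P : pred X) :
  let H := [set x in taylor_koszul_fam | P x] in
  [disjoint taylor_koszul_fam :\: H & H] /\
  taylor_koszul_fam = taylor_koszul_fam :\: H :|: H.
Proof.
move=> H; split; first by rewrite -setI_eq0 setIDAC setDIl setDv setI0.
apply/setP=> x; rewrite !inE; case: (_ <= _)%MM => //=.
by case: (P x).
Qed.

(** If the lcm of the first component [T] differs from [a] at the variable [v],
    then [v] can be added to and deleted from the second component; what is left
    are the pairs of an empty second component and a [T] whose lcm is [a]. *)
Lemma taylor_side i :
  hd taylor_koszul_fam i = hdim cd (@simplex_d K r) [set T | lcmm T == a] i.
Proof.
pose P (x : X) := lcmm x.1 == a.
have [dis AE] := tk_split P.
set H := [set x in taylor_koszul_fam | P x] in dis AE; set G := taylor_koszul_fam :\: H in dis AE.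
have cA := taylor_koszul_complex; rewrite AE in cA.
have GE x : (x \in G) = (x \in taylor_koszul_fam) && (lcmm x.1 != a).
  by rewrite in_setD {1}/H in_set /P; case: (x \in taylor_koszul_fam); rewrite ?andbT ?andbF.
have lea x : x \in taylor_koszul_fam -> (lcmm x.1 <= a)%MM.
  by rewrite inE; apply: lepm_trans; apply: lem_addr.
have GH g h : g \in G -> h \in H -> prod_d K g h = 0.
  rewrite GE => /andP [gA gne]; rewrite inE => /andP [_ /eqP ha].
  apply/eqP/negPn/negP => /prod_d_neq0 H0; case/negP: gne.
  apply/eqP/mnmP => j; apply/eqP; rewrite eqn_leq (mnm_lepP (lea _ gA)) /=.
  have: (lcmm h.1 <= lcmm g.1)%MM.
    by apply: lcmmS; case: H0 => [] [v _ ->] //=; rewrite subsetDl.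
  by rewrite ha => /mnm_lepP /(_ j).
have HE : H = (fun T : {set 'I_r} => (T, set0)) @: [set T | lcmm T == a].
  apply/setP=> -[T S]; rewrite !inE /P /=; apply/andP/imsetP.
    case=> le /eqP e; exists T; rewrite ?inE ?e //.
    congr (_, _); apply/setP=> v; rewrite inE; apply/negbTE/negP => vS.
    move/mnm_lepP/(_ v): le; rewrite e mnmDE sqfree_mnmE vS; lia.
  case=> T'; rewrite inE => /eqP e [-> ->]; rewrite e eqxx; split=> //.
  by apply/mnm_lepP => v; rewrite mnmDE sqfree_mnmE inE addn0.
rewrite AE (hdim_sub0 (@prod_d_deg _ _ _) dis cA GH); last first.
  (* the factor [n.+1] lets the size of the first component dominate, since
     deleting a generator may change the variable that is toggled *)
  pose v0 T := [pick v | (lcmm T v < a v)%N].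
  pose mu (x : X) := if v0 x.1 is Some v then (x.1, toggle v x.2) else x.
  pose w (x : X) := (#|x.1| * n.+1 +
    (if v0 x.1 is Some v then #|x.2 :\ v| else 0))%N.
  have v0P x : x \in G -> exists2 v, v0 x.1 = Some v & (lcmm x.1 v < a v)%N.
    rewrite GE => /andP [xA xne]; rewrite /v0; case: pickP => [v lt|none].
      by exists v.
    case/negP: xne; apply/eqP/mnmP=> j; apply/eqP.
    rewrite eqn_leq (mnm_lepP (lea _ xA)) /=.
    by have /= := none j; rewrite ltnNge => /negbFE.
  apply: (matching_acyclic (@prod_d_deg _ _ _) (mu := mu) (w := w)).
  - exact: complex_sub dis cA GH.
  - move=> x xG; have [v ev lv] := v0P x xG; rewrite /mu ev /= ev toggleK.
    split.
    + move: xG; rewrite !GE !inE /= => /andP [le ->]; rewrite andbT.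
      apply/mnm_lepP=> j; move/mnm_lepP/(_ j): le; rewrite !mnmDE !sqfree_mnmE in_toggle.
      case: (j =P v) => [->|_]; last by rewrite addbF.
      by move: lv; case: (v \in x.2) => /=; rewrite ?addn0 ?addn1 // => lv /ltnW.
    + by case: x {xG ev lv}.
    + by rewrite /w /= ev toggleD1.
    + rewrite /toggle; case: ifP => vx; first by rewrite prod_d_r.
      apply/orP; right; have /= := @prod_d_r K _ _ (x.1, v |: x.2) v (setU11 _ _).
      by rewrite setU1K ?vx //; case: x {xG ev lv vx}.
  - move=> x y xG yG /prod_d_neq0 xy ne.
    have [v ev _] := v0P x xG.
    case: xy ne => [] [l lx ->] /=; rewrite /w /mu ev /=.
      move=> _; rewrite (cardsD1 l x.1) lx.
      have : ((if v0 (x.1 :\ l) is Some v' then #|x.2 :\ v'| else 0) <= n)%N.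
        case: (v0 _) => [v'|] //; rewrite -[leqRHS](card_ord n); exact: max_card.
      by move=> le; apply: leq_trans (leq_addr _ _); rewrite mulnDl mul1n [X in (_ < X)%N]addnC ltn_add2l ltnS.
    by move=> ne; rewrite ltn_add2l toggle_decr //; apply: contraNneq ne => ->.
rewrite HE -[in LHS](addn0 i).
apply: hdim_image => [T T' [] //|T|T T' _ _].
  by rewrite /prod_deg /= cards0.
rewrite /prod_d /= eqxx mulr1 [X in _ * (_ * X)]big_pred0 ?mulr0 ?addr0 // => v.
by rewrite inE.
Qed.

(** If a generator divides [a - S], for [S] the second component, then it can be
    added to and deleted from the first component; what is left is the Koszul
    family, with an empty first component. *)
Lemma koszul_side i :
  hd taylor_koszul_fam i = hdim cd (@simplex_d K n) (koszul_fam J a) i.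
Proof.
pose P (x : X) := ~~ J (a - sqfree_mnm x.2)%MM.
have [dis AE] := tk_split P.
set H := [set x in taylor_koszul_fam | P x] in dis AE; set G := taylor_koszul_fam :\: H in dis AE.
have cA := taylor_koszul_complex; rewrite AE in cA.
have GE x : (x \in G) = (x \in taylor_koszul_fam) && J (a - sqfree_mnm x.2)%MM.
  rewrite in_setD {1}/H in_set /P.
  by case: (x \in taylor_koszul_fam); rewrite ?andbF ?andbT ?negbK.
have inA x : (x \in taylor_koszul_fam) =
    (sqfree_mnm x.2 <= a)%MM && [forall l in x.1, (m l <= a - sqfree_mnm x.2)%MM].
  rewrite inE; apply/idP/andP => [le|[lS /forall_inP H0]].
    split; first by apply: lepm_trans le; apply: lem_addl.
    apply/forall_inP => l lx; apply/mnm_lepP => j; rewrite mnmBE.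
    have /lcmm_leP /(_ l lx) /mnm_lepP /(_ j) := lepm_refl (lcmm x.1).
    by move/mnm_lepP/(_ j): le; rewrite mnmDE; lia.
  apply/mnm_lepP => j; rewrite mnmDE.
  have /lcmm_leP/mnm_lepP/(_ j) := H0; rewrite mnmBE.
  by move/mnm_lepP/(_ j): lS; lia.
have GH g h : g \in G -> h \in H -> prod_d K g h = 0.
  rewrite GE => /andP [gA gJ]; rewrite inE => /andP [_ /negP hJ].
  apply/eqP/negPn/negP => /prod_d_neq0 H0; case: hJ; apply: in_ideal_up gJ.
  have /mnm_lepP le : (sqfree_mnm h.2 <= sqfree_mnm g.2)%MM.
    by apply: sqfree_mnmS; case: H0 => [] [v _ ->] //=; rewrite subsetDl.
  by apply/mnm_lepP=> j; rewrite !mnmBE leq_sub2l.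
have HE : H = (fun S : {set 'I_n} => (set0, S)) @: koszul_fam J a.
  apply/setP=> -[T S]; rewrite inE inA /P /=; apply/andP/imsetP.
    case=> /andP [le /forall_inP T0] nJ; exists S; first by rewrite inE le nJ.
    congr (_, _); apply/setP=> l; rewrite inE; apply/negbTE/negP => lT.
    by case/negP: nJ; apply/existsP; exists l; exact: T0.
  case=> S'; rewrite inE => /andP [le nJ] [-> ->]; split=> //.
  by rewrite le; apply/forall_inP => l; rewrite inE.
rewrite AE (hdim_sub0 (@prod_d_deg _ _ _) dis cA GH); last first.
  (* the factor [r.+1] lets the size of the second component dominate *)
  pose l0 (S : {set 'I_n}) := [pick l | (m l <= a - sqfree_mnm S)%MM].
  pose mu (x : X) := if l0 x.2 is Some l then (toggle l x.1, x.2) else x.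
  pose w (x : X) := (#|x.2| * r.+1 +
    (if l0 x.2 is Some l then #|x.1 :\ l| else 0))%N.
  have l0P x : x \in G -> exists2 l, l0 x.2 = Some l & (m l <= a - sqfree_mnm x.2)%MM.
    rewrite GE => /andP [xA /existsP [l1 xJ]]; rewrite /l0; case: pickP => [l le|none].
      by exists l.
    by have /= := none l1; rewrite xJ.
  apply: (matching_acyclic (@prod_d_deg _ _ _) (mu := mu) (w := w)).
  - exact: complex_sub dis cA GH.
  - move=> x xG; have [l el lel] := l0P x xG; rewrite /mu el /= el toggleK.
    split.
    + move: xG; rewrite !GE !inA /= => /andP [/andP [-> /forall_inP H0] ->].
      rewrite andbT; apply/forall_inP => l'; rewrite in_toggle.
      by case: (l' =P l) => [->|_] //; rewrite addbF; exact: H0.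
    + by case: x {xG el lel}.
    + by rewrite /w /= el toggleD1.
    + rewrite /toggle; case: ifP => lx; first by rewrite prod_d_l.
      apply/orP; right; have /= := @prod_d_l K _ _ (l |: x.1, x.2) l (setU11 _ _).
      by rewrite setU1K ?lx //; case: x {xG el lel lx}.
  - move=> x y xG yG /prod_d_neq0 xy ne.
    have [l el _] := l0P x xG.
    case: xy ne => [] [v vx ->] /=; rewrite /w /mu el /=; last first.
      move=> _; rewrite (cardsD1 v x.2) vx.
      have : ((if l0 (x.2 :\ v) is Some l' then #|x.1 :\ l'| else 0) <= r)%N.
        case: (l0 _) => [v'|] //; rewrite -[leqRHS](card_ord r); exact: max_card.
      by move=> le; apply: leq_trans (leq_addr _ _); rewrite mulnDl mul1n [X in (_ < X)%N]addnC ltn_add2l ltnS.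
    by move=> ne; rewrite ltn_add2l toggle_decr //; apply: contraNneq ne => ->.
rewrite HE -[in LHS](addn0 i).
apply: hdim_image => [S S' [] //|S|S S' _ _].
  by rewrite /prod_deg /= cards0 addn0.
rewrite /prod_d /= cards0 expr0 eqxx !mul1r [X in X * _]big_pred0 ?mul0r ?add0r // => v.
by rewrite inE.
Qed.

Lemma taylor_koszul i :
  hdim cd (@simplex_d K r) [set T | lcmm T == a] i = hdim cd (@simplex_d K n) (koszul_fam J a) i.
Proof. by rewrite -taylor_side koszul_side. Qed.

End TaylorKoszul.

(** * Graded Betti numbers are independent of the resolution *)

Section HomogeneousComponent.
Variables (K : fieldType) (n : nat).
Local Notation R := {mpoly K[n]}.
Implicit Types (p q : R) (e f : int).

(** The homogeneous component, of integral degree since the degrees of the basis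
    elements of a resolution are integers. *)
Definition hcomp e p : R :=
  \sum_(w <- msupp p | (mdeg w)%:Z == e) p@_w *: 'X_[w].

Lemma mcoeff_hcomp e p w :
  (hcomp e p)@_w = if (mdeg w)%:Z == e then p@_w else 0.
Proof.
rewrite /hcomp raddf_sum /=.
have [we|we] := boolP ((mdeg w)%:Z == e); last first.
  rewrite big1 // => u ue; rewrite mcoeffZ mcoeffX.
  case: eqP => [eu|_]; last by rewrite mulr0.
  by rewrite -eu ue in we.
have [wp|wp] := boolP (w \in msupp p).
  rewrite big_mkcond (bigD1_seq w) ?msupp_uniq //= we mcoeffZ mcoeffX eqxx mulr1.
  rewrite big1 ?addr0 // => u /negbTE nu; case: ifP => // _.
  by rewrite mcoeffZ mcoeffX nu mulr0.
rewrite (memN_msupp_eq0 wp) big1_seq // => u /andP [_ up].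
rewrite mcoeffZ mcoeffX; case: eqP => [eu|]; last by rewrite mulr0.
by rewrite eu (negbTE wp) in up.
Qed.

Definition mono_deg f p := forall w, w \in msupp p -> (mdeg w)%:Z = f.

Lemma hcomp_homog e p : mono_deg e (hcomp e p).
Proof.
move=> w; rewrite mcoeff_msupp mcoeff_hcomp.
by case: ifP => [/eqP|_]; rewrite ?eqxx.
Qed.

Lemma hcomp_id e p : mono_deg e p -> hcomp e p = p.
Proof.
move=> hp; apply/mpolyP => w; rewrite mcoeff_hcomp.
by case: eqP => // ne; rewrite memN_msupp_eq0 //; apply/negP => /hp.
Qed.

(** Multiplication by a homogeneous polynomial shifts components.  Hence the
    components of the expected degrees of any lift through a homogeneous matrix
    form a homogeneous lift ([lift_homog]). *)
Lemma hcompM e f p q : mono_deg f q -> hcomp (e + f) (p * q) = hcomp e p * q.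
Proof.
move=> hq; apply/mpolyP => w; rewrite mcoeff_hcomp !(mcoeffM).
have [we|we] := eqVneq (mdeg w)%:Z (e + f).
  apply: eq_bigr => -[k1 k2] /= /eqP wE; rewrite mcoeff_hcomp.
  have [k2q|/memN_msupp_eq0 ->] := boolP ((k2 : 'X_{1..n}) \in msupp q); last by rewrite !mulr0.
  suff -> : (mdeg k1)%:Z == e by [].
  by have := hq _ k2q; have := congr1 (@mdeg n) wE; move: we; rewrite mdegD; lia.
rewrite big1 // => -[k1 k2] /= /eqP wE; rewrite mcoeff_hcomp.
have [k2q|/memN_msupp_eq0 ->] := boolP ((k2 : 'X_{1..n}) \in msupp q); last by rewrite !mulr0.
case: eqP => [e1|_]; last by rewrite mul0r.
by have := hq _ k2q; have := congr1 (@mdeg n) wE; move: we; rewrite mdegD; lia.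
Qed.

Lemma hcomp_sum e (T : finType) (F : T -> R) :
  hcomp e (\sum_t F t) = \sum_t hcomp e (F t).
Proof.
apply/mpolyP => w; rewrite mcoeff_hcomp.
have s (E : T -> R) : (\sum_t E t)@_w = \sum_t (E t)@_w by exact: raddf_sum.
rewrite !s; case: ifP => we; last by rewrite big1 // => t _; rewrite mcoeff_hcomp we.
by apply: eq_bigr => t _; rewrite mcoeff_hcomp we.
Qed.

Lemma hcompB e p q : hcomp e (p - q) = hcomp e p - hcomp e q.
Proof.
apply/mpolyP => w; rewrite mcoeffB !mcoeff_hcomp mcoeffB.
by case: ifP; rewrite ?subr0.
Qed.

Definition hcomp_mx r s (a : 'I_r -> int) (b : 'I_s -> int) (A : 'M[R]_(r, s)) :=
  \matrix_(k, l) hcomp (a k - b l) (A k l).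

Lemma hcomp_mx_homog r s a b (A : 'M[R]_(r, s)) :
  homogeneous_mx a b (hcomp_mx a b A).
Proof. by move=> k l w; rewrite mxE => /hcomp_homog ->; rewrite subrK. Qed.

Lemma homogeneous_mxP r s a b (A : 'M[R]_(r, s)) k l :
  homogeneous_mx a b A -> mono_deg (a k - b l) (A k l).
Proof. by move=> hA w /hA <-; rewrite addrK. Qed.

Lemma hcomp_mx_id r s a b (A : 'M[R]_(r, s)) :
  homogeneous_mx a b A -> hcomp_mx a b A = A.
Proof.
by move=> hA; apply/matrixP => k l; rewrite mxE hcomp_id //; apply: homogeneous_mxP.
Qed.

Lemma hcomp_mxM r s t a b c (A : 'M[R]_(r, s)) (B : 'M[R]_(s, t)) :
  homogeneous_mx b c B -> hcomp_mx a c (A *m B) = hcomp_mx a b A *m B.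
Proof.
move=> hB; apply/matrixP => k l; rewrite !mxE hcomp_sum.
apply: eq_bigr => i _; rewrite !mxE -(hcompM _ _ (homogeneous_mxP (k := i) (l := l) hB)).
by rewrite addrA subrK.
Qed.

End HomogeneousComponent.

Record graded_ideal (K : fieldType) (n : nat) (I : {mpoly K[n]} -> Prop) : Prop :=
  GradedIdeal {
    gi_0 : I 0;
    gi_add : forall p q, I p -> I q -> I (p + q);
    gi_mul : forall p q, I q -> I (p * q);
    gi_hcomp : forall e p, I p -> I (hcomp e p)
  }.

(** Chain maps and homotopies are built degree by degree from lifts that merely
    exist. *)
Lemma dependent_choice_from (T : nat -> Type) (P : forall i, T i -> Prop)
    (Q : forall i, T i -> T i.+1 -> Prop) (x0 : T 0%N) :
  P 0%N x0 -> (forall i x, P i x -> exists y, P i.+1 y /\ Q i x y) ->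
  exists f : forall i, T i,
    [/\ f 0%N = x0, forall i, P i (f i) & forall i, Q i (f i) (f i.+1)].
Proof.
move=> P0 step.
have step' i (x : {x : T i | P i x}) :
    {y : {y : T i.+1 | P i.+1 y} | Q i (sval x) (sval y)}.
  apply: constructive_indefinite_description.
  case: x => x Px; have [y [Py Qxy]] := step i x Px.
  by exists (exist _ y Py).
pose g := nat_rect (fun i => {x : T i | P i x}) (exist _ x0 P0)
  (fun i x => sval (step' i x)).
exists (fun i => sval (g i)); split=> // i; first exact: (svalP (g i)).
exact: (svalP (step' i (g i))).
Qed.

Lemma mul_rows_lift (R : pzRingType) r s t (A : 'M[R]_(r, t)) (D : 'M[R]_(s, t)) :
  (forall k, exists w : 'rV_s, row k A = w *m D) -> exists X, A = X *m D.
Proof.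
move=> H; have [w hw] := fin_all_exists H.
exists (\matrix_k w k); apply/row_matrixP => k.
by rewrite row_mul rowK.
Qed.

Section Comparison.
Variables (K : fieldType) (n : nat) (I : {mpoly K[n]} -> Prop).
Hypothesis idI : graded_ideal I.
Local Notation R := {mpoly K[n]}.
Implicit Types F G : graded_resolution I.

Lemma ideal_sum (T : finType) (E : T -> R) :
  (forall t, I (E t)) -> I (\sum_t E t).
Proof. by move=> H; apply: big_ind => //; [exact: gi_0|exact: gi_add]. Qed.

Lemma ideal_opp p : I p -> I (- p).
Proof. by move=> Ip; rewrite -mulN1r; apply: gi_mul. Qed.

(** The vectors of [F_i] on which the map out of [F_i] vanishes, this map having
    its values in R/I for [i = 0]. *)
Definition syz F i : 'rV[R]_(gr_rank F i) -> Prop :=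
  match i return 'rV[R]_(gr_rank F i) -> Prop with
  | 0 => fun v => I ((v *m gr_aug F) 0 0)
  | i'.+1 => fun v => v *m gr_diff F i' = 0
  end.

Lemma syzP F i (v : 'rV_(gr_rank F i)) :
  syz v <-> exists w, v = w *m gr_diff F i.
Proof. by case: i v => [|i] v; [exact: gr_exact0|exact: gr_exactS]. Qed.

Lemma diff_diff F i : gr_diff F i.+1 *m gr_diff F i = 0.
Proof.
apply/row_matrixP => k; rewrite row_mul row0.
by apply/gr_exactS; exists (delta_mx 0 k); rewrite -rowE.
Qed.

Lemma lift_homog r s t a b c (A : 'M[R]_(r, t)) (D : 'M[R]_(s, t)) :
  homogeneous_mx a c A -> homogeneous_mx b c D ->
  (forall k, exists w : 'rV_s, row k A = w *m D) ->
  exists2 X, homogeneous_mx a b X & A = X *m D.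
Proof.
move=> hA hD /mul_rows_lift [X eX]; exists (hcomp_mx a b X).
  exact: hcomp_mx_homog.
by rewrite -(hcomp_mxM _ _ hD) -eX hcomp_mx_id.
Qed.

Lemma homogeneous_mxM r s t a b c (A : 'M[R]_(r, s)) (B : 'M[R]_(s, t)) :
  homogeneous_mx a b A -> homogeneous_mx b c B -> homogeneous_mx a c (A *m B).
Proof.
move=> hA hB; rewrite -(hcomp_mx_id hA) -(hcomp_mxM _ _ hB).
exact: hcomp_mx_homog.
Qed.

(** The identity of R/I lifts to a homogeneous chain map: in each degree the
    image of a basis vector is a syzygy of the target, hence a boundary. *)
Lemma comparison F G :
  exists f : forall i, 'M[R]_(gr_rank F i, gr_rank G i),
    [/\ forall k, I ((gr_aug F - f 0%N *m gr_aug G) k 0),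
        forall i, homogeneous_mx (@gr_deg _ _ _ F i) (@gr_deg _ _ _ G i) (f i)
      & forall i, gr_diff F i *m f i = f i.+1 *m gr_diff G i].
Proof.
have [f0 [f0h f0a]] : exists f0 : 'M[R]_(gr_rank F 0, gr_rank G 0),
    homogeneous_mx (@gr_deg _ _ _ F 0) (@gr_deg _ _ _ G 0) f0 /\
    forall k, I ((gr_aug F - f0 *m gr_aug G) k 0).
  have H k := @gr_aug_surjective _ _ _ G (gr_aug F k 0).
  have [w hw] := fin_all_exists H.
  exists (hcomp_mx (@gr_deg _ _ _ F 0) (@gr_deg _ _ _ G 0) (\matrix_k w k)).
  split; first exact: hcomp_mx_homog.
  move=> k; rewrite -(hcomp_mxM _ _ (gr_aug_homogeneous (g := G))).
  rewrite !mxE -[gr_aug F k 0](hcomp_id (e := gr_deg k - 0)).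
    rewrite -hcompB; apply: gi_hcomp => //.
    have := hw k; rewrite !mxE; congr (I (_ - _)).
    by apply: eq_bigr => j _; rewrite !mxE.
  by move=> u /(gr_aug_homogeneous (g := F)) <-; rewrite addr0 subr0.
pose P i (f : 'M[R]_(gr_rank F i, gr_rank G i)) :=
  homogeneous_mx (@gr_deg _ _ _ F i) (@gr_deg _ _ _ G i) f /\
  forall v : 'rV_(gr_rank F i), syz v -> syz (v *m f).
pose Q i (f : 'M[R]_(gr_rank F i, gr_rank G i))
         (f' : 'M[R]_(gr_rank F i.+1, gr_rank G i.+1)) :=
  gr_diff F i *m f = f' *m gr_diff G i.
have P0 : P 0%N f0.
  split=> // v /= Iv.
  have -> : v *m f0 *m gr_aug G =
      v *m gr_aug F - v *m (gr_aug F - f0 *m gr_aug G).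
    by rewrite mulmxBr subKr mulmxA.
  rewrite mxE [X in _ + X]mxE; apply: gi_add => //; apply: ideal_opp.
  by rewrite mxE; apply: ideal_sum => k; apply: gi_mul.
have step i f : P i f -> exists f', P i.+1 f' /\ Q i f f'.
  case=> fh fz.
  have [f' f'h f'E] : exists2 f', homogeneous_mx (@gr_deg _ _ _ F i.+1)
      (@gr_deg _ _ _ G i.+1) f' & gr_diff F i *m f = f' *m gr_diff G i.
    apply: lift_homog.
    - exact: homogeneous_mxM (gr_diff_homogeneous (g := F) (i := i)) fh.
    - exact: gr_diff_homogeneous.
    - move=> k; rewrite row_mul; apply/syzP/fz/syzP.
      by exists (delta_mx 0 k); rewrite -rowE.
  exists f'; split=> //; split=> // v /= vz.
  by rewrite -mulmxA -f'E mulmxA vz mul0mx.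
have [f [fE fP fQ]] := dependent_choice_from P0 step.
exists f; split=> [k|i|//]; first by rewrite fE.
by case: (fP i).
Qed.

(** A chain map lifting zero is null-homotopic, by the same degreewise lifting.
    The homotopy is not required to be homogeneous: taking constant
    coefficients and projecting to degree [j] is harmless in [tor_dim_le]. *)
Lemma null_homotopic F (phi : forall i, 'M[R]_(gr_rank F i)) :
  (forall k, I ((phi 0%N *m gr_aug F) k 0)) ->
  (forall i, gr_diff F i *m phi i = phi i.+1 *m gr_diff F i) ->
  exists h : forall i, 'M[R]_(gr_rank F i, gr_rank F i.+1),
    phi 0%N = h 0%N *m gr_diff F 0 /\
    forall i, phi i.+1 = gr_diff F i *m h i + h i.+1 *m gr_diff F i.+1.
Proof.
move=> phi0 phiC.
have [h0 h0E] : exists h0, phi 0%N = h0 *m gr_diff F 0.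
  apply: mul_rows_lift => k; apply/gr_exact0.
  by rewrite -row_mul mxE.
pose P i (h : 'M[R]_(gr_rank F i, gr_rank F i.+1)) :=
  gr_diff F i *m (phi i - h *m gr_diff F i) = 0.
pose Q i (h : 'M[R]_(gr_rank F i, gr_rank F i.+1))
         (h' : 'M[R]_(gr_rank F i.+1, gr_rank F i.+2)) :=
  phi i.+1 = gr_diff F i *m h + h' *m gr_diff F i.+1.
have P0 : P 0%N h0 by rewrite /P -h0E subrr mulmx0.
have step i h : P i h -> exists h', P i.+1 h' /\ Q i h h'.
  move=> Ph.
  have [h' h'E] : exists h', phi i.+1 - gr_diff F i *m h = h' *m gr_diff F i.+1.
    apply: mul_rows_lift => k; apply/gr_exactS; rewrite -row_mul mulmxBl -phiC.
    by rewrite -mulmxA -mulmxBr Ph row0.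
  have e : phi i.+1 = gr_diff F i *m h + h' *m gr_diff F i.+1.
    by rewrite -h'E addrC subrK.
  exists h'; split=> //.
  by rewrite /P e addrK mulmxA diff_diff mul0mx.
have [h [hE _ hQ]] := dependent_choice_from P0 step.
by exists h; split=> //; rewrite hE.
Qed.

(** A map [f] that sends [Z] into [Z'] and whose preimage of [B'] meets [Z] inside
    [B] embeds [Z / B] into [Z' / B']. *)
Lemma rank_quotient_le (p q a b : nat) (Z : 'M[K]_(p, a)) (B : 'M[K]_(q, a))
   (p' q' : nat) (Z' : 'M[K]_(p', b)) (B' : 'M[K]_(q', b)) (f : 'M[K]_(a, b)) :
  (Z *m f <= Z')%MS -> (B' <= Z')%MS ->
  (forall z : 'rV_a, (z <= Z)%MS -> (z *m f <= B')%MS -> (z <= B)%MS) ->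
  (\rank Z - \rank B <= \rank Z' - \rank B')%N.
Proof.
move=> Zf BZ ker; pose C := cokermx B'.
have e1 := mxrank_mul_ker Z (f *m C).
have e2 := mxrank_mul_ker Z' C.
have l1 : (\rank (Z *m (f *m C)) <= \rank (Z' *m C))%N.
  by rewrite mulmxA; apply: mxrankS; exact: submxMr.
have l2 : (\rank (Z :&: kermx (f *m C)) <= \rank B)%N.
  apply: mxrankS; apply/rV_subP => z; rewrite sub_capmx => /andP [zZ /sub_kermxP].
  by rewrite mulmxA => zf; apply: ker => //; rewrite submxE; apply/eqP.
have l3 : (\rank B' <= \rank (Z' :&: kermx C))%N.
  by apply: mxrankS; rewrite sub_capmx BZ /=; apply/sub_kermxP; exact: mulmx_coker.
lia.
Qed.

Local Notation tc := (map_mx (@mcoeff n K 0%MM)).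

Definition comp_mx r (a : 'I_r -> int) (j : int) : 'M[K]_r :=
  diag_mx (\row_k (a k == j)%:R).

(** A constant term of a homogeneous matrix joins only basis vectors of equal
    degrees. *)
Lemma comp_mx_comm r s a b (A : 'M[R]_(r, s)) j : homogeneous_mx a b A ->
  comp_mx a j *m tc A = tc A *m comp_mx b j.
Proof.
move=> hA; apply/matrixP => k l; rewrite mul_diag_mx mul_mx_diag !mxE.
have [z|nz] := boolP (0%MM \in msupp (A k l)); last first.
  by rewrite memN_msupp_eq0 // mulr0 mul0r.
by rewrite -(hA k l _ z) mdeg0 add0r mulrC.
Qed.

Lemma comp_mx_idem r (a : 'I_r -> int) j : comp_mx a j *m comp_mx a j = comp_mx a j.
Proof.
apply/matrixP => k l; rewrite mul_diag_mx !mxE.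
by case: (k == l); case: (a k == j); rewrite /= ?mulr1n ?mulr0n ?mulr0 ?mulr1 // !mul0r.
Qed.

Lemma sub_comp_mx r (a : 'I_r -> int) j (z : 'rV[K]_r) :
  (z <= comp_mx a j)%MS -> z *m comp_mx a j = z.
Proof. by case/submxP => y ->; rewrite -mulmxA comp_mx_idem. Qed.

Lemma tor_cyclesP F i j (z : 'rV_(gr_rank F i)) :
  (z <= tensor_cycles F i j)%MS <->
  z *m comp_mx (@gr_deg _ _ _ F i) j = z /\
  match i return 'rV_(gr_rank F i) -> Prop with
  | 0 => fun=> True | i'.+1 => fun z => z *m tensor_diff F i' = 0 end z.
Proof.
case: i z => [|i] z /=; first split=> [/sub_comp_mx //|[<- _]].
- exact: submxMl.
- rewrite sub_capmx; split=> [/andP [/sub_comp_mx -> /sub_kermxP] //|[e zd]].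
  apply/andP; split; first by rewrite -e submxMl.
  exact/sub_kermxP.
Qed.

Lemma tor_boundaries_cycles F i j :
  (tensor_boundaries F i j <= tensor_cycles F i j)%MS.
Proof.
apply/rV_subP => z /submxP [y ->] {z}; apply/tor_cyclesP.
rewrite /tensor_boundaries -/(comp_mx _ _).
have c := comp_mx_comm j (gr_diff_homogeneous (g := F) (i := i)).
split; first by rewrite -!mulmxA -c [comp_mx _ _ *m (_ *m _)]mulmxA comp_mx_idem.
case: i y c => [|i] y c //.
rewrite -!mulmxA -map_mxM diff_diff (_ : tc 0 = 0) ?mulmx0 //.
by apply/matrixP => k l; rewrite !mxE mcoeff0.
Qed.

(** Compare [F] and [G] both ways: the composite is homotopic to the identity of
    [F], so the map from Tor computed by [F] to Tor computed by [G] is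
    injective. *)
Lemma tor_dim_le F G i j : (tor_dim F i j <= tor_dim G i j)%N.
Proof.
have [f [f0 fh fC]] := comparison F G; have [g [g0 _ gC]] := comparison G F.
pose phi i := f i *m g i - 1%:M.
have phi0 k : I ((phi 0%N *m gr_aug F) k 0).
  rewrite /phi mulmxBl mul1mx.
  have -> : f 0%N *m g 0%N *m gr_aug F - gr_aug F =
      - (f 0%N *m (gr_aug G - g 0%N *m gr_aug F) + (gr_aug F - f 0%N *m gr_aug G)).
    by rewrite mulmxBr !mulmxA opprD opprB opprB addrA subrK.
  rewrite mxE; apply: ideal_opp => //; rewrite mxE; apply: gi_add => //.
  by rewrite mxE; apply: ideal_sum => l; apply: gi_mul.
have phiC l : gr_diff F l *m phi l = phi l.+1 *m gr_diff F l.
  by rewrite /phi mulmxBr mulmxBl mulmx1 mul1mx mulmxA fC -!mulmxA gC.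
have [h [h0 hS]] := null_homotopic phi0 phiC.
pose E l := comp_mx (@gr_deg _ _ _ F l) j.
have dE l : E l.+1 *m tensor_diff F l = tensor_diff F l *m E l.
  exact: comp_mx_comm (gr_diff_homogeneous (g := F) (i := l)).
apply: (rank_quotient_le (f := tc (f i))).
- apply/rV_subP => y /submxP [x ->]; rewrite mulmxA.
  have /tor_cyclesP : (x *m tensor_cycles F i j <= tensor_cycles F i j)%MS by exact: submxMl.
  set z := x *m _ => -[zE zd]; apply/tor_cyclesP; split.
    by rewrite -[in LHS]mulmxA -(comp_mx_comm j (fh i)) mulmxA zE.
  move: z zE zd; clear x y; case: i => // l z _ zd.
  by rewrite -mulmxA -map_mxM -fC map_mxM mulmxA zd mul0mx.
- exact: tor_boundaries_cycles.
- move=> z /tor_cyclesP [zE zd] zB.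
  (* on cycles the homotopy leaves only a boundary *)
  have zphi : (z *m tc (phi i) *m E i <= tensor_boundaries F i j)%MS.
    have key (y : 'rV_(gr_rank F i.+1)) :
        (y *m tensor_diff F i *m E i <= tensor_boundaries F i j)%MS.
      by rewrite -mulmxA -dE; exact: submxMl.
    move: z zE zd zB key; case: i => [|l] z zE zd zB key.
      by rewrite h0 map_mxM mulmxA; exact: key.
    rewrite hS map_mxD mulmxDr !map_mxM !mulmxA zd mul0mx add0r; exact: key.
  have zfg : (z *m tc (f i) *m tc (g i) *m E i <= tensor_boundaries F i j)%MS.
    have /submxP [y ->] := zB; rewrite /tensor_boundaries /tensor_diff -!mulmxA.
    rewrite [tc _ *m (tc _ *m _)]mulmxA -map_mxM gC map_mxM -!mulmxA.
    rewrite -/(tensor_diff F i) -(dE i).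
    by do 3!apply: mulmx_sub; exact: submx_refl.
  have -> : z = z *m tc (f i) *m tc (g i) *m E i - z *m tc (phi i) *m E i.
    rewrite /phi map_mxB map_mxM map_mx1 mulmxBr mulmx1 mulmxBl mulmxA.
    by rewrite subKr zE.
  by rewrite addmx_sub // eqmx_opp.
Qed.

Lemma tor_dim_unique F G i j : tor_dim F i j = tor_dim G i j.
Proof. by apply/eqP; rewrite eqn_leq !tor_dim_le. Qed.

Lemma bettiE F (i : nat) (j : int) : betti I i j = tor_dim F i j.
Proof.
rewrite /betti; have [|G <-] := epsilon_spec (inhabits 0%N)
  (fun b => exists F0 : graded_resolution I, tor_dim F0 i j = b).
  by exists (tor_dim F i j), F.
exact: tor_dim_unique.
Qed.

End Comparison.

(** * The Taylor resolution of a monomial ideal *)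

Lemma rank_castmx (K : fieldType) p q p' q' (e : (p = p') * (q = q')) (M : 'M[K]_(p, q)) :
  \rank (castmx e M) = \rank M.
Proof. by case: e => e1 e2; case: p' / e1; case: q' / e2. Qed.

Lemma rank_fun_rank (K : fieldType) (X Y : finType) p q (f : 'I_p -> X) (f' : 'I_q -> Y)
    (g : X -> Y -> K) (M : 'M[K]_(p, q)) :
  injective f -> injective f' ->
  (forall x y, g x y != 0 -> x \in codom f /\ y \in codom f') ->
  (forall k l, M k l = g (f k) (f' l)) -> \rank M = fun_rank g.
Proof.
move=> fI f'I supp ME; rewrite -(fun_rank_reindex fI f'I supp) /fun_rank.
rewrite -(rank_castmx (esym (card_ord p), esym (card_ord q)) M); congr (\rank _).
apply/matrixP => k l; rewrite castmxE !mxE ME.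
by congr (g (f _) (f' _)); rewrite enum_val_ord; apply: val_inj.
Qed.

Lemma mdeg_le_eq n (u w : 'X_{1..n}) : (u <= w)%MM -> mdeg u = mdeg w -> u = w.
Proof.
move=> uw; have e := submK uw; rewrite -[in mdeg w]e mdegD => /esym/eqP.
rewrite -{2}[mdeg u]add0n eqn_add2r mdeg_eq0 => /eqP z.
by rewrite -e z add0m.
Qed.

Section Taylor.
Variables (K : fieldType) (n r : nat) (m : 'I_r -> 'X_{1..n}).
Local Notation R := {mpoly K[n]}.
Local Notation lcmm := (lcmm m).
Local Notation J := (in_ideal m).
Local Notation simplex_d := (@simplex_d K r).
Local Notation cd := (fun S : {set _} => #|S|).
Variable I : R -> Prop.
Hypothesis IE : forall p, I p <-> exists w : 'I_r -> R, p = \sum_l w l * 'X_[m l].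
Implicit Types (T S : {set 'I_r}) (a : 'X_{1..n}).

Lemma monomial_ideal_graded : graded_ideal I.
Proof.
split.
- by apply/IE; exists (fun=> 0); rewrite big1 // => l _; rewrite mul0r.
- move=> p q /IE [w ->] /IE [u ->]; apply/IE; exists (fun l => w l + u l).
  by rewrite -big_split; apply: eq_bigr => l _; rewrite mulrDl.
- move=> p q /IE [w ->]; apply/IE; exists (fun l => p * w l).
  by rewrite mulr_sumr; apply: eq_bigr => l _; rewrite mulrA.
- move=> e p /IE [w ->]; apply/IE; exists (fun l => hcomp (e - (mdeg (m l))%:Z) (w l)).
  rewrite hcomp_sum; apply: eq_bigr => l _.
  rewrite -(@hcompM _ _ _ (mdeg (m l))%:Z) ?subrK // => u.
  by rewrite msuppX inE => /eqP ->.
Qed.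

Lemma monomial_ideal_supp p a : I p -> ~~ J a -> p@_a = 0.
Proof.
case/IE => w -> nJ; rewrite (raddf_sum (mcoeff a)) big1 // => l _ /=.
rewrite mcoeffM big1 // => -[k1 k2] /= /eqP aE; rewrite mcoeffX.
case: eqP => [e|]; last by rewrite mulr0.
case/negP: nJ; apply/existsP; exists l; rewrite aE e; exact: lem_addl.
Qed.

Definition tset i : {set {set 'I_r}} := [set T : {set 'I_r} | #|T| == i].

(** The entry of the Taylor differential from the basis element [T] to [S]. *)
Definition tentry T S : R := simplex_d T S *: 'X_[lcmm T - lcmm S].

(** A vector of the [i]-th Taylor module as a function on sets of generators; its
    values outside [tset i] do not matter. *)
Definition vrow i (V : {set 'I_r} -> R) : 'rV[R]_#|tset i| :=
  \row_k V (enum_val k).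

Lemma vrowE i (v : 'rV[R]_#|tset i|) : exists V, v = vrow i V.
Proof.
exists (fun T => \sum_(k | enum_val k == T) v 0 k).
apply/rowP => k; rewrite mxE (big_pred1 k) // => l.
by rewrite /= (inj_eq enum_val_inj).
Qed.

Lemma vrow_inj i V W : vrow i V = vrow i W -> {in tset i, V =1 W}.
Proof.
move=> e T Ti; have := congr1 (fun M : 'rV_ _ => M 0 (enum_rank_in Ti T)) e.
by rewrite !mxE enum_rankK_in.
Qed.

Lemma eq_vrow i V W : {in tset i, V =1 W} -> vrow i V = vrow i W.
Proof. by move=> e; apply/rowP => k; rewrite !mxE e ?enum_valP. Qed.

Definition taylor_aug : 'M[R]_(#|tset 0|, 1) := const_mx 1.

Definition taylor_diff i : 'M[R]_(#|tset i.+1|, #|tset i|) :=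
  \matrix_(k, l) tentry (enum_val k) (enum_val l).

Lemma vrow_diff i V : vrow i.+1 V *m taylor_diff i =
  vrow i (fun S => \sum_(T in tset i.+1) V T * tentry T S).
Proof.
apply/rowP => l; rewrite !mxE.
rewrite (big_enum_val (fun T => V T * tentry T (enum_val l))).
by apply: eq_bigr => k _; rewrite !mxE.
Qed.

Lemma vrow_aug V : (vrow 0 V *m taylor_aug) 0 0 = V set0.
Proof.
rewrite mxE (eq_bigr (fun k => V (enum_val k))); last first.
  by move=> k _; rewrite !mxE mulr1.
rewrite -(big_enum_val V) (big_pred1 set0) // => T.
by rewrite inE cards_eq0.
Qed.

Lemma tentry_neq0 T S : tentry T S != 0 -> exists2 l, l \in T & S = T :\ l.
Proof.
move=> ne; apply: (@simplex_d_neq0 K); apply: contraNneq ne => e.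
by rewrite /tentry e scale0r.
Qed.

Definition below a : {set {set 'I_r}} := [set T | (lcmm T <= a)%MM].

Lemma below_complex a : is_complex simplex_d (below a).
Proof.
apply: convex_complex => R0 S T _; rewrite !inE => Ta _ ST.
exact: lepm_trans (lcmmS m ST) Ta.
Qed.

(** The sets of generators with lcm dividing [a] form the full simplex on the
    generators that divide [a]. *)
Lemma below_acyclic a : J a -> forall i, hdim cd simplex_d (below a) i = 0%N.
Proof.
case/existsP => l la.
apply: (toggle_acyclic (v := l) (@below_complex a)) => T; rewrite !inE => /lcmm_leP Ta.
apply/lcmm_leP => l'; rewrite in_toggle.
by case: eqP => [-> //|_]; rewrite addbF; exact: Ta.
Qed.

(** The coordinates of the multidegree [a] component of [V]. *)
Definition slot a (V : {set 'I_r} -> R) T : K :=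
  if (lcmm T <= a)%MM then (V T)@_(a - lcmm T) else 0.

(** In multidegree [a] the Taylor complex is the complex of a full simplex,
    hence exact if the simplex has a vertex; otherwise no generator divides [a],
    and a vector of [I] has no component of this multidegree. *)
Lemma slot_exact i V a :
  (forall T, T \notin tset i -> V T = 0) ->
  (i = 0%N -> I (V set0)) ->
  (forall S, \sum_T V T * tentry T S = 0) ->
  exists y : {set 'I_r} -> K,
   (forall T, y T != 0 -> T \in tset i.+1 /\ (lcmm T <= a)%MM) /\
   (forall S, (lcmm S <= a)%MM -> \sum_T y T * simplex_d T S = slot a V S).
Proof.
move=> Vs V0 Vc.
have [Ja|nJa] := boolP (J a); last first.
  exists (fun=> 0); split=> [T|S Sa]; first by rewrite eqxx.
  rewrite big1 => [|T _]; last by rewrite mul0r.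
  rewrite /slot Sa; have [S0|[l lS]] := set_0Vmem S; last first.
    by case/negP: nJa; apply/existsP; exists l; move/lcmm_leP: Sa; apply.
  rewrite S0 lcmm0 subm0; have [i0|i0] := eqVneq i 0%N.
    by rewrite (monomial_ideal_supp (V0 i0) nJa).
  by rewrite Vs ?mcoeff0 // inE cards0 eq_sym.
have sliceE j T : (T \in slice cd (below a) j) = (lcmm T <= a)%MM && (T \in tset j).
  by rewrite !inE.
have [|S Sa|y [ys yE]] := acyclic_exact (@simplex_d_deg K r) (z := slot a V)
    (@below_complex a) (below_acyclic Ja i).
- move=> T; rewrite sliceE negb_and /slot => /orP [/negbTE -> //|Ti].
  by rewrite Vs // mcoeff0; case: ifP.
- have Sa' : (lcmm S <= a)%MM by rewrite inE in Sa.
  have := congr1 (mcoeff (a - lcmm S)) (Vc S).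
  rewrite mcoeff0 (raddf_sum (mcoeff _)) /= => e; rewrite -[RHS]e big_mkcond.
  apply: eq_bigr => T _; rewrite inE /slot.
  have [s0|/simplex_d_neq0 [l lT SE]] := eqVneq (simplex_d T S) 0.
    by rewrite /tentry s0 scale0r !mulr0 mcoeff0; case: ifP.
  rewrite /tentry -scalerAr mcoeffZ.
  have ST : (lcmm S <= lcmm T)%MM by apply: lcmmS; rewrite SE subsetDl.
  case: ifP => Ta; last first.
    rewrite mcoeffM big1 ?mulr0 // => -[k1 k2] /= /eqP kE; rewrite mcoeffX.
    case: eqP => [e2|]; last by rewrite mulr0.
    case/negP: Ta; apply/mnm_lepP => j.
    have := congr1 (fun u : 'X_{1..n} => u j) kE; rewrite -e2 mnmBE mnmDE mnmBE.
    by move/mnm_lepP/(_ j): Sa'; move/mnm_lepP/(_ j): ST; lia.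
  have -> : (a - lcmm S = (lcmm T - lcmm S) + (a - lcmm T))%MM.
    apply/mnmP => j; rewrite mnmDE !mnmBE.
    by move/mnm_lepP/(_ j): Ta; move/mnm_lepP/(_ j): ST; lia.
  by rewrite mcoeffMX Ta mulrC.
- exists y; split=> [T yT|S Sa].
    have : T \in slice cd (below a) i.+1.
      by apply: contraNT yT => /ys ->.
    by rewrite sliceE => /andP [].
  rewrite -yE ?inE // [RHS]big_mkcond; apply: eq_bigr => T _.
  case: ifP => // Tb; rewrite ys ?mul0r // sliceE.
  by rewrite inE in Tb; rewrite Tb.
Qed.

(** The preimages found in the finitely many multidegrees that occur in [V] are
    added up. *)
Lemma taylor_exact i V :
  (forall T, T \notin tset i -> V T = 0) ->
  (i = 0%N -> I (V set0)) ->
  (forall S, \sum_T V T * tentry T S = 0) ->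
  exists W, vrow i V = vrow i.+1 W *m taylor_diff i.
Proof.
move=> Vs V0 Vc.
have H a := constructive_indefinite_description _ (@slot_exact i V a Vs V0 Vc).
(* [W] collects the preimages in the finitely many multidegrees of [V] *)
pose y a := sval (H a).
have yN a T : y a T != 0 -> T \in tset i.+1 /\ (lcmm T <= a)%MM.
  by case: (svalP (H a)) => + _; apply.
have yE a S : (lcmm S <= a)%MM -> \sum_T y a T * simplex_d T S = slot a V S.
  by case: (svalP (H a)) => _; apply.
pose A := undup (flatten [seq [seq (w + lcmm T)%MM | w <- msupp (V T)] | T <- enum {set 'I_r}]).
have AP T w : w \in msupp (V T) -> (w + lcmm T)%MM \in A.
  move=> wV; rewrite mem_undup; apply/flattenP.
  exists [seq (u + lcmm T)%MM | u <- msupp (V T)]; first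
    by apply: (map_f (fun T => [seq (w + lcmm T)%MM | w <- msupp (V T)])); rewrite mem_enum.
  exact: (map_f (fun u => (u + lcmm T)%MM)).
pose W T : R := \sum_(a <- A) y a T *: 'X_[a - lcmm T].
exists W; rewrite vrow_diff; apply: eq_vrow => S _.
transitivity (\sum_(a <- A) (\sum_T y a T * simplex_d T S) *: 'X_[a - lcmm S] : R); last first.
  under [RHS]eq_bigr => T Ti.
    rewrite /W mulr_suml (eq_bigr (fun a => (y a T * simplex_d T S) *: 'X_[a - lcmm S])); last first.
      move=> a _; have [->|/yN [_ Ta]] := eqVneq (y a T) 0.
        by rewrite mul0r !scale0r mul0r.
      rewrite /tentry -scalerAl -scalerAr scalerA.
      have [->|/simplex_d_neq0 [l lT SE]] := eqVneq (simplex_d T S) 0; first by rewrite !mulr0 !scale0r.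
      have ST : (lcmm S <= lcmm T)%MM by apply: lcmmS; rewrite SE subsetDl.
      congr (_ *: _); rewrite -mpolyXD; congr 'X_[_].
      apply/mnmP => j; rewrite mnmDE !mnmBE.
      by move/mnm_lepP/(_ j): Ta; move/mnm_lepP/(_ j): ST; lia.
    over.
  rewrite [RHS]exchange_big /=; apply: eq_bigr => a _.
  rewrite scaler_suml [RHS]big_mkcond; apply: eq_bigr => T _.
  case: ifP => // Ti; have [->|/yN []] := eqVneq (y a T) 0; last by rewrite Ti.
  by rewrite mul0r scale0r.
have termE a : (\sum_T y a T * simplex_d T S) = if (lcmm S <= a)%MM then (V S)@_(a - lcmm S) else 0.
  case: ifP => Sa; first by rewrite yE // /slot Sa.
  rewrite big1 // => T _; have [->|/yN [_ Ta]] := eqVneq (y a T) 0; first by rewrite mul0r.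
  have [->|/simplex_d_neq0 [l lT SE]] := eqVneq (simplex_d T S) 0; first by rewrite mulr0.
  by rewrite (lepm_trans _ Ta) // in Sa; apply: lcmmS; rewrite SE subsetDl.
apply/mpolyP => w; rewrite (raddf_sum (mcoeff w)) /=.
have aE a : (lcmm S <= a)%MM -> (a - lcmm S)%MM = w -> a = (w + lcmm S)%MM.
  by move=> Sa <-; rewrite submK.
have [wV|wV] := boolP (w \in msupp (V S)).
  rewrite (bigD1_seq (w + lcmm S)%MM) ?undup_uniq ?AP //=.
  rewrite termE lem_addl mcoeffZ mcoeffX addmK eqxx mulr1 big1 ?addr0 // => a ne.
  rewrite termE mcoeffZ mcoeffX; case: ifP => Sa; last by rewrite mul0r.
  case: eqP => [/(aE _ Sa) e|_]; last by rewrite mulr0.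
  by rewrite e eqxx in ne.
rewrite (memN_msupp_eq0 wV) big1 // => a _; rewrite termE mcoeffZ mcoeffX.
case: ifP => _; last by rewrite mul0r.
by case: eqP => [->|_]; rewrite ?mulr0 // (memN_msupp_eq0 wV) mul0r.
Qed.
End Taylor.

(** The Betti number in homological degree [i] and degree [k], as a sum over the
    multidegrees of total degree [k]. *)
Definition koszul_betti (K : fieldType) n (J : pred 'X_{1..n}) (i k : nat) : nat :=
  (\sum_(a : 'X_{1..n < k.+1} | mdeg a == k)
     hdim (fun S : {set 'I_n} => #|S|) (@simplex_d K n) (koszul_fam J a) i)%N.

Section TaylorResolution.
Variables (K : fieldType) (n r : nat) (m : 'I_r -> 'X_{1..n}).
Local Notation R := {mpoly K[n]}.
Local Notation lcmm := (lcmm m).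
Local Notation J := (in_ideal m).
Local Notation simplex_d := (@simplex_d K r).
Local Notation cd := (fun S : {set _} => #|S|).
Variable I : R -> Prop.
Hypothesis IE : forall p, I p <-> exists w : 'I_r -> R, p = \sum_l w l * 'X_[m l].
Implicit Types (T S : {set 'I_r}) (a : 'X_{1..n}).
Local Notation tset := (@tset r).
Local Notation tentry := (@tentry K n r m).
Local Notation vrow := (@vrow K n r).
Local Notation taylor_diff := (@taylor_diff K n r m).
Local Notation taylor_aug := (@taylor_aug K n r).

Let gI : graded_ideal I := monomial_ideal_graded IE.

Lemma monomial_in_ideal a : J a -> I 'X_[a].
Proof.
case/existsP => l la; rewrite -(submK la) mpolyXD; apply: (gi_mul gI).
apply/IE; exists (fun l' => (l' == l)%:R).
rewrite (bigD1 l) //= eqxx mul1r big1 ?addr0 // => l' /negbTE ->.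
by rewrite mul0r.
Qed.

Lemma tentryM T S : \sum_U tentry T U * tentry U S = 0.
Proof.
rewrite (eq_bigr (fun U => (simplex_d T U * simplex_d U S) *: 'X_[lcmm T - lcmm S])).
  by rewrite -scaler_suml simplex_dd scale0r.
move=> U _; rewrite /tentry -scalerAl -scalerAr scalerA.
have [->|/simplex_d_neq0 [l _ UE]] := eqVneq (simplex_d T U) 0; first by rewrite !mul0r !scale0r.
have [->|/simplex_d_neq0 [l' _ SE]] := eqVneq (simplex_d U S) 0; first by rewrite !mulr0 !scale0r.
congr (_ *: _); rewrite -mpolyXD; congr 'X_[_]; apply/mnmP => j.
have /mnm_lepP /(_ j) : (lcmm U <= lcmm T)%MM by apply: lcmmS; rewrite UE subsetDl.
have /mnm_lepP /(_ j) : (lcmm S <= lcmm U)%MM by apply: lcmmS; rewrite SE subsetDl.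
rewrite mnmDE !mnmBE; lia.
Qed.

Lemma tentry_deg T S : tentry T S != 0 -> #|T| = #|S|.+1.
Proof. by case/tentry_neq0 => l lT ->; rewrite [LHS](cardsD1 l) lT. Qed.

Lemma vrow_supported i (V : {set 'I_r} -> R) : exists V',
  (forall T, T \notin tset i -> V' T = 0) /\ vrow i V = vrow i V'.
Proof.
exists (fun T => if T \in tset i then V T else 0); split.
  by move=> T /negbTE ->.
by apply: eq_vrow => T ->.
Qed.

Lemma taylor_diff_homogeneous i :
  homogeneous_mx (fun k : 'I_#|tset i.+1| => (mdeg (lcmm (enum_val k)))%:Z)
    (fun k : 'I_#|tset i| => (mdeg (lcmm (enum_val k)))%:Z) (taylor_diff i).
Proof.
move=> k l w; rewrite mxE.
set T := enum_val k; set S := enum_val l.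
have [->|te] := eqVneq (tentry T S) 0; first by rewrite msupp0.
have [v vT SE] := tentry_neq0 te.
rewrite /tentry mcoeff_msupp mcoeffZ mcoeffX.
have [<- _|_] := eqVneq (lcmm T - lcmm S)%MM w; last by rewrite mulr0 eqxx.
rewrite -PoszD -mdegD submK //; apply: lcmmS; rewrite SE; exact: subsetDl.
Qed.

Definition taylor_resolution : graded_resolution I.
Proof.
refine (@GradedResolution K n I (fun i => #|tset i|)
  (fun i k => (mdeg (lcmm (enum_val k)))%:Z) taylor_aug taylor_diff _ _ _ _ _).
- move=> k l w; rewrite mxE msupp1 inE => /eqP ->; rewrite mdeg0 addr0.
  have := enum_valP k; rewrite inE cards_eq0 => /eqP ->.
  by rewrite lcmm0 mdeg0.
- exact: taylor_diff_homogeneous.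
- move=> p; exists (vrow 0 (fun=> p)); rewrite vrow_aug subrr; exact: gi_0.
- move=> v; have [V ->] := vrowE v.
  have [V' [V's VE]] := vrow_supported 0 V.
  split=> [|[w]].
    rewrite VE vrow_aug => IV.
    have [|S|W ->] := taylor_exact IE V's; last by exists (vrow 1 W).
      by [].
    rewrite big1 // => T _; have [/V's ->|] := boolP (T \notin tset 0).
      by rewrite mul0r.
    rewrite negbK inE => /eqP T0; have [->|/tentry_deg] := eqVneq (tentry T S) 0.
      by rewrite mulr0.
    by rewrite T0.
  have [W ->] := vrowE w; rewrite vrow_diff => /vrow_inj VW.
  rewrite vrow_aug VW ?inE ?cards0 //.
  apply: (big_ind I); [exact: gi_0|exact: gi_add|] => T; rewrite inE => /eqP T1.
  apply: (gi_mul gI); rewrite /tentry -mul_mpolyC; apply: (gi_mul gI).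
  rewrite lcmm0 subm0; apply: monomial_in_ideal.
  have [T0|[l lT]] := set_0Vmem T; first by rewrite T0 cards0 in T1.
  by apply/existsP; exists l; apply: (lcmm_leP m T (lcmm T) _ l lT); exact: lepm_refl.
- move=> i v; have [V ->] := vrowE v.
  have [V' [V's VE]] := vrow_supported i.+1 V.
  split=> [|[w]].
    rewrite VE vrow_diff => e.
    have [//|S|W ->] := taylor_exact IE V's; last by exists (vrow i.+2 W).
    have [Si|Si] := boolP (S \in tset i); last first.
      rewrite big1 // => T _; have [/V's ->|] := boolP (T \notin tset i.+1).
        by rewrite mul0r.
      rewrite negbK inE => /eqP T0; have [->|/tentry_deg] := eqVneq (tentry T S) 0.
        by rewrite mulr0.
      by rewrite T0 => -[iS]; rewrite inE -iS eqxx in Si.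
    have z : vrow i (fun=> 0) = 0 by apply/rowP => k; rewrite !mxE.
    rewrite -z in e; have /= eS := vrow_inj e Si.
    rewrite -[RHS]eS [RHS]big_mkcond /=.
    by apply: eq_bigr => T _; case: ifP => // /negbT /V's ->; rewrite mul0r.
  have [W ->] := vrowE w => ->; rewrite !vrow_diff.
  apply/rowP => k; rewrite !mxE; set S := enum_val k.
  rewrite (eq_bigr (fun U => \sum_(T in tset i.+2) W T * (tentry T U * tentry U S))); last first.
    by move=> U _; rewrite mulr_suml; apply: eq_bigr => T _; rewrite mulrA.
  rewrite exchange_big /= big1 // => T Ti; rewrite -mulr_sumr.
  transitivity (W T * 0); last by rewrite mulr0.
  congr (_ * _); rewrite -[RHS](tentryM T S).
  rewrite big_mkcond; apply: eq_bigr => U _; case: ifP => // Ui.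
  have [->|/tentry_deg e] := eqVneq (tentry T U) 0; first by rewrite mul0r.
  by rewrite !inE e eqSS in Ti Ui; rewrite Ti in Ui.
Defined.

(** After tensoring with [K], the basis of the degree [j] part of the Taylor
    complex. *)
Definition degset (j : nat) : {set {set 'I_r}} := [set T | mdeg (lcmm T) == j].

Lemma mdeg_lcmmS T S : S \subset T -> (mdeg (lcmm S) <= mdeg (lcmm T))%N.
Proof. by move=> ST; rewrite -(submK (lcmmS m ST)) mdegD leq_addl. Qed.

Lemma degset_complex j : is_complex simplex_d (degset j).
Proof.
apply: convex_complex => U S T; rewrite !inE => /eqP Uj /eqP Tj US ST.
have := mdeg_lcmmS US; have := mdeg_lcmmS ST; lia.
Qed.

Lemma enum_val_codom (i : nat) T : T \in tset i ->
  T \in codom (enum_val : 'I_#|tset i| -> {set 'I_r}).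
Proof. by move=> Ti; apply/codomP; exists (enum_rank_in Ti T); rewrite enum_rankK_in. Qed.

(** The entry of the Taylor differential from [T] to [S] has a nonzero constant
    term only if [T] and [S] have the same lcm, which for [S] inside [T] means
    that these lcms have the same degree. *)
Lemma taylor_tor_dim i (j : nat) :
  tor_dim taylor_resolution i j = hdim cd simplex_d (degset j) i.
Proof.
pose E i := tensor_component taylor_resolution i j.
have rE l : \rank (E l) = #|slice cd (degset j) l|.
  rewrite -(rank_ind_mx K) -[RHS]/(fun_rank _).
  apply: (@rank_fun_rank _ _ _ _ _ enum_val enum_val); try exact: enum_val_inj.
    move=> T S; have [->|_] := eqVneq T S; last by rewrite eqxx.
    case: (boolP (S \in slice _ _ _)) => [|_]; last by rewrite eqxx.
    by rewrite !inE => /andP [_ Sl] _; split; apply: enum_val_codom; rewrite inE.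
  move=> k l'; rewrite !mxE (inj_eq enum_val_inj) !inE eqz_nat.
  have := enum_valP k; rewrite inE => ->; rewrite andbT.
  by case: (k == l') => //=; rewrite mulr1n.
have rB l : \rank (tensor_boundaries taylor_resolution l j) = bd_rank cd simplex_d (degset j) l.+1.
  apply: (@rank_fun_rank _ _ _ _ _ enum_val enum_val); try exact: enum_val_inj.
    move=> T S; rewrite /bd_coef => ne.
    have [Tl Tne] : T \in tset l.+1 /\ simplex_d T S != 0.
      split; last by apply: contraNneq ne => ->; rewrite mulr0.
      rewrite inE; apply: contraNT ne => /negbTE ->.
      by rewrite !andbF mul0r.
    split; apply: enum_val_codom => //.
    by move: Tl; rewrite !inE (simplex_d_deg Tne) eqSS.
  move=> k l'; rewrite /tensor_boundaries /tensor_diff mul_diag_mx !mxE /=.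
  set T := enum_val k; set S := enum_val l'.
  have Tl : #|T| == l.+1 by have := enum_valP k; rewrite inE.
  rewrite eqz_nat /tentry mcoeffZ mcoeffX /bd_coef !inE Tl andbT.
  case Tj: (mdeg (lcmm T) == j); rewrite ?mul0r //= mul1r mulrC.
  have [->|/simplex_d_neq0 [v vT SE]] := eqVneq (simplex_d T S) 0; first by rewrite !mulr0.
  have ST : S \subset T by rewrite SE subsetDl.
  congr (_%:R * _); congr nat_of_bool; apply/eqP/eqP => [e|Sj].
    by move/eqP: Tj <-; have := submK (lcmmS m ST); rewrite e add0m => ->.
  have <- : lcmm S = lcmm T by apply: mdeg_le_eq; [exact: lcmmS | move/eqP: Tj; lia].
  by apply/mnmP => v'; rewrite mnmBE subnn mnm0E.
rewrite /tor_dim rB /hdim; congr (_ - _)%N.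
case: i => [|i]; first by rewrite [LHS]rE bd_rank0 ?subn0 //; exact: simplex_d_deg.
rewrite /tensor_cycles -rE -rB.
by rewrite -(mxrank_mul_ker (E i.+1) (tensor_diff taylor_resolution i)) addKn.
Qed.

Lemma taylor_tor_dim_neg i (j : int) : j < 0 -> tor_dim taylor_resolution i j = 0%N.
Proof.
move=> j0; rewrite /tor_dim.
suff -> : tensor_cycles taylor_resolution i j = 0 by rewrite mxrank0.
have z l : tensor_component taylor_resolution l j = 0.
  apply/matrixP => k l'; rewrite !mxE.
  by case: eqP => /= [e|]; rewrite ?mul0rn //; move: j0; rewrite -e.
by case: i => [|i] /=; rewrite z ?cap0mx.
Qed.

(** Tensored with [K], the Taylor complex splits according to the lcm, and the
    part of lcm [a] has the homology of the Koszul family of multidegree [a]. *)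
Theorem betti_monomial (i : nat) (j : int) :
  betti I i j = if j is Posz k then koszul_betti K J i k else 0%N.
Proof.
rewrite (bettiE gI taylor_resolution).
case: j => [k|k]; last exact: taylor_tor_dim_neg.
rewrite taylor_tor_dim.
pose lab T : 'X_{1..n < k.+1} := insubd bm0 (lcmm T).
have labE T : T \in degset k -> val (lab T) = lcmm T.
  by rewrite inE => /eqP Tk; rewrite /lab val_insubd Tk ltnSn.
rewrite (hdim_labels (@simplex_d_deg _ _) (lab := lab) (@degset_complex k)); last first.
  move=> T S Tk Sk /simplex_d_neq0 [v vT SE]; apply: val_inj; rewrite !labE //.
  apply/esym/mdeg_le_eq; first by apply: lcmmS; rewrite SE subsetDl.
  by move: Tk Sk; rewrite !inE => /eqP -> /eqP ->.
rewrite /koszul_betti [RHS]big_mkcond; apply: eq_bigr => a _.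
case: ifP => ak.
  rewrite -taylor_koszul; congr (hdim _ _ _ i); apply/setP => T; rewrite [RHS]inE inE.
  apply/andP/eqP => [[Tk /eqP <-]|Ta]; first by rewrite labE.
  have Tk : T \in degset k by rewrite inE Ta.
  by split=> //; apply/eqP/val_inj; rewrite /= labE.
rewrite -(hdim_set0 cd simplex_d i); congr (hdim _ _ _ i); apply/setP => T; rewrite !inE.
apply/negbTE/negP => /andP [Tk /eqP e]; move: ak; rewrite -e labE ?inE //.
by rewrite Tk.
Qed.

End TaylorResolution.

(** * Monomial ideals with linear quotients *)

Section LinearQuotients.
Variables (K : fieldType) (n : nat).
Local Notation cd := (fun S : {set _} => #|S|).
Local Notation hd := (hdim cd (@simplex_d K n)).
Local Notation colon_gen := ('X_{1..n} * {set 'I_n})%type.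
Implicit Types (a u w : 'X_{1..n}) (S T V : {set 'I_n}) (L : seq colon_gen).

Definition divided_by L w : bool := has (fun g : colon_gen => (g.1 <= w)%MM) L.

(** A generator comes with the variables that generate the colon ideal of the
    previous generators by it.  Degrees are nondecreasing along the list. *)
Definition linear_quotients L := forall L1 g L2, L = L1 ++ g :: L2 ->
  [/\ (0 < mdeg g.1)%N, forall h, h \in L1 -> (mdeg h.1 <= mdeg g.1)%N
    & forall w, divided_by L1 (g.1 + w)%MM = [exists v in g.2, (0 < w v)%N]].

Lemma divided_by_up L : up_closed (divided_by L).
Proof. by move=> u w uw /hasP [g gL gu]; apply/hasP; exists g => //; apply: lepm_trans uw. Qed.

Lemma linear_quotients_rcons L g : linear_quotients (rcons L g) -> linear_quotients L.
Proof.
by move=> LQ L1 h L2 LE; apply: (LQ L1 h (rcons L2 g)); rewrite LE rcons_cat.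
Qed.

Section Step.
Variables (L : seq colon_gen) (u : 'X_{1..n}) (V : {set 'I_n}) (a : 'X_{1..n}).
Hypothesis colon : forall w, divided_by L (u + w)%MM = [exists v in V, (0 < w v)%N].

(** Adding the generator [u] to the list removes these sets from the Koszul
    family: those for which [u] divides [a - S] while no earlier generator
    does. *)
Definition new_part := [set S in koszul_fam (divided_by L) a | (u <= a - sqfree_mnm S)%MM].
Definition old_part := koszul_fam (divided_by (rcons L (u, V))) a.

Lemma new_partP S : reflect
  (forall v, (u v + sqfree_mnm S v <= a v)%N /\ (v \in V -> a v = (u v + sqfree_mnm S v)%N))
  (S \in new_part).
Proof.
rewrite !inE; apply: (iffP idP) => [/andP [/andP [Sa nJ] ua] v|H].
  move/mnm_lepP: Sa => Sa; move/mnm_lepP: (ua) => ua'.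
  have := Sa v; have := ua' v; rewrite mnmBE => l1 l2; split=> [|vV]; first by lia.
  apply/eqP; rewrite eqn_leq [X in _ && X](_ : _ = true) ?andbT; last by lia.
  rewrite leqNgt; apply: contra nJ => lt.
  rewrite -(submK ua) addmC colon; apply/existsP; exists v.
  by rewrite vV !mnmBE /=; lia.
have Sa : (sqfree_mnm S <= a)%MM by apply/mnm_lepP => v; have [] := H v; lia.
have ua : (u <= a - sqfree_mnm S)%MM.
  by apply/mnm_lepP => v; have [] := H v; rewrite mnmBE; lia.
rewrite Sa ua andbT /= -(submK ua) addmC colon; apply/existsP => -[v /andP [vV]].
by have [_ /(_ vV)] := H v; rewrite !mnmBE; lia.
Qed.

Lemma step_split : koszul_fam (divided_by L) a = new_part :|: old_part.
Proof.
apply/setP => S; rewrite !inE /divided_by -cats1 has_cat /= orbF negb_or.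
by case: (_ <= a)%MM => //=; case: has; case: (u <= _)%MM.
Qed.

Lemma step_disjoint : [disjoint new_part & old_part].
Proof.
rewrite -setI_eq0; apply/eqP/setP => S; rewrite !inE /divided_by -cats1 has_cat /= orbF.
by rewrite negb_or; case: (_ <= a)%MM => //=; case: has; case: (u <= _)%MM.
Qed.

Lemma step_arrows S T : S \in new_part -> T \in old_part -> simplex_d K S T = 0.
Proof.
rewrite 2!inE => /andP [_ ua] ; rewrite !inE => /andP [_ /hasPn /(_ (u, V))].
rewrite mem_rcons inE eqxx => /(_ isT) /negP nu; apply/eqP/negPn/negP => /simplex_d_neq0 [v _ TE].
apply: nu; apply: lepm_trans ua _; apply/mnm_lepP => i; rewrite !mnmBE leq_sub2l //.
by rewrite !sqfree_mnmE TE !inE; case: (i == v).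
Qed.

Lemma step_complex : is_complex (@simplex_d K n) (new_part :|: old_part).
Proof. by rewrite -step_split; apply/convex_complex/koszul_fam_convex/divided_by_up. Qed.

(** The part removed is an interval of sets: the variables where [a] exceeds [u]
    must be present if they lie in [V] and, outside of [V], are free.  Its
    homology is zero unless the interval is a single set [T], contained in [V]
    and with [a = u + T]. *)
Lemma hdim_new_part i : hd new_part i =
  (\sum_(T in powerset V) ((u + sqfree_mnm T)%MM == a) * (#|T| == i))%N.
Proof.
have [/existsP [T /andP [TV /eqP aE]]|none] :=
    boolP [exists T : {set 'I_n}, (T \subset V) && ((u + sqfree_mnm T)%MM == a)].
  have -> : new_part = [set T].
    apply/setP => S; rewrite in_set1; apply/new_partP/eqP => [H|->].
      apply/setP => v; have [] := H v; rewrite -aE mnmDE !sqfree_mnmE.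
      case vV: (v \in V); last first.
        have -> : v \in T = false by apply: contraFF vV; exact: (subsetP TV).
        by case: (v \in S) => //=; lia.
      by move=> _ /(_ isT); case: (v \in S); case: (v \in T) => //=; lia.
    by move=> v; rewrite -aE mnmDE; split=> //; lia.
  rewrite hdim_set1; last exact: simplex_d_deg.
  rewrite (bigD1 T) ?powersetE //= aE eqxx mul1n big1 ?addn0 // => S /andP [_ ne].
  case: eqP => // e; case/eqP: ne; apply/setP => v.
  have := congr1 (fun x : 'X_{1..n} => x v) e; rewrite -aE !mnmDE !sqfree_mnmE.
  by case: (v \in S); case: (v \in T) => //=; lia.
rewrite big1 => [|T]; last first.
  rewrite powersetE => TV; case: eqP => // e; case/negP: none.
  by apply/existsP; exists T; rewrite TV e eqxx.
have [ua|nua] := boolP (u <= a)%MM; last first.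
  rewrite -(hdim_set0 cd (@simplex_d K n) i); congr (hd _ i); apply/setP => S.
  rewrite [RHS]inE; apply/negbTE/new_partP => H; case/negP: nua; apply/mnm_lepP => v.
  by have [] := H v; lia.
(* a variable that can be added and deleted makes the interval a cone *)
have [v /andP [va bad]|nov] := pickP (fun v => (u v < a v)%N && ~~ ((v \in V) && (a v == (u v).+1))).
  apply: (toggle_acyclic (v := v)).
    exact: complex_sub step_disjoint step_complex step_arrows.
  move=> S /new_partP H; apply/new_partP => w; have [le eq] := H w.
  rewrite sqfree_mnmE in_toggle; rewrite sqfree_mnmE in le eq.
  case: (w =P v) => [wv|_]; last by rewrite addbF.
  rewrite wv in le eq *; split; first by case: (v \in S) le => /=; lia.
  move=> vV; move: bad; rewrite vV /=; move: (eq vV); case: (v \in S) => /=; lia.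
case/negP: none; apply/existsP; exists [set v | (u v < a v)%N]; apply/andP; split.
  apply/subsetP => v; rewrite inE => va; have := nov v; rewrite va /=.
  by case: (v \in V).
apply/eqP/mnmP => v; rewrite mnmDE sqfree_mnmE inE.
move/mnm_lepP/(_ v): ua; have := nov v; case: ltnP => //= uv; last by lia.
by move/negbFE/andP => [_ /eqP ->]; rewrite addn1.
Qed.

End Step.

Lemma koszul_fam_nil a i : hd (koszul_fam (divided_by [::]) a) i = ((a == 0%MM) * (i == 0))%N.
Proof.
have cA : is_complex (@simplex_d K n) (koszul_fam (divided_by [::]) a).
  by apply/convex_complex/koszul_fam_convex/divided_by_up.
have [a0|a0] := eqVneq a 0%MM.
  have -> : koszul_fam (divided_by [::]) a = [set set0].
    apply/setP => S; rewrite !inE andbT a0; apply/mnm_lepP/eqP => [H|-> v].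
      by apply/setP => v; have := H v; rewrite sqfree_mnmE mnm0E inE; case: (v \in S).
    by rewrite sqfree_mnmE inE.
  by rewrite (hdim_set1 (@simplex_d_deg _ _)) cards0 eq_sym mul1n.
have [v va] : exists v, (0 < a v)%N.
  apply/existsP; apply: contraNT a0 => /existsPn H; apply/eqP/mnmP => v.
  by rewrite mnm0E; have := H v; rewrite lt0n negbK => /eqP.
rewrite mul0n; apply: (toggle_acyclic (v := v)) => // S.
rewrite !inE !andbT => /mnm_lepP H; apply/mnm_lepP => w; have := H w.
rewrite !sqfree_mnmE in_toggle; case: (w =P v) => [->|]; last by rewrite addbF.
by case: (v \in S).
Qed.

(** The removed part has homology only in total degree equal to the size plus
    the degree of the new generator, where the larger family has none by the
    second hypothesis.  So the inclusion is zero in homology. *)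
Lemma linear_quotients_step L g : linear_quotients (rcons L g) ->
  (forall a i, hd (koszul_fam (divided_by L) a) i != 0%N -> (mdeg a < i + mdeg g.1)%N) ->
  forall a i, hd (koszul_fam (divided_by (rcons L g)) a) i =
    (hd (koszul_fam (divided_by L) a) i +
     if i is i'.+1 then
       \sum_(T in powerset g.2) ((g.1 + sqfree_mnm T)%MM == a) * (#|T| == i') else 0)%N.
Proof.
case: g => u V LQ vanish a i.
have [//|_ _ colon] := LQ L (u, V) [::]; first by rewrite cats1.
rewrite /= in colon *.
rewrite (hdim_quotient (@simplex_d_deg _ _) (step_disjoint L u V a) (@step_complex L u V a)
   (@step_arrows L u V a)) -?step_split; last first.
  move=> j; rewrite (hdim_new_part a colon).
  have [|/vanish lt] := eqVneq (hd (koszul_fam (divided_by L) a) j) 0%N; first by right.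
  left; apply: big1 => T _; case: eqP => //= aE; case: eqP => //= Tj.
  by move: lt; rewrite -aE mdegD mdeg_sqfree Tj /= addnC ltnn.
by case: i => [|i] //; rewrite (hdim_new_part a colon).
Qed.

(** Linear quotients whose generators have degree at most [d] give a quotient ring
    of regularity less than [d]. *)
Lemma linear_quotients_vanish L (d : nat) : (0 < d)%N -> linear_quotients L ->
  (forall g, g \in L -> (mdeg g.1 <= d)%N) ->
  forall a i, hd (koszul_fam (divided_by L) a) i != 0%N -> (mdeg a < i + d)%N.
Proof.
elim/last_ind: L d => [|L g IH] d d0 LQ deg a i.
  rewrite koszul_fam_nil; have [->|_] := eqVneq a 0%MM; last by rewrite mul0n.
  by rewrite mdeg0 addn_gt0 d0 orbT.
have LQ' := linear_quotients_rcons LQ.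
have [g0 gdeg _] : [/\ (0 < mdeg g.1)%N, forall h, h \in L -> (mdeg h.1 <= mdeg g.1)%N
    & True] by have [|? ? _] := LQ L g [::]; rewrite ?cats1.
rewrite linear_quotients_step //; last exact: IH.
rewrite addn_eq0 negb_and => /orP [/(IH d) -> //|].
  by move=> h hL; apply: deg; rewrite mem_rcons inE hL orbT.
case: i => [//|i]; rewrite sum_nat_eq0 negb_forall_in => /existsP [T /andP [_]].
have [<-|_] := eqVneq (g.1 + sqfree_mnm T)%MM a; last by rewrite mul0n.
have [<-|_] := eqVneq #|T| i; last by rewrite muln0.
move=> _; rewrite mdegD mdeg_sqfree.
by rewrite addSn ltnS addnC leq_add2l; apply: deg; rewrite mem_rcons mem_head.
Qed.

Lemma sum_pick_mnm (k : nat) (u : 'X_{1..n}) :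
  (\sum_(a : 'X_{1..n < k.+1} | mdeg a == k) (u == a :> 'X_{1..n}) = (mdeg u == k))%N.
Proof.
have [uk|uk] := eqVneq (mdeg u) k; last first.
  by apply: big1 => a /eqP ak; case: eqP => // ua; rewrite ua ak eqxx in uk.
have bu : (mdeg u < k.+1)%N by rewrite uk.
rewrite (bigD1 (BMultinom bu)) /= ?uk // eqxx big1 // => a /andP [_].
by rewrite bmeqP /= eq_sym => /negbTE ->.
Qed.

(** The formula of iterated mapping cones: a generator with [c] colon variables
    contributes a Koszul complex on [c] variables. *)
Theorem linear_quotients_koszul_betti L i k : linear_quotients L ->
  koszul_betti K (divided_by L) i k =
  ((i == 0) * (k == 0) + \sum_(g <- L)
    if i is i'.+1 then (mdeg g.1 + i' == k) * 'C(#|g.2|, i') else 0)%N.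
Proof.
elim/last_ind: L => [|L g IH] LQ.
  rewrite big_nil addn0 /koszul_betti.
  rewrite (eq_bigr (fun a : 'X_{1..n < k.+1} => (0%MM == a :> 'X_{1..n}) * (i == 0))%N).
    by rewrite -big_distrl /= sum_pick_mnm mdeg0 (eq_sym 0%N k) mulnC.
  by move=> a _; rewrite koszul_fam_nil eq_sym.
have LQ' := linear_quotients_rcons LQ.
have [g0 gdeg _] : [/\ (0 < mdeg g.1)%N, forall h, h \in L -> (mdeg h.1 <= mdeg g.1)%N
    & True] by have [|? ? _] := LQ L g [::]; rewrite ?cats1.
rewrite -[in RHS]cats1 big_cat big_seq1 /= addnA -IH // /koszul_betti.
under eq_bigr => a _.
  rewrite (linear_quotients_step LQ (linear_quotients_vanish g0 LQ' gdeg)); over.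
rewrite big_split /=; congr (_ + _)%N.
case: i {IH} => [|i]; first by rewrite big1.
rewrite exchange_big /=.
rewrite (eq_bigr (fun T => (mdeg g.1 + i == k) * (#|T| == i)))%N; last first.
  move=> T _; rewrite -big_distrl /= sum_pick_mnm mdegD mdeg_sqfree.
  by case: (#|T| =P i) => [->|]; rewrite ?muln0.
rewrite -big_distrr /= -cards_draws; congr (_ * _)%N.
rewrite -sum1_card big_mkcond [RHS]big_mkcond; apply: eq_bigr => T _.
by rewrite inE powersetE; case: (T \subset _).
Qed.

End LinearQuotients.

(** * Facets of squeezed balls *)

Local Open Scope nat_scope.

Section Facets.
Variables (m n : nat).
Implicit Types (s t : seq nat) (H : {set 'I_n}).

(** A monomial x_{i_1} ... x_{i_k} in m variables is encoded by the word of its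
    indices in increasing order, each index diminished by one. *)
Definition valid s := sorted leq s && all (fun x => x < m) s.
(** The default value [m] is one more than all letters: past the end of a word
    the indices continue as if the monomial were multiplied by all powers of an
    additional last variable.  With it a facet of the squeezed ball becomes a
    union of pairs over all positions [q], cut at [n], the final segment of the
    facet being made of the pairs past the end of the word. *)
Definition idx s q := nth m s q.
(** The lower vertex of the [q]-th pair of the facet. *)
Definition low s q := idx s q + 2 * q.
Definition in_pairs s v :=
  has (fun q => (low s q == v) || ((low s q).+1 == v)) (iota 0 v.+1).
Definition pair_facet s : {set 'I_n} := [set v : 'I_n | in_pairs s v].
(** The restriction face of the facet in the shelling by increasing indices: its
    lower vertices in the pairs that precede the final segment. *)
Definition low_part s : {set 'I_n} :=
  [set v : 'I_n | has (fun q => low s q == v) (iota 0 (size s))].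

Lemma idx_lt s q : valid s -> (idx s q < m) = (q < size s).
Proof.
case/andP=> _ /allP H; rewrite /idx; have [qs|qs] := ltnP q (size s); first exact: (H _ (mem_nth m qs)).
by rewrite nth_default // ltnn.
Qed.

Lemma idx_le s q : valid s -> idx s q <= m.
Proof.
move=> vs; have [qs|qs] := ltnP q (size s); last by rewrite /idx nth_default.
by rewrite ltnW // idx_lt.
Qed.

Lemma idx_default s q : size s <= q -> idx s q = m.
Proof. by move=> qs; rewrite /idx nth_default. Qed.

Lemma idx_mono s p q : valid s -> p <= q -> idx s p <= idx s q.
Proof.
move=> vs pq; have [qs|qs] := ltnP q (size s); last by rewrite (idx_default qs) idx_le.
case/andP: vs => so _; rewrite /idx.
apply: (sorted_leq_nth leq_trans leqnn m so) => //; rewrite inE //.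
exact: leq_ltn_trans pq qs.
Qed.

Lemma low_gap s p q : valid s -> p <= q -> low s p + 2 * (q - p) <= low s q.
Proof. by move=> vs pq; rewrite /low; have := idx_mono vs pq; lia. Qed.

Lemma low_inj s p q : valid s -> low s p = low s q -> p = q.
Proof.
move=> vs e; have [pq|] := leqP p q; first by have := low_gap vs pq; lia.
by move/ltnW => qp; have := low_gap vs qp; lia.
Qed.

Lemma in_pairsP s v : reflect (exists q, v = low s q \/ v = (low s q).+1) (in_pairs s v).
Proof.
apply: (iffP hasP) => [[q _ /orP [] /eqP <-]|[q vE]]; first by exists q; left.
  by exists q; right.
exists q; last by case: vE => ->; rewrite eqxx ?orbT.
by rewrite mem_iota /= add0n; case: vE => ->; rewrite /low; lia.
Qed.

Lemma low_partP s (v : 'I_n) :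
  reflect (exists2 q, q < size s & v = low s q :> nat) (v \in low_part s).
Proof.
rewrite inE; apply: (iffP hasP) => [[q]|[q qs ->]].
  by rewrite mem_iota => qs /eqP <-; exists q.
by exists q; rewrite ?mem_iota // eqxx.
Qed.

Lemma pair_facetP s (v : 'I_n) :
  reflect (exists q, v = low s q :> nat \/ v = (low s q).+1 :> nat) (v \in pair_facet s).
Proof. by rewrite inE; exact: in_pairsP. Qed.

Lemma low_part_sub s : low_part s \subset pair_facet s.
Proof. by apply/subsetP => v /low_partP [q _ vq]; apply/pair_facetP; exists q; left. Qed.

Lemma valid_eq s t : valid s -> valid t -> idx s =1 idx t -> s = t.
Proof.
move=> vs vt e.
have st : size s = size t.
  apply/eqP; rewrite eqn_leq; apply/andP; split; rewrite leqNgt.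
    by rewrite -(idx_lt _ vs) e (idx_default (leqnn _)) ltnn.
  by rewrite -(idx_lt _ vt) -e (idx_default (leqnn _)) ltnn.
by apply: (@eq_from_nth _ m) => // i _; exact: e.
Qed.

Lemma valid_take s k : valid s -> valid (take k s).
Proof.
case/andP=> so al; apply/andP; split; first exact: take_sorted.
by apply/allP => x /mem_take; exact: (allP al).
Qed.

Lemma idx_take s k q : idx (take k s) q = if q < k then idx s q else m.
Proof.
rewrite /idx; case: ltnP => qk; first by rewrite nth_take.
by rewrite nth_default // size_take; case: ifP => //; lia.
Qed.

Lemma low_part_take s k : low_part (take k s) \subset low_part s.
Proof.
apply/subsetP => v /low_partP [q qs vq]; apply/low_partP; exists q.
  by move: qs; rewrite size_take; case: ifP; lia.
rewrite vq /low idx_take; case: ifP => //.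
by move: qs; rewrite size_take; case: ifP; lia.
Qed.

Lemma in_pairs_tail s v k : size s <= k -> m + 2 * k <= v -> in_pairs s v.
Proof.
move=> sk mv; apply/in_pairsP; exists ((v - m) %/ 2).
rewrite /low idx_default; last by lia.
by have := divn_eq (v - m) 2; have := ltn_pmod (v - m) (isT : 0 < 2); lia.
Qed.

(** Reading [H] from left to right, each vertex not covered yet opens a new pair.
    This produces a word whose restriction face lies in [H], and whose facet
    contains [H] unless more than [k] pairs are called for. *)
Lemma greedy H k : exists s, [/\ valid s, size s <= k, low_part s \subset H
  & (forall h : 'I_n, h \in H -> in_pairs s h) \/
    (size s = k /\ forall h : 'I_n, h \in H -> h < last 0 s + 2 * k -> in_pairs s h)].
Proof.
elim: k => [|k [s [vs ss RH]]].
  exists [::]; split=> //; last by right; split.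
  by apply/subsetP => v /low_partP [].
case=> [all_in|[sk below]].
  by exists s; split=> //; [exact: leqW | left].
have lastE : last 0 s <= m.
  by case: (s) vs => [|x s'] //= /andP [_ /allP /(_ (last x s') (mem_last _ _))]; lia.
pose P := [pred h : 'I_n | (h \in H) && (last 0 s + 2 * k <= h)].
have [h0 /= Ph0|none] := pickP P; last first.
  exists s; split=> //; first exact: leqW.
  left => h hH; apply: below => //; rewrite ltnNge; apply/negP => le.
  by have /= := none h; rewrite hH le.
have [h /andP [hH le] hmin] := arg_minnP (fun h : 'I_n => nat_of_ord h) (P := P) Ph0.
have [hm|hm] := leqP (m + 2 * k) h.
  exists s; split=> //; first exact: leqW.
  left => h' h'H; have [lt|le'] := ltnP h' (last 0 s + 2 * k); first exact: below.
  apply: (@in_pairs_tail _ _ k) => //; apply: leq_trans hm (hmin h' _).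
  by rewrite /= h'H.
exists (rcons s (h - 2 * k)).
have vs' : valid (rcons s (h - 2 * k)).
  case/andP: (vs) => so al; rewrite /valid all_rcons al andbT; apply/andP; split; last by lia.
  case: (s) so le => [|x s'] //= so le.
  by rewrite rcons_path so /=; lia.
have idxE q : q < k -> idx (rcons s (h - 2 * k)) q = idx s q.
  by move=> qk; rewrite /idx nth_rcons sk qk.
have idxk : idx (rcons s (h - 2 * k)) k = h - 2 * k.
  by rewrite /idx nth_rcons sk ltnn eqxx.
split=> //; first by rewrite size_rcons sk.
  apply/subsetP => v /low_partP [q]; rewrite size_rcons sk ltnS leq_eqVlt => /orP [/eqP ->|qk] vE.
    suff -> : v = h by [].
    by apply: val_inj; rewrite /= vE /low idxk; lia.
  by apply: (subsetP RH); apply/low_partP; exists q; rewrite ?sk // vE /low idxE.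
right; split; first by rewrite size_rcons sk.
move=> h' h'H; rewrite last_rcons => lt; apply/in_pairsP.
have [lt'|le'] := ltnP h' (last 0 s + 2 * k).
  have /in_pairsP [q hq] := below h' h'H lt'.
  have [qk|kq] := ltnP q k; first by exists q; move: hq; rewrite /low idxE.
  by move: hq; rewrite /low idx_default ?sk //; lia.
exists k; rewrite /low idxk.
have : h <= h' by apply: hmin; rewrite /= h'H.
lia.
Qed.

Lemma count_below s q : valid s -> count (in_pairs s) (iota 0 (low s q)) = 2 * q.
Proof.
move=> vs; elim: q => [|q IH].
  apply/eqP; rewrite muln0 -leqn0 leqNgt -has_count; apply/hasPn => v.
  rewrite mem_iota /= => vc; apply/in_pairsP => -[p vp].
  by have := low_gap vs (leq0n p); lia.
have g := low_gap vs (leqnSn q).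
rewrite -(subnKC (_ : low s q + 2 <= low s q.+1)); last by lia.
rewrite iotaD count_cat iotaD count_cat IH add0n.
have -> : count (in_pairs s) (iota (low s q) 2) = 2.
  have c2 (P : pred nat) a b : P a -> P b -> count P [:: a; b] = 2 by move=> /= -> ->.
  by apply: c2; apply/in_pairsP; exists q; [left | right].
suff -> : count (in_pairs s) (iota (low s q + 2) (low s q.+1 - (low s q + 2))) = 0 by lia.
apply/eqP; rewrite -leqn0 leqNgt -has_count; apply/hasPn => v.
rewrite mem_iota => /andP [lo hi]; apply/in_pairsP => -[p vp].
have [pq|qp] := leqP p q; first by have := low_gap vs pq; lia.
by have := low_gap vs qp; lia.
Qed.

Lemma card_ord_count (P : pred nat) k : k <= n ->
  #|[set x : 'I_n | P x && (x < k)]| = count P (iota 0 k).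
Proof.
move=> kn; rewrite -sum1_card.
rewrite (eq_bigl (fun x : 'I_n => P x && (x < k))); last by move=> x; rewrite inE.
rewrite -sum1_count -(big_mkord (fun x => P x && (x < k)) (fun=> 1)).
rewrite /index_iota subn0 -{1}(subnKC kn) iotaD big_cat /= [X in _ + X]big1_seq ?addn0.
  rewrite big_mkcond [RHS]big_mkcond !big_seq; apply: eq_bigr => x.
  by rewrite mem_iota /= => ->; rewrite andbT.
move=> x; rewrite mem_iota add0n => /andP [/andP [_ xk] /andP [kx _]].
by lia.
Qed.

(** The vertices of a facet below the [q]-th pair are the [2 * q] vertices of the
    preceding pairs. *)
Lemma rank_lower s q : valid s -> low s q <= n ->
  #|[set x in pair_facet s | (x < low s q)%N]| = 2 * q.
Proof.
move=> vs cn; rewrite -(count_below q vs) -card_ord_count //.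
by apply: eq_card => x; rewrite !inE.
Qed.

Lemma rank_upper s q : valid s -> low s q < n ->
  #|[set x in pair_facet s | (x < (low s q).+1)%N]| = (2 * q).+1.
Proof.
move=> vs cn; rewrite -(rank_lower vs (ltnW cn)) (cardsD1 (Ordinal cn)) !inE /= ltnSn andbT.
rewrite (_ : in_pairs s (low s q)) ?add1n; last by apply/in_pairsP; exists q; left.
congr _.+1; apply: eq_card => x; rewrite !inE -(inj_eq val_inj) /=.
by rewrite ltnS [x <= _]leq_eqVlt; case: (in_pairs s x); rewrite ?andbF //=; lia.
Qed.

Variable r : nat.
Hypothesis mrn : m + 2 * r < n.

(** The restriction face of [s] lies only in facets with smaller or equal
    indices: the pairs of [t] are at least two apart, so the [q]-th vertex of
    the restriction face of [s] cannot be reached before the [q]-th pair of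
    [t]. *)
Lemma facet_order_lower s t : valid s -> valid t -> size s <= r.+1 ->
  low_part s \subset pair_facet t -> forall q, idx t q <= idx s q.
Proof.
move=> vs vt ss RF; elim/ltn_ind=> q IH.
have [qs|qs] := ltnP q (size s); last by rewrite (idx_default qs) idx_le.
have lt : idx s q < m by rewrite idx_lt.
have cn : low s q < n by rewrite /low; lia.
have /(subsetP RF) /pair_facetP [p cp] : Ordinal cn \in low_part s by apply/low_partP; exists q.
rewrite /= in cp; have [qp|pq] := leqP q p.
  by have := low_gap vt qp; move: cp; rewrite /low; lia.
case: q => // q in IH qs lt cn cp pq *.
have := IH q (ltnSn q); have := low_gap vs (leqnSn q); have := low_gap vt (pq : p <= q).
by move: cp; rewrite /low; lia.
Qed.

(** The bound on [n] leaves room for the upper vertices of all pairs at positions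
    below [r]. *)
Lemma upper_vertex s q : valid s -> size s <= r -> q < r -> 
  exists2 v : 'I_n, v = (low s q).+1 :> nat & v \in pair_facet s :\: low_part s.
Proof.
move=> vs ss qr; have lt : (low s q).+1 < n by have := idx_le q vs; rewrite /low; lia.
exists (Ordinal lt) => //; rewrite inE; apply/andP; split.
  apply/negP => /low_partP [p _ /= e].
  have [pq|qp] := leqP p q; first by have := low_gap vs pq; lia.
  by have := low_gap vs (ltnW qp); lia.
by apply/pair_facetP; exists q; right.
Qed.

(** The complement in a facet of its restriction face plays the same role for the
    reversed order, which is a shelling order too; the upper vertices are now
    compared from right to left. *)
Lemma facet_order_upper s t : valid s -> valid t -> size s <= r -> size t <= r ->
  pair_facet s :\: low_part s \subset pair_facet t -> forall q, idx s q <= idx t q.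
Proof.
move=> vs vt ss st FF q.
have [k] := ubnP (r - q); elim: k q => // k IH q qk.
have [rq|qr] := leqP r q; first by rewrite !idx_default //; lia.
have [v vE /(subsetP FF) /pair_facetP [p vp]] := upper_vertex vs ss qr.
have [pq|qp] := leqP p q; first by have := low_gap vt pq; move: vp; rewrite vE /low; lia.
have := IH q.+1; have := low_gap vt qp; have := low_gap vs (leqnSn q).
by move: vp; rewrite vE /low; lia.
Qed.

Lemma facet_inj s t : valid s -> valid t -> size s <= r -> size t <= r ->
  pair_facet s \subset pair_facet t -> s = t.
Proof.
move=> vs vt ss st FF; apply: valid_eq => // q; apply/eqP; rewrite eqn_leq.
rewrite (facet_order_upper vs vt) ?(facet_order_lower vs vt) //.
- exact: leqW.
- exact: subset_trans (low_part_sub s) FF.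
- exact: subset_trans (subsetDl _ _) FF.
Qed.

Lemma card_pair_facet s : valid s -> size s <= r -> #|pair_facet s| = n - m.
Proof.
move=> vs ss; have cr : low s r = m + 2 * r by rewrite /low idx_default.
have := rank_lower (q := r) vs; rewrite cr => /(_ (ltnW mrn)) e.
rewrite -(cardsID [set x : 'I_n | x < m + 2 * r] (pair_facet s)).
rewrite (_ : pair_facet s :&: _ = [set x in pair_facet s | x < m + 2 * r]); last first.
  by apply/setP => x; rewrite !inE.
rewrite e (_ : pair_facet s :\: _ = ~: [set x : 'I_n | x < m + 2 * r]); last first.
  apply/setP => x; rewrite !inE; case: ltnP => //= le.
  by rewrite (@in_pairs_tail s x r).
have := cardsC [set x : 'I_n | x < m + 2 * r]; rewrite card_ord.
have -> : #|[set x : 'I_n | x < m + 2 * r]| = m + 2 * r.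
  rewrite -[RHS](size_iota 0) -(count_predT (iota _ _)) -card_ord_count ?(ltnW mrn) //.
by lia.
Qed.

(** The rank of a lower vertex in a facet is even and that of an upper vertex is
    odd.  Two vertices completing the same ridge to facets cannot be of the same
    kind, as one of the facets would then contain both. *)
Lemma ridge_parity s t (Q : {set 'I_n}) (v w : 'I_n) :
  valid s -> valid t -> size s <= r -> size t <= r ->
  v \notin Q -> w \notin Q -> v < w -> v |: Q = pair_facet s -> w |: Q = pair_facet t ->
  odd (#|[set x in Q | (x < v)%N]| + #|[set x in Q | (x < w)%N]|).
Proof.
move=> vs vt ss st vQ wQ vw sE tE.
have vt' : v \notin pair_facet t.
  by rewrite -tE !inE negb_or vQ andbT -(inj_eq val_inj) neq_ltn vw.
have ws' : w \notin pair_facet s.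
  by rewrite -sE !inE negb_or wQ andbT -(inj_eq val_inj) neq_ltn vw orbT.
have small t' x : size t' <= r -> (x : 'I_n) \notin pair_facet t' -> x < m + 2 * r.
  move=> st'; apply: contraNltn => le; rewrite inE.
  exact: in_pairs_tail st' le.
have vlt := small t v st vt'; have wlt := small s w ss ws'.
have cQs k : #|[set x in pair_facet s | x < k]| = (v < k) + #|[set x in Q | x < k]|.
  rewrite -sE (cardsD1 v) !inE eqxx /=; congr (_ + _); apply: eq_card => x.
  by rewrite !inE; case: eqP => [->|] //=; rewrite (negbTE vQ).
have cQt k : #|[set x in pair_facet t | x < k]| = (w < k) + #|[set x in Q | x < k]|.
  rewrite -tE (cardsD1 w) !inE eqxx /=; congr (_ + _); apply: eq_card => x.
  by rewrite !inE; case: eqP => [->|] //=; rewrite (negbTE wQ).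
have /pair_facetP [p vp] : v \in pair_facet s by rewrite -sE setU11.
have /pair_facetP [q wq] : w \in pair_facet t by rewrite -tE setU11.
have rs := rank_lower (q := p) vs; have rt := rank_lower (q := q) vt.
have rs' := rank_upper (q := p) vs; have rt' := rank_upper (q := q) vt.
have vn := ltn_ord v; have wn := ltn_ord w.
have sv : #|[set x in Q | x < v]| = #|[set x in pair_facet s | x < v]|.
  by rewrite cQs ltnn.
have tw : #|[set x in Q | x < w]| = #|[set x in pair_facet t | x < w]|.
  by rewrite cQt ltnn.
(* if [v] and [w] are both lower, the rank of [w.+1] in the facet of [s] is odd,
   so [w.+1] is upper there and [w] belongs to this facet; the case of two
   upper vertices is symmetric *)
case: vp wq => [ve|ve] [we|we].
- exfalso; have w1n : w.+1 < n by lia.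
  have w1Q : Ordinal w1n \in Q.
    have : Ordinal w1n \in pair_facet t by apply/pair_facetP; exists q; right; rewrite /= we.
    by rewrite -tE !inE -(inj_eq val_inj) /= (gtn_eqF (ltnSn w)).
  have : Ordinal w1n \in pair_facet s by rewrite -sE !inE w1Q orbT.
  move=> /pair_facetP [l /= wl].
  have := cQs w.+1; have := cQt w.+1.
  rewrite we rt' -?we // ltnSn ltnS (ltnW vw) => e1; rewrite -?we.
  case: wl => wl.
    by rewrite wl rank_lower -?wl //; lia.
  by case/negP: ws'; apply/pair_facetP; exists l; left; case: wl.
- rewrite sv tw ve we rs -?ve 1?ltnW // rt' -?we; last by lia.
  by rewrite oddD /= !oddM.
- rewrite sv tw ve we rt -?we 1?ltnW // rs' -?ve; last by lia.
  by rewrite oddD /= !oddM.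
- exfalso; have v1n : v.-1 < n by lia.
  have v1Q : Ordinal v1n \in Q.
    have : Ordinal v1n \in pair_facet s by apply/pair_facetP; exists p; left; rewrite /= ve.
    by rewrite -sE !inE -(inj_eq val_inj) /= => /orP [/eqP|//]; lia.
  have : Ordinal v1n \in pair_facet t by rewrite -tE !inE v1Q orbT.
  move=> /pair_facetP [l /= vl].
  have cv : low s p <= v by rewrite ve.
  have f1 : (v < low s p) = false by rewrite ltnNge cv.
  have f2 : (w < low s p) = false by rewrite ltnNge (leq_trans cv (ltnW vw)).
  have e1 := cQs (low s p); have e2 := cQt (low s p).
  rewrite f1 rs ?(leq_trans cv (ltnW vn)) // in e1; rewrite f2 -e1 in e2.
  case: vl => vl.
    case/negP: vt'; apply/pair_facetP; exists l; right.
    by rewrite -vl ve.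
  have e3 : low s p = (low t l).+1 by rewrite -vl ve.
  have ln : low t l < n by apply: leq_trans (ltnW vn); rewrite -e3.
  by have := congr1 odd e2; rewrite e3 rank_upper // /= !oddM.
Qed.

End Facets.

(** * Nonfaces and boundary of a squeezed ball *)

Section Ball.
Variables (m r n : nat).
Local Notation valid := (valid m).
Local Notation idx := (idx m).
Local Notation low := (low m).
Local Notation pair_facet := (@pair_facet m n).
Local Notation low_part := (@low_part m n).
Implicit Types (s t : seq nat) (H G : {set 'I_n}).

Variable Uw : seq (seq nat).

(** A shifted order ideal seen through words.  In [fi_up] the word [t] may be
    shorter than [s], the missing letters being replaced by the default [m], so
    that closure under prefixes is a case of this condition. *)
Record facet_ideal : Prop := FacetIdeal {
  fi_valid : forall s, s \in Uw -> valid s;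
  fi_size : forall s, s \in Uw -> size s <= r;
  fi_up : forall s t, s \in Uw -> valid t -> (forall q, idx s q <= idx t q) -> t \in Uw;
  fi_nil : [::] \in Uw }.

Hypothesis UI : facet_ideal.
Let U_valid := fi_valid UI.
Let U_size := fi_size UI.
Let U_up := fi_up UI.
Let U_nil := fi_nil UI.

Definition in_ball H : bool := has (fun s => H \subset pair_facet s) Uw.
(** Interior faces, described by the intervals of the reversed shelling; that the
    other faces of the ball are those of the sphere is [sphereP]. *)
Definition in_int H : bool :=
  has (fun s => (pair_facet s :\: low_part s \subset H) && (H \subset pair_facet s)) Uw.

Lemma in_ballP H : reflect (exists2 s, s \in Uw & H \subset pair_facet s) (in_ball H).
Proof. exact: hasP. Qed.

Lemma in_intP H : reflect
  (exists s, [/\ s \in Uw, pair_facet s :\: low_part s \subset H & H \subset pair_facet s]) (in_int H).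
Proof.
apply: (iffP hasP) => [[s sU /andP [h1 h2]]|[s [sU h1 h2]]]; exists s => //.
by rewrite h1 h2.
Qed.

Lemma in_ball_sub H G : H \subset G -> in_ball G -> in_ball H.
Proof. by move=> HG /in_ballP [s sU GF]; apply/in_ballP; exists s => //; apply: subset_trans GF. Qed.

(** A prefix has larger indices than the word, in the sense of [idx]. *)
Lemma take_in_ideal s k : s \in Uw -> take k s \in Uw.
Proof.
move=> sU; apply: (U_up sU); first exact/valid_take/U_valid.
by move=> q; rewrite idx_take; case: ifP => // _; exact/idx_le/U_valid.
Qed.

(** The minimal generators of the ideal spanned by the complement of [Uw].  It is
    enough to require the quotient by the last variable to be in [Uw], for the
    quotients by the other variables have larger indices. *)
Definition min_gen g : bool := [&& valid g, g \notin Uw & take (size g).-1 g \in Uw].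

Lemma min_gen_size g : min_gen g -> 0 < size g <= r.+1.
Proof.
case/and3P => _ gU tU; apply/andP; split.
  by rewrite lt0n; apply: contraNneq gU => /size0nil ->.
by have := U_size tU; rewrite size_take; case: ifP; lia.
Qed.

Lemma min_gen_prefix s : valid s -> s \notin Uw -> exists2 k, k <= size s & min_gen (take k s).
Proof.
move=> vs sU.
have ex : exists k, take k s \notin Uw by exists (size s); rewrite take_size.
have [k kU kmin] := ex_minnP ex.
have ks : k <= size s by apply: kmin; rewrite take_size.
exists k => //; rewrite /min_gen valid_take // kU size_takel //=.
case: k kU kmin ks => [|k] kU kmin ks; first by rewrite take0 U_nil in kU.
rewrite take_takel //=; apply: contraT => /kmin; rewrite ltnn //.
Qed.

Hypothesis mrn : m + 2 * r < n.

(** The word read off from [H] by [greedy] is, index by index, above that of any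
    facet that contains [H], hence in [Uw]. *)
Lemma ball_partition H : in_ball H ->
  exists s, [/\ s \in Uw, low_part s \subset H & H \subset pair_facet s].
Proof.
case/in_ballP => t tU HF; have [s [vs ss RH alt]] := greedy m H r.+1.
have sU : s \in Uw.
  apply: (U_up tU vs); apply: (facet_order_lower mrn vs (U_valid tU) ss).
  exact: subset_trans RH HF.
exists s; split=> //; case: alt => [all_in|[e _]].
  by apply/subsetP => h hH; rewrite inE; exact: all_in.
by have := U_size sU; rewrite e ltnn.
Qed.

(** The minimal nonfaces of the ball are the stretched minimal generators: the
    word read off from a nonface by [greedy] is not in [Uw]. *)
Lemma nonface_min_gen H : ~~ in_ball H -> exists2 g, min_gen g & low_part g \subset H.
Proof.
move=> nB; have [s [vs ss RH alt]] := greedy m H r.+1.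
have sU : s \notin Uw.
  apply: contra nB => sU; apply/in_ballP; exists s => //.
  case: alt => [all_in|[e _]]; last by have := U_size sU; rewrite e ltnn.
  by apply/subsetP => h hH; rewrite inE; exact: all_in.
have [k _ gk] := min_gen_prefix vs sU; exists (take k s) => //.
exact: subset_trans (low_part_take _ _ _ _) RH.
Qed.

Lemma min_gen_nonface g H : min_gen g -> low_part g \subset H -> ~~ in_ball H.
Proof.
move=> gg RH; have /andP [_ gs] := min_gen_size gg.
case/and3P: gg => vg gU _; apply: contra gU => /in_ballP [t tU HF].
apply: (U_up tU vg); apply: (facet_order_lower mrn vg (U_valid tU) gs).
exact: subset_trans RH HF.
Qed.

Lemma upper_part_le H s t : s \in Uw -> t \in Uw ->
  pair_facet t :\: low_part t \subset H -> H \subset pair_facet s -> forall q, idx t q <= idx s q.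
Proof.
move=> sU tU FH HF; apply: (facet_order_upper mrn); rewrite ?U_valid ?U_size //.
exact: subset_trans FH HF.
Qed.

(** Let [H] be an interior face in the facet of [s], and [x] a vertex of this facet
    outside of [H] and of the restriction face.  The ridge opposite to [x] lies
    in a second facet, obtained by moving down by one the block of pairs that
    ends at [x]; its word is in [Uw] because it is still above the word [t] whose
    interval contains [H]. *)
Lemma interior_ridge s t (x : 'I_n) H : s \in Uw -> t \in Uw ->
  x \in pair_facet s -> x \notin low_part s -> x \notin H -> H \subset pair_facet s ->
  pair_facet t :\: low_part t \subset H ->
  exists2 w, w \in Uw & w != s /\ pair_facet s :\ x \subset pair_facet w.
Proof.
move=> sU tU xF xR xH HF tH.
have vs := U_valid sU; have vt := U_valid tU.
have ss := U_size sU; have st := U_size tU.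
have le := upper_part_le sU tU tH HF.
have xt : x \notin pair_facet t :\: low_part t by apply: contra xH; exact: (subsetP tH).
have /pair_facetP [q [xq|xq]] := xF.
  have qs : size s <= q.
    rewrite leqNgt; apply: contra xR => qs; apply/low_partP; by exists q.
  have sq : idx s q = m by rewrite idx_default.
  have tq : idx t q < m.
    have [//|] := ltnP (idx t q) m; move=> ge.
    have tqm : idx t q = m by apply/eqP; rewrite eqn_leq ge idx_le.
    case/negP: xt; rewrite inE; apply/andP; split.
      apply/low_partP => -[p ps xp]; move: ps; rewrite -(idx_lt p vt).
      suff -> : p = q by rewrite tqm ltnn.
      by apply: (low_inj vt); rewrite -xp xq /low sq tqm.
    by apply/pair_facetP; exists q; left; rewrite xq /low sq tqm.
  have qr : q < r.
    by apply: leq_trans st; rewrite -(idx_lt q vt).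
  (* If [x] were in the final segment of the facet of [s], then the pairs of [t]
     up to [q] would come before those of [s] at the same positions, and the
     first of them would have no place in the facet of [s]. *)
  have key p : p <= q -> (low t p).+1 < low s p.
    move=> pq; have [k] := ubnP (q - p); elim: k p pq => // k IH p pq qpk.
    have [v vE vF] := upper_vertex mrn vt st (leq_ltn_trans pq qr).
    have vx : v != x by apply: contraNneq xt => <-.
    have /pair_facetP [l vl] : v \in pair_facet s.
      by apply: (subsetP HF); apply: (subsetP tH).
    have [pq'|pq'] := eqVneq p q.
      have ne : (low t p).+1 != low s p.
        apply: contraNneq vx => e; rewrite -(inj_eq val_inj) /= vE e pq' xq //.
      rewrite ltn_neqAle ne /=; move: tq; rewrite -pq' /low; rewrite -pq' in sq.
      by rewrite sq; clear; lia.
    have lt : (low t p.+1).+1 < low s p.+1 by apply: IH; move: pq pq' qpk; clear; lia.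
    have pr1 : p.+1 < r by apply: leq_ltn_trans qr; rewrite ltn_neqAle pq' pq.
    have [v' v'E v'F] := upper_vertex mrn vt st pr1.
    have /pair_facetP [l' v'l] : v' \in pair_facet s.
      by apply: (subsetP HF); apply: (subsetP tH).
    have l'p : l' <= p.
      rewrite leqNgt; apply/negP => pl; have := low_gap vs pl; move: v'l lt.
      by rewrite v'E; clear; lia.
    have := low_gap vs l'p; have := low_gap vt (leqnSn p).
    by move: v'l; rewrite v'E; clear; lia.
  exfalso; have lt0 := key 0 (leq0n q).
  have [v vE vF] := upper_vertex mrn vt st (leq_ltn_trans (leq0n q) qr).
  have /pair_facetP [l vl] : v \in pair_facet s by apply: (subsetP HF); apply: (subsetP tH).
  have := low_gap vs (leq0n l); move: vl lt0; rewrite vE; clear; lia.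
have tq : idx t q < idx s q.
  have [//|ge] := ltnP (idx t q) (idx s q).
  have e : idx t q = idx s q by apply/eqP; rewrite eqn_leq ge le.
  case/negP: xt; rewrite inE; apply/andP; split.
    apply/low_partP => -[p _ xp].
    have [pq|qp] := leqP p q.
      by have := low_gap vt pq; move: xp; rewrite xq /low e; clear; lia.
    by have := low_gap vt (ltnW qp); move: xp qp; rewrite xq /low e; clear; lia.
  by apply/pair_facetP; exists q; right; rewrite xq /low e.
have sqm := idx_le q vs.
(* shift down by one the block of indices that are equal to the [q]-th one and
   end at it *)
pose f p := if (p <= q) && (idx s p == idx s q) then (idx s p).-1 else idx s p.
pose w := mkseq f (maxn (size s) q.+1).
have fm p : p < maxn (size s) q.+1 -> f p < m.
  rewrite /f => pm; case: ifP => [/andP [_ /eqP e]|/negbT nd].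
    by rewrite e; move: tq sqm; clear; lia.
  have [pq|qp] := leqP p q.
    have ne : idx s p != idx s q by move: nd; rewrite pq.
    by have := idx_mono vs pq; move: ne sqm; clear; lia.
  by rewrite (idx_lt p vs); move: pm; rewrite leq_max ltnS (leqNgt p q) qp orbF.
have wf p : idx w p = f p.
  have [pm|pm] := ltnP p (maxn (size s) q.+1); first by rewrite /idx nth_mkseq.
  rewrite idx_default ?size_mkseq // /f; move: pm; rewrite geq_max => /andP [sp qp].
  by rewrite leqNgt qp /= idx_default.
have vw : valid w.
  rewrite /valid; apply/andP; split; last first.
    by apply/allP => y /mapP [p]; rewrite mem_iota add0n => /fm ltm ->.
  apply/(sortedP 0) => i; rewrite size_mkseq => iw; rewrite !nth_mkseq ?(ltnW iw) //.
  have := idx_mono vs (leqnSn i); rewrite /f.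
  case: (leqP i q) => iq; case: (leqP i.+1 q) => iq1 /=; try by move: iq iq1; clear; lia.
    have := idx_mono vs iq1; have := idx_mono vs iq.
    by case: eqP; case: eqP; clear; lia.
  by case: eqP; clear; lia.
have wU : w \in Uw.
  apply: (U_up tU vw) => p; rewrite wf /f; case: ifP => [/andP [pq /eqP e]|_]; last exact: le.
  by have := idx_mono vt pq; rewrite e; move: tq; clear; lia.
exists w => //; split.
  apply/eqP => ws; have := wf q; rewrite ws /f leqnn eqxx /=; move: tq; clear; lia.
apply/subsetP => y; rewrite !inE => /andP [yx /in_pairsP [p yp]].
apply/in_pairsP; have [dec|ndec] := boolP ((p <= q) && (idx s p == idx s q)); last first.
  by exists p; rewrite /low wf /f (negbTE ndec).
have /andP [pq /eqP e] := dec.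
case: yp => yp.
  exists p; right; rewrite /low wf /f dec yp /low; move: tq; rewrite e; clear; lia.
have pq' : p < q.
  rewrite ltn_neqAle pq andbT; apply: contraNneq yx => pq'.
  by rewrite -(inj_eq val_inj) /= yp xq pq'.
have e1 : idx s p.+1 = idx s q.
  apply/eqP; rewrite eqn_leq (idx_mono vs pq') /= -e; exact: idx_mono vs (leqnSn p).
exists p.+1; left; rewrite /low wf /f pq' e1 eqxx /= yp /low e; move: tq; clear; lia.
Qed.

Definition idx_sum s := \sum_(q < r) idx s q.

(** A face of the ball is not interior if and only if it lies in a ridge that is
    contained in a single facet. *)
Lemma sphereP H : reflect
  (exists G s, [/\ H \subset G, #|G| = (n - m).-1, s \in Uw, G \subset pair_facet s
     & forall t, t \in Uw -> G \subset pair_facet t -> t = s])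
  (in_ball H && ~~ in_int H).
Proof.
apply: (iffP andP) => [[HB HI]|[G [s [HG cG sU GF uniqG]]]].
  (* Among the facets that contain [H], one of least index sum: the ridge opposite
     to a vertex that is outside of [H] and of the restriction face lies in no
     other facet, which would have a smaller sum. *)
  have ex : exists k, has (fun s => (H \subset pair_facet s) && (idx_sum s == k)) Uw.
    by case/in_ballP: HB => s sU HF; exists (idx_sum s); apply/hasP; exists s; rewrite ?HF ?eqxx.
  have [k /hasP [s sU /andP [HF /eqP sk]] kmin] := ex_minnP ex.
  have /subsetPn [x xF xH] : ~~ (pair_facet s :\: low_part s \subset H).
    by apply: contra HI => FH; apply/in_intP; exists s.
  move: xF; rewrite inE => /andP [xR xF].
  exists (pair_facet s :\ x), s; split=> //.
  - by rewrite subsetD1 HF xH.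
  - have := card_pair_facet mrn (U_valid sU) (U_size sU).
    by rewrite (cardsD1 x) xF /= => <-.
  - exact: subsetDl.
  move=> t tU GF.
  have le := facet_order_lower mrn (U_valid sU) (U_valid tU) (leqW (U_size sU))
    (subset_trans (_ : low_part s \subset pair_facet s :\ x) GF).
  have {}le : forall q, idx t q <= idx s q.
    by apply: le; rewrite subsetD1 low_part_sub xR.
  have kt : k <= idx_sum t.
    apply: kmin; apply/hasP; exists t => //; rewrite eqxx andbT.
    by apply: subset_trans GF; rewrite subsetD1 HF xH.
  apply: valid_eq (U_valid tU) (U_valid sU) _ => q.
  have [qr|rq] := ltnP q r; last first.
    by rewrite !idx_default // (leq_trans (U_size _) rq).
  apply/eqP; rewrite eqn_leq le /= leqNgt; apply/negP => lt.
  have : idx_sum t < idx_sum s.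
    rewrite /idx_sum (bigD1 (Ordinal qr)) //= [X in _ < X](bigD1 (Ordinal qr)) //=.
    by rewrite -addSn; apply: leq_add => //; apply: leq_sum => i _; exact: le.
  by rewrite sk ltnNge kt.
have cF := card_pair_facet mrn (U_valid sU) (U_size sU).
have GB : in_ball G by apply/in_ballP; exists s.
split; first exact: in_ball_sub HG GB.
have [x xF xG] : exists2 x, x \in pair_facet s & x \notin G.
  apply/subsetPn; apply/negP => FG; have := subset_leq_card FG.
  by rewrite cG cF; move: mrn; clear; lia.
have GE : G = pair_facet s :\ x.
  apply/eqP; rewrite eqEcard subsetD1 GF xG /=.
  by move: cF; rewrite (cardsD1 x) xF cG => <-.
have xR : x \notin low_part s.
  have [t [tU RG GFt]] := ball_partition GB.
  by rewrite -(uniqG t tU GFt); apply: contra xG; exact: (subsetP RG).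
apply/in_intP => -[t [tU tH _]].
have xH : x \notin H by apply: contra xG; exact: (subsetP HG).
have [w wU [ws Gw]] := interior_ridge sU tU xF xR xH (subset_trans HG GF) tH.
by case/eqP: ws; apply: uniqG; rewrite ?GE.
Qed.

Lemma in_int_ball H : in_int H -> in_ball H.
Proof. by case/in_intP => s [sU _ HF]; apply/in_ballP; exists s. Qed.

(** The faces of the sphere form a simplicial complex by [sphereP]. *)
Lemma in_int_up H G : H \subset G -> in_int H -> in_ball G -> in_int G.
Proof.
move=> HG HI GB; apply: contraT => GI.
have /sphereP [G' [s [GG' cG' sU G'F uG']]] : in_ball G && ~~ in_int G by rewrite GB GI.
have : in_ball H && ~~ in_int H.
  by apply/sphereP; exists G', s; split=> //; apply: subset_trans GG'.
by rewrite HI andbF.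
Qed.

End Ball.

(** * Stretching the minimal generators of the shifted ideal *)

Section Generators.
Variables (m r n : nat).
Hypothesis mrn : m + 2 * r < n.
Local Notation valid := (valid m).
Local Notation idx := (idx m).
Local Notation low := (low m).
Local Notation pair_facet := (@pair_facet m n).
Local Notation low_part := (@low_part m n).
Variable Uw : seq (seq nat).
Hypothesis UI : facet_ideal m r Uw.
Let U_valid := fi_valid UI.
Let U_size := fi_size UI.
Let U_up := fi_up UI.
Let U_nil := fi_nil UI.
Local Notation min_gen := (min_gen m Uw).
Local Notation in_ball := (@in_ball m n Uw).
Implicit Types (g h s : seq nat) (e : nat).

Lemma min_gen_valid g : min_gen g -> valid g.
Proof. by case/and3P. Qed.

(** For [e = 0] this gives the generators of I(U), and for [e = 2] those of the
    ideal of the ball. *)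
Definition stretch e g q := idx g q + e * q.
Definition stretch_mnm e g : 'X_{1..n} :=
  [multinom \sum_(q < size g) (stretch e g q == i :> nat) | i < n].
(** The variables below the last letter of the stretched word, except for the
    blocks of [e] variables that start at its other letters. *)
Definition colon_vars e g : {set 'I_n} :=
  [set v : 'I_n | (v < stretch e g (size g).-1) &&
    all (fun q => ~~ (stretch e g q <= v < stretch e g q + e)) (iota 0 (size g).-1)].

(** Words are compared by length and then by index sum, which is at most
    [r.+1 * m] for minimal generators. *)
Definition genkey g := size g * (r.+1 * m).+1 + sumn g.

Lemma sumn_idx s : sumn s = \sum_(q < size s) idx s q.
Proof. by rewrite sumnE (big_nth m) big_mkord. Qed.

Lemma sumn_le g : valid g -> size g <= r.+1 -> sumn g <= r.+1 * m.
Proof.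
move=> vg gs; rewrite sumn_idx; apply: (@leq_trans (\sum_(q < size g) m)).
  by apply: leq_sum => q _; exact: idx_le.
by rewrite sum_nat_const card_ord leq_mul2r gs orbT.
Qed.

Lemma genkey_size g h : min_gen g -> genkey h <= genkey g -> size h <= size g.
Proof.
move=> gg; have /andP [_ gs] := min_gen_size UI gg.
have := sumn_le (min_gen_valid gg) gs; rewrite /genkey => le1 le2.
rewrite leqNgt; apply/negP => lt.
have : (size g).+1 * (r.+1 * m).+1 <= size h * (r.+1 * m).+1 by rewrite leq_mul2r lt orbT.
by rewrite mulSn; move: le1 le2; clear; lia.
Qed.

(** A minimal generator that is not later in the order and has larger or equal
    indices is the same: if [h] were shorter than [g], then [h] would be above a
    proper prefix of [g], which is in [Uw]. *)
Lemma genkey_eq g h : min_gen g -> min_gen h -> genkey h <= genkey g ->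
  (forall q, idx g q <= idx h q) -> h = g.
Proof.
move=> gg gh key le; have vg := min_gen_valid gg; have vh := min_gen_valid gh.
have hg := genkey_size gg key.
have [lt|ge] := ltnP (size h) (size g).
  case/and3P: gh => _ /negP hU _; case: hU.
  have tU : take (size h) g \in Uw.
    case/and3P: gg => _ _ /(take_in_ideal UI (size h)).
    by rewrite take_takel //; move: lt; clear; lia.
  apply: (U_up tU vh) => q; rewrite idx_take; case: ltnP => // hq.
  by rewrite idx_default.
have sz : size h = size g by apply/eqP; rewrite eqn_leq hg ge.
apply: valid_eq vh vg _ => q; have [qs|qs] := ltnP q (size g); last first.
  by rewrite !idx_default ?sz.
apply/eqP; rewrite eqn_leq le andbT leqNgt; apply/negP => lt.
have : sumn g < sumn h.
  rewrite !sumn_idx sz (bigD1 (Ordinal qs)) //= [X in _ < X](bigD1 (Ordinal qs)) //=.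
  by rewrite -addSn; apply: leq_add => //; apply: leq_sum => i _; exact: le.
by move: key; rewrite /genkey sz leq_add2l; clear; lia.
Qed.

Lemma stretch_lt e g q : e <= 2 -> min_gen g -> q < size g -> stretch e g q < n.
Proof.
move=> e2 gg qs; have /andP [_ gs] := min_gen_size UI gg.
have lt : idx g q < m by rewrite (idx_lt q (min_gen_valid gg)).
rewrite /stretch; apply: leq_ltn_trans mrn; rewrite -(ltn_add2r (e * q)) in lt.
apply: leq_trans (ltnW lt) _; rewrite leq_add2l; apply: leq_mul => //.
by move: qs gs; clear; lia.
Qed.

Lemma mdeg_stretch e g : e <= 2 -> min_gen g -> mdeg (stretch_mnm e g) = size g.
Proof.
move=> e2 gg; rewrite mdegE.
under eq_bigr do rewrite mnmE.
rewrite exchange_big /= -[RHS](card_ord (size g)) -sum1_card; apply: eq_bigr => q _.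
rewrite (bigD1 (Ordinal (stretch_lt e2 gg (ltn_ord q)))) //= eqxx big1 // => i.
by rewrite -(inj_eq val_inj) /= eq_sym => /negbTE ->.
Qed.

Lemma stretch_supp e g v : 0 < stretch_mnm e g v ->
  exists2 q, q < size g & v = stretch e g q :> nat.
Proof.
rewrite mnmE lt0n sum_nat_eq0 negb_forall => /existsP [q /=].
by have [<- _|_] := eqVneq (stretch e g q) (v : nat); [exists q | ].
Qed.

(** Replacing the first letter of [g] which after stretching exceeds [v] by the
    letter that stretches to [v] gives a word with smaller indices.  It stays
    outside of [Uw], and its minimal prefix is an earlier generator. *)
Lemma colon_lower e g (v : 'I_n) : min_gen g -> v \in colon_vars e g ->
  exists g', [/\ min_gen g', genkey g' < genkey g & (stretch_mnm e g' <= stretch_mnm e g + U_(v))%MM].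
Proof.
move=> gg; rewrite inE => /andP [vlt /allP vblock].
have vg := min_gen_valid gg; have /andP [g0 gs] := min_gen_size UI gg.
have ex : exists q, v < stretch e g q by exists (size g).-1.
have [q vq qmin] := ex_minnP ex.
have qk : q <= (size g).-1 by exact: qmin.
have qs : q < size g by move: qk g0; clear; lia.
have lo p : p < q -> stretch e g p + e <= v.
  move=> pq; have pk : p \in iota 0 (size g).-1.
    by rewrite mem_iota /=; move: pq qk; clear; lia.
  have nb := vblock _ pk; rewrite leqNgt; apply: contra nb => ->.
  by rewrite andbT leqNgt; apply: contraTN pq => /qmin; rewrite -leqNgt.
have eqv : e * q <= v.
  case: q vq qmin qk qs lo => [|q] vq qmin qk qs lo; first by rewrite muln0.
  by have := lo q (ltnSn q); rewrite /stretch mulnS; clear; lia.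
(* [q] is the position of the first stretched letter beyond [v] *)
pose f p := if p == q then v - e * q else idx g p.
pose u := mkseq f (size g).
have tu p : idx u p = if p < size g then f p else m.
  case: ltnP => pg; first by rewrite /idx nth_mkseq.
  by rewrite idx_default // size_mkseq.
have fq : f q < idx g q.
  by rewrite /f eqxx; move: vq eqv; rewrite /stretch; clear; lia.
have fle p : f p <= idx g p.
  by have [->|ne] := eqVneq p q; [exact: ltnW | rewrite /f (negbTE ne)].
have vu : valid u.
  rewrite /valid; apply/andP; split; last first.
    apply/allP => y /mapP [p]; rewrite mem_iota add0n => /andP [_ pg] ->.
    by apply: leq_ltn_trans (fle p) _; rewrite (idx_lt p vg).
  apply/(sortedP 0) => p; rewrite size_mkseq => pg; rewrite !nth_mkseq ?(ltnW pg) //.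
  have [pq|pq] := eqVneq p.+1 q.
    have := lo p; rewrite -pq ltnSn => /(_ isT); rewrite /f pq eqxx -pq.
    by rewrite (ltn_eqF (ltnSn p)) /stretch mulnS; clear; lia.
  apply: leq_trans (fle p) _; rewrite /f (negbTE pq); exact: idx_mono.
have uU : u \notin Uw.
  case/and3P: (gg) => _ gU _; apply: contra gU => uU; apply: (U_up uU vg) => p.
  by rewrite tu; case: ltnP => pg; [exact: fle | rewrite idx_default].
have [k kle gk] := min_gen_prefix UI vu uU; rewrite size_mkseq in kle.
exists (take k u); split=> //.
  rewrite /genkey size_takel ?size_mkseq //.
  move: kle; rewrite leq_eqVlt => /orP [/eqP kE|klt].
    rewrite kE ltn_add2l -(size_mkseq f (size g)) take_size !sumn_idx size_mkseq.
    rewrite (bigD1 (Ordinal qs)) //= [X in _ < X](bigD1 (Ordinal qs)) //= tu qs.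
    rewrite -addSn; apply: leq_add => //; apply: leq_sum => i _.
    by rewrite tu ltn_ord.
  apply: (@leq_trans (k.+1 * (r.+1 * m).+1)); last first.
    by apply: leq_trans (leq_addr _ _); rewrite leq_mul2r klt orbT.
  rewrite [k.+1 * _]mulSn addnC ltn_add2r ltnS.
  by apply: sumn_le (min_gen_valid gk) _; have /andP [] := min_gen_size UI gk.
apply/mnm_lepP => i; rewrite mnmDE mnm1E !mnmE size_takel ?size_mkseq //.
apply: (@leq_trans (\sum_(p < size g) (stretch e u p == i))).
  rewrite (eq_bigr (fun p : 'I_k => (stretch e u p == i) : nat)); last first.
    by move=> p _; rewrite /stretch idx_take ltn_ord.
  rewrite (big_ord_widen (size g) (fun p => (stretch e u p == i) : nat) kle) big_mkcond.
  by apply: leq_sum => p _; case: ifP.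
rewrite (bigD1 (Ordinal qs)) //= [X in _ <= X + _](bigD1 (Ordinal qs)) //=.
rewrite /stretch tu qs /f eqxx subnK // addnC -[X in _ <= X]addnA [X in _ <= X]addnC -addnA.
apply: leq_add.
  apply: leq_sum => p ne; rewrite tu ltn_ord /f.
  by rewrite (_ : (p == q :> nat) = false) //; apply: contraNF ne => /eqP e'; apply/eqP/val_inj.
by rewrite -(inj_eq val_inj) leq_addr.
Qed.

Lemma count_le s x : count (fun y => y <= x) s = \sum_(z < x.+1) count_mem (nat_of_ord z) s.
Proof.
elim: s => [|y s IH] /=; first by rewrite big1.
rewrite IH big_split /=; congr (_ + _).
have [yx|xy] := leqP y x.
  have lt : y < x.+1 by [].
  rewrite (bigD1 (Ordinal lt)) //= eqxx big1 // => z; rewrite -(inj_eq val_inj) /= eq_sym.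
  by move/negbTE ->.
rewrite big1 // => z _; apply/eqP; rewrite eqb0; have := ltn_ord z.
by apply: contraTneq => <-; rewrite ltnS -ltnNge.
Qed.

Lemma stretch0_count g (i : 'I_n) : stretch_mnm 0 g i = count_mem (i : nat) g.
Proof.
rewrite mnmE -sum1_count (big_nth m) big_mkord [RHS]big_mkcond; apply: eq_bigr => q _.
by rewrite /stretch mul0n addn0 /idx /=; case: (_ == _).
Qed.

(** Compare the numbers of letters up to the [q]-th letter of [h]: the monomial
    [w] contributes none, since it has no variable below the last letter of
    [g]. *)
Lemma colon_upper0 g h (w : 'X_{1..n}) : min_gen g -> min_gen h -> genkey h <= genkey g ->
  (forall v, v \in colon_vars 0 g -> w v = 0) -> (stretch_mnm 0 h <= stretch_mnm 0 g + w)%MM ->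
  forall q, idx g q <= idx h q.
Proof.
move=> gg gh key wV le q; have vg := min_gen_valid gg; have vh := min_gen_valid gh.
have hg := genkey_size gg key; have /andP [g0 gs] := min_gen_size UI gg.
have [qh|hq] := ltnP q (size h); last by rewrite (idx_default _ hq) idx_le.
rewrite leqNgt; apply/negP => lt.
have hm : idx h q < m by rewrite (idx_lt q vh).
have c1 : q.+1 <= count (fun y => y <= idx h q) h.
  rewrite -[X in count _ X](cat_take_drop q.+1 h) count_cat.
  apply: leq_trans (leq_addr _ _).
  have allh : all (fun y => y <= idx h q) (take q.+1 h).
    apply/(all_nthP m) => p; rewrite size_takel // => pq.
    by rewrite nth_take //; exact: (idx_mono vh).
  by move: allh; rewrite all_count => /eqP ->; rewrite size_takel.
have c2 : count (fun y => y <= idx h q) g <= q.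
  rewrite -[X in count _ X](cat_take_drop q g) count_cat.
  rewrite [X in _ + X](_ : _ = 0) ?addn0.
    by apply: leq_trans (count_size _ _) _; rewrite size_take; case: ltnP.
  apply/eqP; rewrite -leqn0 leqNgt -has_count; apply/(has_nthP m) => -[p].
  rewrite size_drop nth_drop => _; apply/negP; rewrite -ltnNge.
  exact: leq_trans lt (idx_mono vg (leq_addr _ _)).
have := leq_trans c1 (leq_trans _ c2); rewrite ltnn => /(_ _) F.
suff : count (fun y => y <= idx h q) h <= count (fun y => y <= idx h q) g by move/F.
rewrite !count_le; apply: leq_sum => z _.
have zl : z <= idx h q by rewrite -ltnS.
have zn : z < n by apply: leq_ltn_trans mrn; apply: leq_trans (leq_addr _ _); apply: leq_trans zl (ltnW hm).
have := mnm_lepP le (Ordinal zn); rewrite mnmDE !stretch0_count wV ?addn0 //.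
rewrite inE; apply/andP; split.
  rewrite /stretch mul0n addn0 /=; apply: leq_ltn_trans zl (leq_trans lt _).
  by apply: idx_mono => //; move: qh hg; clear; lia.
by apply/allP => p _; rewrite addn0 ltnNge andbN.
Qed.

(** Each letter of the stretched word of [h] is beyond the last letter of the
    stretched word of [g] or lies in one of its blocks.  Successive letters of
    the former differ by at least two, so they are in different blocks, and the
    [q]-th one is not before the [q]-th block. *)
Lemma colon_upper2 g h (w : 'X_{1..n}) : min_gen g -> min_gen h -> genkey h <= genkey g ->
  (forall v, v \in colon_vars 2 g -> w v = 0) -> (stretch_mnm 2 h <= stretch_mnm 2 g + w)%MM ->
  forall q, idx g q <= idx h q.
Proof.
move=> gg gh key wV le; have vg := min_gen_valid gg; have vh := min_gen_valid gh.
have hg := genkey_size gg key; have /andP [g0 gs] := min_gen_size UI gg.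
elim/ltn_ind => q IH.
have [qh|hq] := ltnP q (size h); last by rewrite (idx_default _ hq) idx_le.
have cn := stretch_lt (leqnn 2) gh qh.
have pos : 0 < stretch_mnm 2 h (Ordinal cn).
  by rewrite mnmE (bigD1 (Ordinal qh)) //= eqxx.
have place : stretch 2 g (size g).-1 <= stretch 2 h q \/
    exists2 p, p < size g & stretch 2 g p <= stretch 2 h q < stretch 2 g p + 2.
  have := leq_trans pos (mnm_lepP le (Ordinal cn)); rewrite mnmDE addn_gt0 => /orP [].
    move/stretch_supp => [p pg /= ->]; right; exists p => //.
    by rewrite leqnn addn2 ltnS leqnSn.
  move=> w0; have : Ordinal cn \notin colon_vars 2 g.
    by apply: contraTN w0 => /wV ->.
  rewrite inE negb_and /= -leqNgt => /orP [|/allPn [p]]; first by left.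
  rewrite mem_iota negbK => /= pg blk; right; exists p => //; move: pg; clear; lia.
have qg : q <= (size g).-1 by move: qh hg; clear; lia.
case: place => [big|[p pg /andP [lo hi]]].
  by have := low_gap vg qg; move: big; rewrite /stretch /low; clear; lia.
have [qp|pq] := leqP q p.
  by have := low_gap vg qp; move: lo; rewrite /stretch /low; clear; lia.
case: q IH qh cn pos qg lo hi pq => // q IH qh cn pos qg lo hi pq.
have := IH q (ltnSn q); have := low_gap vh (leqnSn q).
have := low_gap vg (pq : p <= q); move: hi; rewrite /stretch /low; clear; lia.
Qed.

Lemma card_below k : k <= n -> #|[set v : 'I_n | v < k]| = k.
Proof.
move=> kn; rewrite -[RHS](size_iota 0) -(count_predT (iota _ _)) -(card_ord_count xpredT kn).
by [].
Qed.

Lemma card_colon_vars0 g : min_gen g -> #|colon_vars 0 g| = idx g (size g).-1.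
Proof.
move=> gg; have /andP [g0 gs] := min_gen_size UI gg.
have lt : idx g (size g).-1 < m by rewrite (idx_lt _ (min_gen_valid gg)) prednK.
rewrite -[RHS]card_below; last first.
  by apply: ltnW; apply: ltn_trans lt _; apply: leq_ltn_trans mrn; apply: leq_addr.
apply: eq_card => v; rewrite !inE /stretch mul0n addn0; case: ltnP => //= _.
by apply/allP => q _; rewrite addn0 ltnNge andbN.
Qed.

(** The blocks left out make up exactly for the stretching of the last letter: each
    of the letters before it moves it up by two and removes two variables. *)
Lemma card_colon_vars2 g : min_gen g -> #|colon_vars 2 g| = idx g (size g).-1.
Proof.
move=> gg; have /andP [g0 gs] := min_gen_size UI gg; have vg := min_gen_valid gg.
set k := (size g).-1.
have cn : low g k < n by apply: (stretch_lt (leqnn 2) gg); rewrite /k prednK.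
have rkE := rank_lower vg (ltnW cn).
have e1 : #|[set v : 'I_n | v < low g k]| = low g k := card_below (ltnW cn).
have := cardsID (pair_facet g) [set v : 'I_n | v < low g k].
rewrite e1 (_ : _ :&: _ = [set x in pair_facet g | x < low g k]) ?rkE; last first.
  by apply/setP => v; rewrite !inE andbC.
rewrite (_ : _ :\: _ = colon_vars 2 g); first by rewrite /low; clear; lia.
apply/setP => v; rewrite !inE -/k -[stretch 2 g k]/(low g k) andbC.
have [lt|_] //= := ltnP v (low g k); apply/negP/allP => [nF q|H /in_pairsP [q vq]].
  rewrite mem_iota => /= qk; apply/negP => /andP [lo hi]; apply: nF; apply/in_pairsP; exists q.
  by move: lo hi; rewrite /stretch /low; clear; lia.
have qk : q < k.
  rewrite ltnNge; apply/negP => kq; have := low_gap vg kq; move: vq lt; clear; lia.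
have := H q; rewrite mem_iota qk => /(_ isT) /negP; apply.
by move: vq; rewrite /stretch /low; clear; lia.
Qed.

(** A minimal generator extends a word of [Uw] by one letter, so there are
    finitely many. *)
Definition min_gens : seq (seq nat) :=
  undup [seq g <- [seq rcons s x | s <- Uw, x <- iota 0 m] | min_gen g].

Lemma mem_min_gens g : (g \in min_gens) = min_gen g.
Proof.
rewrite mem_undup mem_filter; case gg: (min_gen g) => //=.
have /andP [g0 _] := min_gen_size UI gg; case/and3P: gg => vg _ tU.
apply/allpairsP; case: (lastP g) g0 vg tU => // s x _ vg tU.
exists (s, x); rewrite size_rcons /= -cats1 take_size_cat // in tU *; split=> //.
by case/andP: vg => _; rewrite all_rcons => /andP [xm _]; rewrite mem_iota.
Qed.

Definition sorted_min_gens := sort (fun g h => genkey g <= genkey h) min_gens.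

Definition gen_list e := [seq (stretch_mnm e g, colon_vars e g) | g <- sorted_min_gens].

Lemma sorted_min_gens_split G1 g G2 : sorted_min_gens = G1 ++ g :: G2 ->
  [/\ min_gen g, forall h, h \in G1 -> [/\ min_gen h, h != g & genkey h <= genkey g]
    & forall h, min_gen h -> genkey h < genkey g -> h \in G1].
Proof.
move=> GE.
have memG h : (h \in sorted_min_gens) = min_gen h by rewrite mem_sort mem_min_gens.
have un : uniq (G1 ++ g :: G2) by rewrite -GE sort_uniq undup_uniq.
have : sorted (fun g h => genkey g <= genkey h) sorted_min_gens.
  by apply: sort_sorted => x y; exact: leq_total.
rewrite sorted_pairwise; last by move=> y x z; apply: leq_trans.
rewrite GE pairwise_cat /= => /and3P [/allrelP H1 _ /andP [/allP H2 _]].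
split=> [|h hG|h gh lt]; first by rewrite -memG GE mem_cat mem_head orbT.
  split; first by rewrite -memG GE mem_cat hG.
    apply: contraTneq un => hg; rewrite cat_uniq negb_and; apply/orP; right.
    by rewrite negb_and; apply/orP; left; rewrite negbK; apply/hasP; exists g; rewrite ?mem_head // -hg.
  by apply: H1 => //; rewrite mem_head.
move: gh; rewrite -memG GE mem_cat inE => /or3P [//|/eqP hg|/H2].
  by rewrite hg ltnn in lt.
by rewrite leqNgt lt.
Qed.

(** The colon variables belong to the colon ideal by [colon_lower].  Conversely,
    if an earlier generator divides [g + w] and [w] avoids these variables, then
    the hypothesis and [genkey_eq] identify it with [g]. *)
Lemma gen_list_linear_quotients e : e <= 2 ->
  (forall g h (w : 'X_{1..n}), min_gen g -> min_gen h -> genkey h <= genkey g ->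
    (forall v, v \in colon_vars e g -> w v = 0) -> (stretch_mnm e h <= stretch_mnm e g + w)%MM ->
    forall q, idx g q <= idx h q) ->
  linear_quotients (gen_list e).
Proof.
move=> e2 upper L1 x L2 LE.
pose k := size L1.
have sL : k < size sorted_min_gens.
  by rewrite -(size_map (fun g => (stretch_mnm e g, colon_vars e g))) -/(gen_list e) LE size_cat /= -addn1 leq_add2l.
pose g := nth [::] sorted_min_gens k.
have GE : sorted_min_gens = take k sorted_min_gens ++ g :: drop k.+1 sorted_min_gens.
  by rewrite -drop_nth // cat_take_drop.
have L1E : L1 = [seq (stretch_mnm e g, colon_vars e g) | g <- take k sorted_min_gens].
  by rewrite map_take -/(gen_list e) LE take_size_cat.
have xE : x = (stretch_mnm e g, colon_vars e g).
  have := nth_map [::] x (fun g => (stretch_mnm e g, colon_vars e g)) sL.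
  by rewrite -/(gen_list e) LE nth_cat ltnn subnn /= => ->.
have [gg before after] := sorted_min_gens_split GE.
rewrite xE /=; split=> [|h|w].
- by rewrite mdeg_stretch //; case/andP: (min_gen_size UI gg).
- rewrite L1E => /mapP [h' /before [gh _ key] ->] /=.
  by rewrite !mdeg_stretch //; apply: genkey_size.
rewrite /divided_by L1E has_map; apply/hasP/existsP => [[h /before [gh ne key] /= le]|].
  apply/existsP; apply: contraT => /existsPn H; case/negP: ne; apply/eqP.
  apply: genkey_eq => //; apply: (upper g h w) => // v vV.
  by have := H v; rewrite vV /= lt0n negbK => /eqP.
case=> v /andP [vV wv]; have [g' [gg' key le]] := colon_lower gg vV.
exists g'; first exact: after.
apply: lepm_trans le _; apply/mnm_lepP => i; rewrite !mnmDE leq_add2l mnm1E.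
by case: eqP => [<-|].
Qed.

Lemma gen_list0_lq : linear_quotients (gen_list 0).
Proof. by apply: gen_list_linear_quotients => // g h w; exact: colon_upper0. Qed.

Lemma gen_list2_lq : linear_quotients (gen_list 2).
Proof. by apply: gen_list_linear_quotients => // g h w; exact: colon_upper2. Qed.

Lemma mem_gen_list e x : x \in gen_list e ->
  exists2 g, min_gen g & x = (stretch_mnm e g, colon_vars e g).
Proof. by case/mapP => g; rewrite mem_sort mem_min_gens => gg ->; exists g. Qed.

(** Both lists of generators have linear quotients with the same degrees and
    the same numbers of colon variables. *)
Theorem koszul_betti_stretch (K : fieldType) i k :
  koszul_betti K (divided_by (gen_list 2)) i k = koszul_betti K (divided_by (gen_list 0)) i k.
Proof.
rewrite !linear_quotients_koszul_betti; [|exact: gen_list0_lq|exact: gen_list2_lq].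
congr (_ + _); rewrite !big_map !big_seq; apply: eq_bigr => g.
by rewrite mem_sort mem_min_gens => gg; rewrite !mdeg_stretch // card_colon_vars0 // card_colon_vars2.
Qed.

(** Each generator has fewer than [m] colon variables. *)
Lemma koszul_betti_proj_dim (K : fieldType) i k : m < i ->
  koszul_betti K (divided_by (gen_list 0)) i k = 0.
Proof.
case: i => // i mi; rewrite linear_quotients_koszul_betti /=; last exact: gen_list0_lq.
rewrite add0n big_map big_seq big1 // => g; rewrite mem_sort mem_min_gens => gg.
rewrite card_colon_vars0 // bin_small ?muln0 //; have /andP [g0 _] := min_gen_size UI gg.
have lt : idx g (size g).-1 < m by rewrite (idx_lt _ (min_gen_valid gg)) prednK.
exact: leq_trans lt mi.
Qed.

Lemma hdim_regularity (K : fieldType) a i :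
  hdim (fun S : {set 'I_n} => #|S|) (@simplex_d K n) (koszul_fam (divided_by (gen_list 2)) a) i != 0 ->
  mdeg a <= i + r.
Proof.
move/(linear_quotients_vanish (d := r.+1) (ltn0Sn r) gen_list2_lq).
rewrite addnS ltnS; apply => g /mem_gen_list [h gh ->].
by rewrite mdeg_stretch //; case/andP: (min_gen_size UI gh).
Qed.

Definition msupp_set (w : 'X_{1..n}) : {set 'I_n} := [set v | 0 < w v].

Lemma divided_by_stretch w : divided_by (gen_list 2) w = ~~ in_ball (msupp_set w).
Proof.
apply/hasP/idP => [[x /mem_gen_list [g gg ->] /= le]|].
  apply: (min_gen_nonface UI mrn gg); apply/subsetP => v /low_partP [q qs vE].
  rewrite inE; apply: leq_trans (mnm_lepP le v).
  by rewrite mnmE (bigD1 (Ordinal qs)) //= vE /stretch eqxx.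
case/(nonface_min_gen UI) => g gg RH; exists (stretch_mnm 2 g, colon_vars 2 g).
  by apply: (map_f (fun g => (stretch_mnm 2 g, colon_vars 2 g))); rewrite mem_sort mem_min_gens.
apply/mnm_lepP => v /=; have vg := min_gen_valid gg.
have [z|/stretch_supp [q qs vE]] := posnP (stretch_mnm 2 g v); first by rewrite z.
have vR : v \in low_part g by apply/low_partP; exists q.
apply: (@leq_trans 1); last by have := subsetP RH v vR; rewrite inE.
rewrite mnmE (bigD1 (Ordinal qs)) //= big1 ?addn0 ?leq_b1 // => p ne.
apply/eqP; rewrite eqb0; apply: contraNneq ne => e; apply/eqP/val_inj => /=.
by apply: (low_inj vg); rewrite -[LHS]/(stretch 2 g p) e vE.
Qed.

End Generators.

(** * Orientation of the facets *)

Local Open Scope ring_scope.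

Section Orientation.
Variables (m r n : nat).
Hypothesis mrn : (m + 2 * r < n)%N.
Local Notation pair_facet := (@pair_facet m n).
Local Notation low_part := (@low_part m n).
Variable Uw : seq (seq nat).
Hypothesis UI : facet_ideal m r Uw.
Local Notation in_ball := (@in_ball m n Uw).
Local Notation in_int := (@in_int m n Uw).
Variable K : fieldType.
Implicit Types (H Q W V : {set 'I_n}).

Definition is_facet H : bool := has (fun s => pair_facet s == H) Uw.

Lemma is_facetP H : reflect (exists2 s, s \in Uw & H = pair_facet s) (is_facet H).
Proof. by apply: (iffP hasP) => -[s sU e]; exists s => //; apply/eqP; rewrite // eq_sym. Qed.

Lemma facet_in_ball H : is_facet H -> in_ball H.
Proof. by case/is_facetP => s sU ->; apply/in_ballP; exists s. Qed.

Lemma facet_setU1 Q s : s \in Uw -> #|Q| = (n - m).-1 -> Q \subset pair_facet s ->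
  exists2 v, v \notin Q & v |: Q = pair_facet s.
Proof.
move=> sU cQ QF; have cF := card_pair_facet mrn (fi_valid UI sU) (fi_size UI sU).
have [v vF vQ] : exists2 v, v \in pair_facet s & v \notin Q.
  apply/subsetPn; apply/negP => FQ; have := subset_leq_card FQ.
  by rewrite cQ cF; move: mrn; clear; lia.
exists v => //; apply/eqP; rewrite eqEcard subUset sub1set vF QF /=.
by rewrite cardsU1 vQ cQ cF; move: mrn; clear; lia.
Qed.

(** The sum of all facets is a cycle modulo the boundary of the ball: the facets,
    oriented by the order of their vertices, are coherently oriented.  If some
    facet is of the form [v |: Q], then [Q] is an interior ridge, contained in
    exactly two facets, whose signs are opposite by [ridge_parity]. *)
Lemma facets_through_ridge Q H : H \subset Q -> in_int H ->
  \sum_(v | (v \notin Q) && is_facet (v |: Q))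
    (-1) ^+ #|[set x in Q | (x < v)%N]| = 0 :> K.
Proof.
move=> HQ HI.
have [v1 /andP [v1Q /is_facetP [s sU sE]]|none] :=
    pickP (fun v => (v \notin Q) && is_facet (v |: Q)); last first.
  by rewrite big_pred0.
have cQ : #|Q| = (n - m).-1.
  have := card_pair_facet mrn (fi_valid UI sU) (fi_size UI sU).
  by rewrite -sE cardsU1 v1Q => <-.
have QF : Q \subset pair_facet s by rewrite -sE subsetUr.
have QI : in_int Q.
  by apply: (in_int_up UI mrn HQ HI); apply/in_ballP; exists s.
have [t tU [QFt ts]] : exists2 t, t \in Uw & Q \subset pair_facet t /\ t != s.
  have [/hasP [t tU /andP [? ?]]|/hasPn H0] :=
      boolP (has (fun t => (Q \subset pair_facet t) && (t != s)) Uw); first by exists t.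
  suff : in_ball Q && ~~ in_int Q by rewrite QI andbF.
  apply/(sphereP UI mrn); exists Q, s; split=> // t tU QFt; apply/eqP.
  by have := H0 t tU; rewrite QFt /= negbK.
have [v2 v2Q tE] := facet_setU1 tU cQ QFt.
(* signs of two facets through [Q] differ, so there is no room for a third *)
have odd2 v w s1 s2 : s1 \in Uw -> s2 \in Uw -> v \notin Q -> w \notin Q -> v != w ->
    v |: Q = pair_facet s1 -> w |: Q = pair_facet s2 ->
    odd (#|[set x in Q | (x < v)%N]| + #|[set x in Q | (x < w)%N]|).
  move=> s1U s2U vQ wQ vw E1 E2.
  have /orP [lt|gt] : (v < w)%N || (w < v)%N by rewrite -neq_ltn.
    exact: (ridge_parity mrn (fi_valid UI s1U) (fi_valid UI s2U)
      (fi_size UI s1U) (fi_size UI s2U) vQ wQ lt E1 E2).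
  rewrite addnC.
  exact: (ridge_parity mrn (fi_valid UI s2U) (fi_valid UI s1U)
      (fi_size UI s2U) (fi_size UI s1U) wQ vQ gt E2 E1).
have v12 : v1 != v2.
  apply: contraNneq ts => e; apply/eqP; apply: (facet_inj mrn);
    rewrite ?(fi_valid UI) ?(fi_size UI) //.
  by rewrite -tE -e sE.
rewrite (bigD1 v1) /=; last by rewrite v1Q; apply/is_facetP; exists s.
rewrite (bigD1 v2) /=; last first.
  by rewrite v2Q eq_sym v12 andbT; apply/is_facetP; exists t.
rewrite big_pred0 ?addr0; last first.
  move=> v3; apply/negbTE/negP => /andP [/andP [/andP [v3Q /is_facetP [t3 t3U E3]] v31] v32].
  have := odd2 _ _ _ _ sU tU v1Q v2Q v12 sE tE.
  have := odd2 _ _ _ _ t3U sU v3Q v1Q v31 E3 sE.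
  have := odd2 _ _ _ _ t3U tU v3Q v2Q v32 E3 tE.
  by rewrite !oddD; do 3!case: (odd _).
have := odd2 _ _ _ _ sU tU v1Q v2Q v12 sE tE; rewrite oddD.
rewrite -signr_odd -[X in _ + X]signr_odd.
by case: (odd _); case: (odd _) => // _; rewrite expr0 expr1 ?subrr // addrC subrr.
Qed.

Lemma ord_split_count Q (v : 'I_n) :
  (v = #|[set x in Q | (x < v)%N]| + #|[set x in ~: Q | (x < v)%N]| :> nat)%N.
Proof.
have : #|[set x : 'I_n | (x < v)%N]| = v.
  rewrite -[RHS](size_iota 0) -(count_predT (iota _ _)).
  by rewrite -(card_ord_count xpredT (ltnW (ltn_ord v))).
move=> e; apply: etrans (esym e) _; rewrite -[LHS](cardsID Q).
congr (_ + _)%N; apply: eq_card => x.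
  by rewrite !inE andbC.
by rewrite !inE andbC.
Qed.

Section PairingSign.

(** The exponent of the sign of the pairing.  It is chosen so that deleting an
    element [v] from either of the two sets paired changes the sign by the sign
    of the boundary, up to the incidence sign of [v] in the facet that [v]
    completes; this is the content of the next lemmas. *)
Definition crossings (T q : {set 'I_n}) : nat :=
  (\sum_(x in q) x + \sum_(x in T) #|[set y in q | (y <= x)%N]|)%N.

Definition pair_sgn (T T' : {set 'I_n}) : K := (-1) ^+ crossings T (T :|: T').

Lemma card_ge_split (T : {set 'I_n}) (v : 'I_n) :
  (#|[set x in T | (v <= x)%N]| + #|[set x in T | (x < v)%N]| = #|T|)%N.
Proof.
rewrite -(cardsID [set x : 'I_n | (v <= x)%N] T); congr (_ + _)%N; apply: eq_card => x.
  by rewrite !inE.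
by rewrite !inE -ltnNge andbC.
Qed.

Lemma crossings_remove (T q : {set 'I_n}) v : v \in q ->
  (crossings T q = v + #|[set x in T | (v <= x)%N]| +
     (\sum_(x in q :\ v) x + \sum_(x in T) #|[set y in q :\ v | (y <= x)%N]|))%N.
Proof.
move=> vq; rewrite /crossings (big_setD1 v) //=.
have -> : (\sum_(x in T) #|[set y in q | (y <= x)%N]| =
    #|[set x in T | (v <= x)%N]| + \sum_(x in T) #|[set y in q :\ v | (y <= x)%N]|)%N.
  have -> : #|[set x in T | (v <= x)%N]| = (\sum_(x in T) (v <= x))%N.
    rewrite -sum1_card [LHS]big_mkcond [RHS]big_mkcond; apply: eq_bigr => x _.
    by rewrite inE; case: (x \in T) => //=; case: (v <= x)%N.
  rewrite -big_split /=; apply: eq_bigr => x _.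
  rewrite (cardsD1 v) !inE vq /=; congr (_ + _)%N.
  by apply: eq_card => y; rewrite !inE andbA.
by rewrite addnACA addnA.
Qed.

Lemma pair_sgn_left (T T' : {set 'I_n}) v : [disjoint T & T'] -> v \in T ->
  face_sgn K T v * pair_sgn (T :\ v) T' =
  pair_sgn T T' * (-1) ^+ #|T| * (-1) ^+ #|[set x in ~: (T :|: T') | (x < v)%N]|.
Proof.
move=> dis vT; set q := T :|: T'; have vq : v \in q by rewrite inE vT.
have qE : (T :\ v) :|: T' = q :\ v.
  apply/setP => x; rewrite !inE; case: eqP => //= ->.
  by rewrite (disjointFr dis vT).
rewrite /pair_sgn -/q qE /face_sgn -!exprD -signr_odd -[RHS]signr_odd; congr (_ ^+ _).
congr nat_of_bool.
have e1 := crossings_remove T vq.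
have e2 : (\sum_(x in T) #|[set y in q :\ v | (y <= x)%N]| =
    #|[set y in q | (y < v)%N]| + \sum_(x in T :\ v) #|[set y in q :\ v | (y <= x)%N]|)%N.
  rewrite (big_setD1 v) //=; congr (_ + _)%N; apply: eq_card => y; rewrite !inE.
  by rewrite leq_eqVlt -(inj_eq val_inj) /=; case: ltngtP; rewrite ?andbF ?andbT.
have e3 := card_ge_split T v; have e4 := ord_split_count q v.
rewrite e1 {e1} e2 /crossings.
move: e3 e4; set a := #|[set x in T | (v <= x)%N]|; set b := #|[set x in T | (x < v)%N]|.
set c := #|[set x in q | _]|; set d := #|[set x in ~: q | _]|.
set S1 := \sum_(_ in _) _; set S2 := \sum_(_ in _) _.
by move=> e3 e4; rewrite -e3 {1}e4 !oddD; do 6!case: (odd _).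
Qed.

Lemma pair_sgn_right (T T' : {set 'I_n}) v : [disjoint T & T'] -> v \in T' ->
  pair_sgn T (T' :\ v) * face_sgn K T' v =
  pair_sgn T T' * (-1) ^+ #|T| * (-1) ^+ #|[set x in ~: (T :|: T') | (x < v)%N]|.
Proof.
move=> dis vT; set q := T :|: T'; have vq : v \in q by rewrite inE vT orbT.
have vnT : v \in T = false by rewrite (disjointFl dis vT).
have qE : T :|: (T' :\ v) = q :\ v.
  by apply/setP => x; rewrite !inE; case: eqP => //= ->; rewrite vnT.
rewrite /pair_sgn -/q qE /face_sgn -!exprD -signr_odd -[RHS]signr_odd; congr (_ ^+ _).
congr nat_of_bool.
have e1 := crossings_remove T vq.
have e3 := card_ge_split T v; have e4 := ord_split_count q v.
have e5 : #|[set y in q | (y < v)%N]| =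
    (#|[set x in T | (x < v)%N]| + #|[set x in T' | (x < v)%N]|)%N.
  rewrite -cardsUI [X in (_ + #|pred_of_set X|)%N](_ : _ = set0) ?cards0 ?addn0.
    by apply: eq_card => y; rewrite !inE andb_orl.
  apply/setP => y; rewrite !inE; case yT: (y \in T) => //=.
  by rewrite (disjointFr dis yT) /= andbF.
rewrite e1 {e1} /crossings; rewrite e5 in e4.
move: e3 e4; set a := #|[set x in T | (v <= x)%N]|; set b := #|[set x in T | (x < v)%N]|.
set c := #|[set x in T' | _]|; set d := #|[set x in ~: q | _]|.
set S1 := (\sum_(_ in _) _)%N; set S2 := (\sum_(_ in _) _)%N.
by move=> e3 e4; rewrite -e3 {1}e4 !oddD; do 6!case: (odd _).
Qed.

End PairingSign.
End Orientation.

(** * Duality between the ball and its interior *)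

Section Duality.
Variables (m r n : nat).
Hypothesis mrn : (m + 2 * r < n)%N.
Local Notation pair_facet := (@pair_facet m n).
Local Notation low_part := (@low_part m n).
Local Notation idx := (idx m).
Variable Uw : seq (seq nat).
Hypothesis UI : facet_ideal m r Uw.
Local Notation in_ball := (@in_ball m n Uw).
Local Notation in_int := (@in_int m n Uw).
Local Notation is_facet := (@is_facet m n Uw).
Local Notation idx_sum := (idx_sum m r).
Variable K : fieldType.
Local Notation cd := (fun S : {set _} => #|S|).
Local Notation simplex_d := (@simplex_d K n).
Local Notation pair_sgn := (@pair_sgn n K).
Implicit Types (H Q T : {set 'I_n}) (s t : seq nat).

(** The homology of this family is the part of squarefree multidegree [W] of the
    Tor of R/I_B; the next family plays this role for I_S/I_B. *)
Definition ball_fam (W : {set 'I_n}) : {set {set 'I_n}} :=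
  [set T : {set 'I_n} | (T \subset W) && in_ball (W :\: T)].
Definition int_fam (W : {set 'I_n}) : {set {set 'I_n}} :=
  [set T : {set 'I_n} | (T \subset W) && in_int (W :\: T)].

Lemma ball_fam_convex W : convex (ball_fam W).
Proof.
move=> R S T; rewrite !inE => /andP [_ RB] /andP [TW _] RS ST.
rewrite (subset_trans ST TW); apply: in_ball_sub RB; exact: setDS.
Qed.

Lemma int_fam_convex W : convex (int_fam W).
Proof.
move=> R S T; rewrite !inE => /andP [_ RB] /andP [TW TI] RS ST.
rewrite (subset_trans ST TW) /=; apply: (in_int_up UI mrn _ TI); first exact: setDS.
by apply: in_ball_sub (in_int_ball RB); exact: setDS.
Qed.

Lemma idx_sum_lt s t : s \in Uw -> t \in Uw -> (forall q, idx t q <= idx s q)%N ->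
  t != s -> (idx_sum t < idx_sum s)%N.
Proof.
move=> sU tU le ts; rewrite ltnNge; apply: contra ts => ge; apply/eqP.
apply: valid_eq (fi_valid UI tU) (fi_valid UI sU) _ => q.
have [qr|rq] := ltnP q r; last first.
  by rewrite !idx_default // (leq_trans (fi_size UI _) rq).
apply/eqP; rewrite eqn_leq le /= leqNgt; apply/negP => lt.
move: ge; rewrite leqNgt /idx_sum => /negP; apply.
rewrite (bigD1 (Ordinal qr)) //= [X in (_ < X)%N](bigD1 (Ordinal qr)) //=.
by rewrite -addSn; apply: leq_add => //; apply: leq_sum => i _; exact: le.
Qed.

Definition in_block s H : bool := (low_part s \subset H) && (H \subset pair_facet s).
Definition in_coblock s H : bool :=
  (pair_facet s :\: low_part s \subset H) && (H \subset pair_facet s).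

Lemma lower_le s t H : s \in Uw -> t \in Uw -> low_part s \subset H -> H \subset pair_facet t ->
  forall q, (idx t q <= idx s q)%N.
Proof.
move=> sU tU RH HF; apply: (facet_order_lower mrn); rewrite ?(fi_valid UI) //.
  by apply: leqW; apply: (fi_size UI).
exact: subset_trans RH HF.
Qed.

Lemma upper_le s t H : s \in Uw -> t \in Uw -> pair_facet s :\: low_part s \subset H ->
  H \subset pair_facet t -> forall q, (idx s q <= idx t q)%N.
Proof. by move=> sU tU RH HF; exact: (upper_part_le UI mrn tU sU RH HF). Qed.

Lemma idx_anti s t : s \in Uw -> t \in Uw -> (forall q, idx t q <= idx s q)%N ->
  (forall q, idx s q <= idx t q)%N -> s = t.
Proof.
move=> sU tU l1 l2; apply: valid_eq (fi_valid UI sU) (fi_valid UI tU) _ => q.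
by apply/eqP; rewrite eqn_leq l1 l2.
Qed.

Lemma subset_implb (A B : {set 'I_n}) x : A \subset B -> (x \in A) ==> (x \in B).
Proof. by move/subsetP => AB; apply/implyP; exact: AB. Qed.

Section Cone.
Variable W : {set 'I_n}.
Local Notation V := (~: W).
Local Notation X := ({set 'I_n} + {set 'I_n})%type.

(** The pairing of [T] and [S] is nonzero if the ball face [W :\: T] and the
    interior face [~: W :\: S] have a facet as their union. *)
Definition cone_pair (T S : {set 'I_n}) : K :=
  ([&& T \subset W, S \subset V & is_facet (~: (T :|: S))])%:R * pair_sgn T S.

(** In the mapping cone the interior side is dualized, hence its decreasing
    degrees.  The shift by [n.+1] makes the pairing lower the degree by one,
    because the complement of a facet has [m] elements. *)
Definition cone_deg (x : X) : nat :=
  match x with inl T => #|T| + n.+1 | inr Q => m + n - #|Q| end.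

Definition cone_d (x y : X) : K :=
  match x, y with
  | inl T, inl Q => simplex_d T Q
  | inl T, inr Q => cone_pair T Q
  | inr Q, inr T => simplex_d T Q
  | inr _, inl _ => 0
  end.

Lemma disjoint_WV (T S : {set 'I_n}) : T \subset W -> S \subset V -> [disjoint T & S].
Proof.
move=> TW SV; rewrite -setI_eq0; apply/eqP/setP => x; rewrite !inE.
apply/negbTE/negP => /andP [xT xS]; move: (subsetP SV x xS); rewrite inE.
by rewrite (subsetP TW).
Qed.

Lemma cone_deg_d x y : cone_d x y != 0 -> cone_deg x = (cone_deg y).+1.
Proof.
case: x y => [T|S] [T'|S'] /=; rewrite ?eqxx //.
- by move=> /simplex_d_deg ->; rewrite addSn.
- rewrite /cone_pair; case: and3P => [[TW SV /is_facetP [s sU sE]] _|_]; last by rewrite mul0r eqxx.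
  have := card_pair_facet mrn (fi_valid UI sU) (fi_size UI sU); rewrite -sE cardsCs setCK.
  rewrite cardsU (disjoint_setI0 (disjoint_WV TW SV)) cards0 subn0 card_ord.
  have := max_card (mem S'); have := max_card (mem T); rewrite card_ord.
  move: mrn; set a := #|T|; set b := #|S'|; clear; lia.
- move=> /simplex_d_deg e; have le : (#|S'| <= n)%N.
    by rewrite -[leqRHS](card_ord n); exact: max_card.
  by rewrite e in le *; rewrite subnSK // (leq_trans le (leq_addl _ _)).
Qed.

Definition cone_fam : {set X} :=
  (inr @: int_fam V : {set X}) :|: (inl @: ball_fam W).

Lemma cone_famE x : (x \in cone_fam) =
  match x with inl T => T \in ball_fam W | inr Q => Q \in int_fam V end.
Proof.
rewrite /cone_fam inE; case: x => [T|S].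
  rewrite (mem_imset _ _ inl_inj) orbC; case: (_ \in _) => //=.
  by apply/imsetP => -[].
rewrite (mem_imset _ _ inr_inj); case: (_ \in _) => //=.
by apply/imsetP => -[].
Qed.

Lemma sum_cone (F : X -> K) : \sum_(y in cone_fam) F y =
  \sum_(T in ball_fam W) F (inl T) + \sum_(S in int_fam V) F (inr S).
Proof.
rewrite big_mkcond big_sumType /= -!big_mkcond /=; congr (_ + _).
  by apply: eq_bigl => T; rewrite cone_famE.
by apply: eq_bigl => T; rewrite cone_famE.
Qed.

(** The pairing is a chain map.  Deletions from [T] and from [S] together run
    over the vertices that complete the ridge [~: (T :|: S)] to a facet, and the
    sum over these vanishes as this ridge contains an interior face. *)
Lemma cone_pair_sum (T S : {set 'I_n}) : T \in ball_fam W -> S \in int_fam V ->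
  \sum_(T' in ball_fam W) simplex_d T T' * cone_pair T' S +
  \sum_(S' in int_fam V) cone_pair T S' * simplex_d S S' = 0.
Proof.
rewrite !inE => /andP [TW TB] /andP [SV SI].
set q := T :|: S; pose Q := ~: q.
have dis := disjoint_WV TW SV.
have HQ : V :\: S \subset Q.
  apply/subsetP => x; rewrite !inE => /andP [xS xW]; rewrite negb_or xS andbT.
  by apply: contra xW; exact: (subsetP TW).
have facet_of v : v \in q -> ~: (q :\ v) = v |: Q.
  move=> vq; apply/setP => x; rewrite !inE; case: eqP => [->|] //=.
have -> : \sum_(T' in ball_fam W) simplex_d T T' * cone_pair T' S =
          \sum_T' simplex_d T T' * cone_pair T' S.
  rewrite big_mkcond; apply: eq_bigr => T' _; case: ifP => // nB.
  rewrite /cone_pair; case: and3P => [[T'W _ F]|]; last by rewrite mul0r mulr0.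
  case/negP: nB; rewrite inE T'W /=; apply: in_ball_sub (facet_in_ball F).
  apply/subsetP => x; rewrite !inE => /andP [xT xW]; rewrite negb_or xT /=.
  by apply: contraTN xW => /(subsetP SV); rewrite inE.
have -> : \sum_(S' in int_fam V) cone_pair T S' * simplex_d S S' =
          \sum_S' simplex_d S S' * cone_pair T S'.
  rewrite big_mkcond; apply: eq_bigr => S' _; rewrite mulrC; case: ifP => // nB.
  have [->|/simplex_d_neq0 [v vS S'E]] := eqVneq (simplex_d S S') 0; first by rewrite mul0r.
  rewrite /cone_pair; case: and3P => [[_ S'V F]|]; last by rewrite mul0r mulr0.
  case/negP: nB; rewrite inE S'V /=.
  apply: (in_int_up UI mrn _ SI); first by rewrite S'E setDS // subsetDl.
  apply: in_ball_sub (facet_in_ball F); apply/subsetP => x; rewrite !inE => /andP [xS xW].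
  by rewrite negb_or xS andbT; apply: contra xW; exact: (subsetP TW).
rewrite !sum_simplex_d.
pose c := pair_sgn T S * (-1) ^+ #|T|.
pose term v : K := c * ((is_facet (v |: Q))%:R * (-1) ^+ #|[set x in Q | (x < v)%N]|).
rewrite (eq_bigr term) => [|v vT]; last first.
  have vq : v \in q by rewrite inE vT.
  rewrite /cone_pair (subset_trans (subsetDl _ _) TW) SV /=.
  have -> : (T :\ v) :|: S = q :\ v.
    apply/setP => x; rewrite !inE; case: eqP => //= ->.
    by rewrite (disjointFr dis vT).
  by rewrite facet_of // mulrCA pair_sgn_left // /term /c -/q -/Q mulrCA -!mulrA; ring.
rewrite [X in _ + X](eq_bigr term) => [|v vS]; last first.
  have vq : v \in q by rewrite inE vS orbT.
  rewrite /cone_pair TW (subset_trans (subsetDl _ _) SV) /=.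
  have -> : T :|: (S :\ v) = q :\ v.
    apply/setP => x; rewrite !inE; case: eqP => //= ->.
    by rewrite (disjointFl dis vS).
  by rewrite facet_of // mulrCA [face_sgn _ _ _ * _]mulrC pair_sgn_right // /term /c -/q -/Q; ring.
have -> : \sum_(v in T) term v + \sum_(v in S) term v = \sum_(v in q) term v.
  by rewrite -bigU //; apply: eq_bigl => v; rewrite !inE.
rewrite -mulr_sumr -[RHS](mulr0 c); congr (_ * _).
rewrite -[RHS](facets_through_ridge mrn UI K HQ SI) big_mkcond [RHS]big_mkcond.
apply: eq_bigr => v _; rewrite [v \in Q]inE negbK.
by case: (v \in q) => //=; case: is_facet; rewrite ?mul1r ?mul0r.
Qed.

Lemma cone_complex : is_complex cone_d cone_fam.
Proof.
move=> x z xA zA; rewrite sum_cone; rewrite !cone_famE in xA zA.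
case: x xA => [T|S] xA; case: z zA => [T'|S'] zA /=.
- rewrite [X in _ + X]big1 ?addr0 => [|S _]; last by rewrite mulr0.
  exact: (@convex_complex K n _ (@ball_fam_convex W) T T' xA zA).
- exact: cone_pair_sum.
- by rewrite !big1 ?addr0 // => ? _; rewrite ?mul0r ?mulr0.
- rewrite big1 ?add0r => [|T _]; last by rewrite mul0r.
  rewrite -[RHS](@convex_complex K n _ (@int_fam_convex V) S' S zA xA).
  by apply: eq_bigr => T _; rewrite mulrC.
Qed.

(** The word of the facet in whose interval the ball face, or the interior face,
    lies. *)
Definition cone_label (x : X) : seq nat :=
  match x with
  | inl T => nth [::] Uw (find (fun s => in_block s (W :\: T)) Uw)
  | inr Q => nth [::] Uw (find (fun s => in_coblock s (V :\: Q)) Uw)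
  end.

Definition labelled (x : X) s : bool :=
  (s \in Uw) &&
  match x with
  | inl T => in_block s (W :\: T)
  | inr Q => in_coblock s (V :\: Q)
  end.

Lemma cone_labelP x : x \in cone_fam -> labelled x (cone_label x).
Proof.
rewrite cone_famE; case: x => [T|S]; rewrite inE => /andP [_ HB] /=.
  have ex : has (fun s => in_block s (W :\: T)) Uw.
    have [s [sU RH HF]] := ball_partition UI mrn HB.
    by apply/hasP; exists s; rewrite // /in_block RH HF.
  by rewrite /labelled mem_nth -?has_find //= (nth_find _ ex).
have ex : has (fun s => in_coblock s (V :\: S)) Uw by exact: HB.
by rewrite /labelled mem_nth -?has_find //= (nth_find _ ex).
Qed.

Lemma label_unique x s t : labelled x s -> labelled x t -> s = t.
Proof.
case: x => [T|S] /andP [sU /andP [s1 s2]] /andP [tU /andP [t1 t2]].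
  apply: idx_anti => //; [exact: lower_le s1 t2 | exact: lower_le t1 s2].
apply: idx_anti => //; [exact: upper_le t1 s2 | exact: upper_le s1 t2].
Qed.

Lemma cone_label_eq x s : x \in cone_fam -> labelled x s -> cone_label x = s.
Proof. by move=> /cone_labelP h1 h2; exact: label_unique h1 h2. Qed.

(** A vertex which can be added to and deleted from the face without leaving its
    interval. *)
Definition flip (x : X) : option 'I_n :=
  match x with
  | inl _ => [pick v in (pair_facet (cone_label x) :\: low_part (cone_label x)) :&: W]
  | inr _ => [pick v in low_part (cone_label x) :&: V]
  end.

(** The matching toggles the vertex given by [flip].  If there is none, then the
    interval of the label meets the faces in [W], resp. outside of [W], in one
    face only.  Both happen together, exactly if [low_part] lies in [W] and the
    rest of the facet outside of it, and these two faces are paired, their union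
    being the facet. *)
Definition cone_mu (x : X) : X :=
  match x, flip x with
  | inl T, Some v => inl (toggle v T)
  | inl T, None => inr (V :\: (pair_facet (cone_label x) :\: low_part (cone_label x)))
  | inr Q, Some v => inr (toggle v Q)
  | inr Q, None => inl (W :\: low_part (cone_label x))
  end.

(** Lexicographic: first the label, then the position in its interval. *)
Definition cone_wt (x : X) : nat :=
  (idx_sum (cone_label x) * n.+1 +
   match x, flip x with
   | inl T, Some v => #|T :\ v|
   | inr Q, Some v => n - #|Q :\ v|
   | _, None => 0
   end)%N.

Definition pair_inl s : {set 'I_n} := W :\: low_part s.
Definition pair_inr s : {set 'I_n} := V :\: (pair_facet s :\: low_part s).

Lemma pair_label s : s \in Uw -> low_part s \subset W -> pair_facet s :\: low_part s \subset V ->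
  labelled (inl (pair_inl s)) s /\ labelled (inr (pair_inr s)) s.
Proof.
move=> sU RW FV; rewrite /labelled /in_block /in_coblock sU /pair_inl /pair_inr /=.
split; apply/andP; split; apply/subsetP => x; apply/implyP.
all: have := subset_implb x RW; have := subset_implb x FV.
all: have := subset_implb x (low_part_sub m n s).
all: rewrite !in_setD !in_setC.
all: by case: (x \in W); case: (x \in low_part s); case: (x \in pair_facet s).
Qed.

Lemma pair_in s : s \in Uw -> low_part s \subset W -> pair_facet s :\: low_part s \subset V ->
  inl (pair_inl s) \in cone_fam /\ inr (pair_inr s) \in cone_fam.
Proof.
move=> sU RW FV; have [/andP [_ /andP [_ h1]] /andP [_ /andP [h2 h3]]] := pair_label sU RW FV.
rewrite !cone_famE !inE !subsetDl /=; split; first by apply/in_ballP; exists s.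
by apply/in_intP; exists s.
Qed.

Lemma pair_cone_d s : s \in Uw -> low_part s \subset W -> pair_facet s :\: low_part s \subset V ->
  cone_d (inl (pair_inl s)) (inr (pair_inr s)) != 0.
Proof.
move=> sU RW FV; rewrite /= /cone_pair !subsetDl /= (_ : is_facet _).
  by rewrite mul1r signr_eq0.
apply/is_facetP; exists s => //; apply/setP => x.
have := subset_implb x RW; have := subset_implb x FV.
have := subset_implb x (low_part_sub m n s).
rewrite !(in_setC, in_setU, in_setD).
by case: (x \in W); case: (x \in low_part s); case: (x \in pair_facet s).
Qed.

Lemma inl_facts T s : inl T \in cone_fam -> labelled (inl T) s ->
  [/\ T \subset W, s \in Uw, low_part s \subset W :\: T & W :\: T \subset pair_facet s].
Proof.
by rewrite cone_famE inE => /andP [-> _] /andP [-> /andP [-> ->]].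
Qed.

Lemma inr_facts S s : inr S \in cone_fam -> labelled (inr S) s ->
  [/\ S \subset V, s \in Uw, pair_facet s :\: low_part s \subset V :\: S
    & V :\: S \subset pair_facet s].
Proof.
by rewrite cone_famE inE => /andP [-> _] /andP [-> /andP [-> ->]].
Qed.

Lemma inl_noflip T s : inl T \in cone_fam -> labelled (inl T) s -> flip (inl T) = None ->
  [/\ T = pair_inl s, low_part s \subset W & pair_facet s :\: low_part s \subset V].
Proof.
move=> TA ls; have [TW sU RT TF] := inl_facts TA ls.
rewrite /flip (cone_label_eq TA ls); case: pickP => // none _.
have RW : low_part s \subset W by apply: subset_trans RT _; exact: subsetDl.
have FV : pair_facet s :\: low_part s \subset V.
  by apply/subsetP => x xF; have := none x; rewrite in_setI xF in_setC => /= ->.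
split=> //; apply/setP => x.
have := subset_implb x TW; have := subset_implb x RT; have := subset_implb x TF.
have := subset_implb x FV; rewrite /pair_inl !in_setD !in_setC.
by case: (x \in T); case: (x \in W); case: (x \in low_part s); case: (x \in pair_facet s).
Qed.

Lemma inr_noflip S s : inr S \in cone_fam -> labelled (inr S) s -> flip (inr S) = None ->
  [/\ S = pair_inr s, low_part s \subset W & pair_facet s :\: low_part s \subset V].
Proof.
move=> SA ls; have [SV sU RS SF] := inr_facts SA ls.
rewrite /flip (cone_label_eq SA ls); case: pickP => // none _.
have FV : pair_facet s :\: low_part s \subset V by apply: subset_trans RS _; exact: subsetDl.
have RW : low_part s \subset W.
  apply/subsetP => x xR; have := none x; rewrite in_setI xR in_setC /=.
  by move/negbFE.
split=> //; apply/setP => x.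
have := subset_implb x SV; have := subset_implb x RS; have := subset_implb x SF.
have := subset_implb x RW; rewrite /pair_inr !in_setD !in_setC.
by case: (x \in S); case: (x \in W); case: (x \in low_part s); case: (x \in pair_facet s).
Qed.

Lemma pair_noflip s : s \in Uw -> low_part s \subset W -> pair_facet s :\: low_part s \subset V ->
  flip (inl (pair_inl s)) = None /\ flip (inr (pair_inr s)) = None.
Proof.
move=> sU RW FV; have [l1 l2] := pair_label sU RW FV; have [i1 i2] := pair_in sU RW FV.
rewrite /flip (cone_label_eq i1 l1) (cone_label_eq i2 l2).
split; case: pickP => // x; rewrite in_setI.
  by case/andP=> /(subsetP FV); rewrite in_setC => /negP.
by case/andP=> /(subsetP RW) xW; rewrite in_setC xW.
Qed.

Lemma inl_toggle T s v : inl T \in cone_fam -> labelled (inl T) s ->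
  v \in (pair_facet s :\: low_part s) :&: W ->
  inl (toggle v T) \in cone_fam /\ labelled (inl (toggle v T)) s.
Proof.
move=> TA ls; have [TW sU RT TF] := inl_facts TA ls.
rewrite in_setI in_setD => /andP [/andP [vR vF] vW].
have tW : toggle v T \subset W.
  apply/subsetP => x; rewrite in_toggle; case: eqP => [->|_]; rewrite ?addbF //.
  exact: (subsetP TW).
have h1 : low_part s \subset W :\: toggle v T.
  apply/subsetP => x xR; have := subsetP RT x xR; rewrite !in_setD in_toggle.
  case: (x =P v) => [e|_]; last by rewrite addbF.
  by rewrite e (negbTE vR) in xR.
have h2 : W :\: toggle v T \subset pair_facet s.
  apply/subsetP => x; rewrite in_setD in_toggle; case: (x =P v) => [-> //|_].
  by rewrite addbF => h; apply: (subsetP TF); rewrite in_setD.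
rewrite cone_famE inE tW /labelled sU /in_block h1 h2; split=> //.
by apply/in_ballP; exists s.
Qed.

Lemma inr_toggle S s v : inr S \in cone_fam -> labelled (inr S) s ->
  v \in low_part s :&: V ->
  inr (toggle v S) \in cone_fam /\ labelled (inr (toggle v S)) s.
Proof.
move=> SA ls; have [SV sU RS SF] := inr_facts SA ls.
rewrite in_setI => /andP [vR vV].
have tV : toggle v S \subset V.
  apply/subsetP => x; rewrite in_toggle; case: eqP => [->|_]; rewrite ?addbF //.
  exact: (subsetP SV).
have h1 : pair_facet s :\: low_part s \subset V :\: toggle v S.
  apply/subsetP => x xR; have := subsetP RS x xR; rewrite ![in X in X -> _]in_setD.
  rewrite [in X in _ -> X]in_setD in_toggle.
  case: (x =P v) => [e|_]; last by rewrite addbF.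
  by move: xR; rewrite e in_setD vR.
have h2 : V :\: toggle v S \subset pair_facet s.
  apply/subsetP => x; rewrite in_setD in_toggle; case: (x =P v) => [-> _|_].
    exact: (subsetP (low_part_sub m n s)).
  by rewrite addbF => h; apply: (subsetP SF); rewrite in_setD.
rewrite cone_famE inE tV /labelled sU /in_coblock h1 h2; split=> //.
by apply/in_intP; exists s.
Qed.

Lemma flip_inl T s v : inl T \in cone_fam -> labelled (inl T) s ->
  flip (inl T) = Some v -> v \in (pair_facet s :\: low_part s) :&: W.
Proof.
by move=> TA ls; rewrite /flip (cone_label_eq TA ls); case: pickP => // x xF [<-].
Qed.

Lemma flip_inr S s v : inr S \in cone_fam -> labelled (inr S) s ->
  flip (inr S) = Some v -> v \in low_part s :&: V.
Proof.
by move=> TA ls; rewrite /flip (cone_label_eq TA ls); case: pickP => // x xF [<-].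
Qed.

(** Along the arrows of the cone the indices of the labels do not increase.  For
    an arrow of the pairing, which goes through a facet [u], the label of the
    target is below [u] and [u] is below the label of the source. *)
Lemma cone_label_mono x y : x \in cone_fam -> y \in cone_fam -> cone_d x y != 0 ->
  forall q, (idx (cone_label y) q <= idx (cone_label x) q)%N.
Proof.
move=> xA yA; have := cone_labelP xA; have := cone_labelP yA.
set s := cone_label x; set t := cone_label y.
case: x y @s @t xA yA => [T|S] [T'|S'] s t xA yA lt ls //=; rewrite -/s -/t in lt ls *.
- have [_ sU RT TF] := inl_facts xA ls; have [_ tU RT' TF'] := inl_facts yA lt.
  case/simplex_d_neq0 => v _ T'E; apply: (lower_le sU tU (subset_trans RT _) TF').
  by rewrite T'E setDS // subsetDl.
- have [_ sU RT TF] := inl_facts xA ls; have [_ tU RT' TF'] := inr_facts yA lt.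
  rewrite /cone_pair; case: and3P => [[TW SV /is_facetP [u uU uE]] _|_]; last by rewrite mul0r eqxx.
  move=> q; apply: (@leq_trans (idx u q)).
    apply: (upper_le tU uU RT'); rewrite -uE; apply/subsetP => x.
    have := subset_implb x TW; rewrite !(in_setC, in_setU, in_setD).
    by case: (x \in W); case: (x \in T); case: (x \in S').
  apply: (lower_le sU uU RT); rewrite -uE; apply/subsetP => x.
  have := subset_implb x SV; rewrite !(in_setC, in_setU, in_setD).
  by case: (x \in W); case: (x \in T); case: (x \in S').
- by rewrite eqxx.
- have [_ sU RT TF] := inr_facts xA ls; have [_ tU RT' TF'] := inr_facts yA lt.
  case/simplex_d_neq0 => v _ SE; apply: (upper_le tU sU RT'); apply: subset_trans TF.
  by rewrite SE setDS // subsetDl.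
Qed.

Lemma cone_acyclic i : hdim cone_deg cone_d cone_fam i = 0%N.
Proof.
apply: (matching_acyclic cone_deg_d (mu := cone_mu) (w := cone_wt)); first exact: cone_complex.
- move=> x xA; have ls := cone_labelP xA; set s := cone_label x in ls.
  have sU : s \in Uw by case/andP: ls.
  case ef: (flip x) => [v|].
    case: x @s xA ls sU ef => [T|S] s xA ls sU ef.
      have vF := flip_inl xA ls ef; have [tA tl] := inl_toggle xA ls vF.
      have lE := cone_label_eq tA tl.
      have ef' : flip (inl (toggle v T)) = Some v by rewrite -ef /flip lE.
      rewrite /cone_mu ef ef' toggleK /cone_wt ef ef' lE toggleD1; split=> //=.
      exact: simplex_d_toggle.
    have vF := flip_inr xA ls ef; have [tA tl] := inr_toggle xA ls vF.
    have lE := cone_label_eq tA tl.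
    have ef' : flip (inr (toggle v S)) = Some v by rewrite -ef /flip lE.
    rewrite /cone_mu ef ef' toggleK /cone_wt ef ef' lE toggleD1; split=> //=.
    by rewrite orbC simplex_d_toggle.
  have [xE [RW FV]] : (x = inl (pair_inl s) \/ x = inr (pair_inr s)) /\
      (low_part s \subset W /\ pair_facet s :\: low_part s \subset V).
    case: x @s xA ls sU ef => [T|S] s xA ls sU ef.
      by have [-> ? ?] := inl_noflip xA ls ef; split=> //; left.
    by have [-> ? ?] := inr_noflip xA ls ef; split=> //; right.
  have [i1 i2] := pair_in sU RW FV; have [l1 l2] := pair_label sU RW FV.
  have [f1 f2] := pair_noflip sU RW FV; have dne := pair_cone_d sU RW FV.
  have e1 := cone_label_eq i1 l1; have e2 := cone_label_eq i2 l2.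
  have m1 : cone_mu (inl (pair_inl s)) = inr (pair_inr s) by rewrite /cone_mu f1 e1.
  have m2 : cone_mu (inr (pair_inr s)) = inl (pair_inl s) by rewrite /cone_mu f2 e2.
  have w12 : cone_wt (inl (pair_inl s)) = cone_wt (inr (pair_inr s)).
    by rewrite /cone_wt f1 f2 e1 e2.
  by case: xE => ->; rewrite ?m1 ?m2 ?m1; split; rewrite ?dne ?orbT.
- move=> x y xA yA dxy ymu.
  have le := cone_label_mono xA yA dxy.
  have lx := cone_labelP xA; have ly := cone_labelP yA.
  have sU : cone_label x \in Uw by case/andP: lx.
  have tU : cone_label y \in Uw by case/andP: ly.
  (* the position in an interval cannot outweigh a change of label *)
  have small z : ((match z, flip z with
     | inl T, Some v => #|T :\ v| | inr Q, Some v => n - #|Q :\ v|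
     | _, None => 0 end) <= n)%N.
    case: z => [T|S]; case: (flip _) => // v; last exact: leq_subr.
    by rewrite -[leqRHS](card_ord n); exact: max_card.
  have [e|ne] := eqVneq (cone_label y) (cone_label x); last first.
    have lt := idx_sum_lt sU tU le ne; have := small y; rewrite /cone_wt.
    set a := (X in (X <= n)%N); set b := (X in (_ < _ + X)%N) => an.
    apply: leq_trans (leq_addr _ _); apply: (@leq_trans ((idx_sum (cone_label y)).+1 * n.+1)).
      by rewrite mulSn addnC ltn_add2r ltnS.
    by rewrite leq_mul2r lt orbT.
  rewrite /cone_wt e ltn_add2l; rewrite e in ly.
  set s := cone_label x in lx ly e.
  case: x y @s xA yA dxy ymu lx ly le sU tU e => [T|S] [T'|S'] s xA yA dxy ymu lx ly le sU tU e; rewrite /= in dxy;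
    last 1 first.
  - case/simplex_d_neq0: dxy => u uS' SE.
    have fE : flip (inr S') = flip (inr S) by rewrite /flip e.
    case ef: (flip (inr S)) => [v|]; rewrite fE ef; last first.
      have [E1 _ _] := inr_noflip xA lx ef.
      have [E2 _ _] := inr_noflip yA ly (etrans fE ef).
      by move: uS'; rewrite E2 -E1 SE !inE eqxx.
    have lt : (#|S :\ v| < #|S' :\ v|)%N.
      rewrite SE; apply: toggle_decr uS' _; apply: contraNneq ymu => uv.
      by rewrite /cone_mu ef SE uv toggleK.
    have := small (inr S'); have le2 : (#|S' :\ v| <= n)%N.
      by rewrite -[leqRHS](card_ord n); exact: max_card.
    by rewrite /= ltn_sub2lE.
  - case/simplex_d_neq0: dxy => u uT T'E.
    have fE : flip (inl T') = flip (inl T) by rewrite /flip e.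
    case ef: (flip (inl T)) => [v|]; rewrite fE ef; last first.
      have [E1 _ _] := inl_noflip xA lx ef.
      have [E2 _ _] := inl_noflip yA ly (etrans fE ef).
      by move: uT; rewrite E1 -E2 T'E !inE eqxx.
    rewrite T'E /=; apply: toggle_decr uT _; apply: contraNneq ymu => uv.
    by rewrite /cone_mu ef T'E uv.
  - have [_ _ RT TF] := inl_facts xA lx; have [_ _ FS SF] := inr_facts yA ly.
    have RW : low_part s \subset W by apply: subset_trans RT _; exact: subsetDl.
    have FV : pair_facet s :\: low_part s \subset V by apply: subset_trans FS _; exact: subsetDl.
    case/negP: ymu; apply/eqP.
    have nx : flip (inl T) = None.
      rewrite /flip -/s; case: pickP => // v; rewrite in_setI => /andP [/(subsetP FV)].
      by rewrite in_setC => /negP.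
    have ny : flip (inr S') = None.
      rewrite /flip e; case: pickP => // v; rewrite in_setI => /andP [/(subsetP RW) vW].
      by rewrite in_setC vW.
    rewrite /cone_mu nx; have [-> _ _] := inr_noflip yA ly ny.
    by rewrite -/s.
  - by rewrite eqxx in dxy.
Qed.

Lemma cone_H (k : nat) : hdim cone_deg cone_d (inl @: ball_fam W) (k + n.+1) =
  hdim cd simplex_d (ball_fam W) k.
Proof. exact: (hdim_image inl_inj). Qed.

Lemma cone_G (k i : nat) : (k + i = m + n)%N ->
  hdim cone_deg cone_d (inr @: int_fam V) k = hdim cd simplex_d (int_fam V) i.
Proof.
move=> e; apply: (hdim_reverse (@simplex_d_deg K n) inr_inj _ _ e) => // S /=.
have := max_card (mem S); rewrite card_ord; rewrite -[#|mem S|]/#|S|.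
by clear; lia.
Qed.

Lemma cone_parts : [disjoint (inr @: int_fam V : {set X}) & inl @: ball_fam W] /\
  forall g h, g \in (inr @: int_fam V : {set X}) -> h \in inl @: ball_fam W ->
    cone_d g h = 0.
Proof.
split.
  rewrite -setI_eq0; apply/eqP/setP => x; rewrite !inE; apply/negP => /andP [].
  by move=> /imsetP [S _ ->] /imsetP [].
by move=> g h /imsetP [S _ ->] /imsetP [T _ ->].
Qed.

(** The cone of the pairing is acyclic, so the pairing induces an isomorphism
    from the homology of the ball side to that of the dual of the interior
    side. *)
Theorem interior_duality i j : (i + j = m)%N ->
  hdim cd simplex_d (int_fam V) i = hdim cd simplex_d (ball_fam W) j.
Proof.
move=> ij; have [dis GH] := cone_parts.
have := hdim_connect cone_deg_d dis cone_complex GH cone_acyclic (j + n).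
by rewrite -addnS cone_H => ->; rewrite (cone_G (i := i)) // -ij; clear; lia.
Qed.

(** The degrees in question occur in the cone only on the interior side. *)
Lemma interior_vanish i : (m < i)%N -> hdim cd simplex_d (int_fam V) i = 0%N.
Proof.
move=> mi; have [dis GH] := cone_parts.
have [le|gt] := leqP i (m + n); last first.
  apply/eqP; rewrite -leqn0 /hdim (_ : slice _ _ _ = set0) ?cards0 ?sub0n //.
  apply/setP => S; rewrite !inE; apply/negbTE; rewrite negb_and; apply/orP; right.
  have := max_card (mem S); rewrite card_ord -[#|mem S|]/#|S|.
  by move: gt; clear; lia.
rewrite -(@cone_G (m + n - i)) ?subnK //.
rewrite -(hdim_connect cone_deg_d dis cone_complex GH cone_acyclic).
apply/eqP; rewrite -leqn0 /hdim (_ : slice _ _ _ = set0) ?cards0 ?sub0n //.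
apply/setP => x; rewrite !inE; apply/negbTE/negP => /andP [/imsetP [T _ ->]] /=.
by move: mi le; clear; lia.
Qed.

End Cone.
End Duality.

(** * From the ball to the sphere *)

Local Open Scope nat_scope.

Section Squarefree.
Variables (K : fieldType) (n : nat) (P : pred {set 'I_n}).
Hypothesis P_down : forall G H : {set 'I_n}, G \subset H -> P H -> P G.
Local Notation hd := (hdim (fun S : {set 'I_n} => #|S|) (@simplex_d K n)).
Variable J : pred 'X_{1..n}.
Hypothesis JE : forall w, J w = ~~ P (msupp_set w).
Implicit Types (W T : {set 'I_n}) (a : 'X_{1..n}).

Lemma squarefree_up : up_closed J.
Proof.
move=> u w uw; rewrite !JE; apply: contra; apply: P_down.
apply/subsetP => v; rewrite !inE => uv; exact: leq_trans uv (mnm_lepP uw v).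
Qed.

Lemma koszul_fam_sqfree W :
  koszul_fam J (sqfree_mnm W) = [set T : {set 'I_n} | (T \subset W) && P (W :\: T)].
Proof.
apply/setP => T; rewrite !inE JE negbK.
have -> : (sqfree_mnm T <= sqfree_mnm W)%MM = (T \subset W).
  apply/mnm_lepP/subsetP => [H v vT|H v]; last first.
    by rewrite !sqfree_mnmE; case vT: (v \in T) => //; rewrite (H v vT).
  by have := H v; rewrite !sqfree_mnmE vT; case: (v \in W).
case: (boolP (T \subset W)) => //= TW; congr P; apply/setP => v.
rewrite !inE mnmBE !sqfree_mnmE.
by case: (v \in T); case: (v \in W).
Qed.

(** If [v] has exponent at least two in [a], then adding or deleting [v] does not
    change the support of [a - T]. *)
Lemma koszul_fam_nonsquarefree a v i : 1 < a v -> hd (koszul_fam J a) i = 0.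
Proof.
move=> av; apply: (toggle_acyclic (v := v)).
  by apply/convex_complex/koszul_fam_convex; exact: squarefree_up.
move=> T; rewrite !inE !JE !negbK => /andP [Ta PT].
have mE : msupp_set (a - sqfree_mnm (toggle v T))%MM = msupp_set (a - sqfree_mnm T)%MM.
  apply/setP => w; rewrite !inE !mnmBE !sqfree_mnmE in_toggle.
  case: (w =P v) => [->|_]; last by rewrite addbF.
  by rewrite !subn_gt0; case: (v \in T) => /=; rewrite av (ltnW av).
rewrite mE PT andbT; apply/mnm_lepP => w; rewrite sqfree_mnmE in_toggle.
case: (w =P v) => [->|_]; first by apply: leq_trans (leq_b1 _) (ltnW av).
by rewrite addbF -sqfree_mnmE; exact: (mnm_lepP Ta).
Qed.

Lemma koszul_betti_squarefree i k : koszul_betti K J i k =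
  \sum_(W : {set 'I_n} | #|W| == k) hd (koszul_fam J (sqfree_mnm W)) i.
Proof.
rewrite /koszul_betti (eq_bigr (fun a : 'X_{1..n < k.+1} =>
  \sum_(W : {set 'I_n}) (sqfree_mnm W == a :> 'X_{1..n}) * hd (koszul_fam J (sqfree_mnm W)) i)); last first.
  move=> a _; have [v av|sf] := pickP (fun v => 1 < a v).
    rewrite (koszul_fam_nonsquarefree i av) big1 // => W _; case: eqP => //= e.
    by rewrite -e sqfree_mnmE ltnNge leq_b1 in av.
  rewrite (bigD1 (msupp_set a)) //= big1 ?addn0.
    have -> : sqfree_mnm (msupp_set a) = a; last by rewrite eqxx mul1n.
    apply/mnmP => v; rewrite sqfree_mnmE inE; have := sf v; case: (bmnm a v) => [|[]] //.
  move=> W Wa; case: eqP => //= e; case/eqP: Wa; apply/setP => v.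
  by rewrite inE -e sqfree_mnmE; case: (v \in W).
rewrite exchange_big /= [RHS]big_mkcond; apply: eq_bigr => W _.
by rewrite -big_distrl /= sum_pick_mnm mdeg_sqfree; case: eqP; rewrite ?mul1n.
Qed.

End Squarefree.

Section Assembly.
Variables (m r n : nat).
Hypothesis mrn : m + 2 * r < n.
Variable Uw : seq (seq nat).
Hypothesis UI : facet_ideal m r Uw.
Variable K : fieldType.
Local Notation in_ball := (@in_ball m n Uw).
Local Notation in_int := (@in_int m n Uw).
Local Notation gen_list := (gen_list m r n Uw).
Local Notation hd := (hdim (fun S : {set 'I_n} => #|S|) (@simplex_d K n)).
Local Notation ball_fam := (ball_fam m Uw).
Local Notation int_fam := (int_fam m Uw).
Implicit Types (W T H : {set 'I_n}).

Definition in_sphere H : bool := in_ball H && ~~ in_int H.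

Lemma in_sphere_down (G H : {set 'I_n}) : G \subset H -> in_sphere H -> in_sphere G.
Proof.
move=> GH /(sphereP UI mrn) [F [s [HF ? ? ? ?]]]; apply/(sphereP UI mrn).
by exists F, s; split=> //; apply: subset_trans HF.
Qed.

Definition sphere_fam W : {set {set 'I_n}} :=
  [set T : {set 'I_n} | (T \subset W) && in_sphere (W :\: T)].

Lemma ball_stretch w : divided_by (gen_list 2) w = ~~ in_ball (msupp_set w).
Proof. exact: divided_by_stretch. Qed.

(** The bound on the regularity in a squarefree multidegree. *)
Lemma ball_fam_regularity W i : hd (ball_fam W) i != 0 -> #|W| <= i + r.
Proof.
move=> ne; rewrite -mdeg_sqfree; apply: (hdim_regularity mrn UI (K := K)).
by rewrite (koszul_fam_sqfree ball_stretch).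
Qed.

(** Homology of both families would give [#|W| <= i + r] and, by duality,
    [#|~: W| <= m - i + r], hence [n <= m + 2 * r]. *)
Lemma int_ball_disjoint W i : hd (int_fam W) i = 0 \/ hd (ball_fam W) i = 0.
Proof.
have [->|ball0] := eqVneq (hd (ball_fam W) i) 0; first by right.
left; rewrite -[W]setCK; have [mi|im] := ltnP m i; first exact: (interior_vanish mrn UI K _ mi).
rewrite (interior_duality mrn UI K _ (j := m - i)) ?subnKC //.
apply/eqP; apply: contraT => ball1.
have := ball_fam_regularity ball1; have := ball_fam_regularity ball0.
have := cardsC W; rewrite card_ord; move: mrn im; clear; lia.
Qed.

(** The sphere family is the quotient of the ball family by the interior one, and
    by [int_ball_disjoint] the inclusion of the latter is zero in homology. *)
Lemma hdim_sphere_fam W i : hd (sphere_fam W) i =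
  hd (ball_fam W) i + (if i is i'.+1 then hd (int_fam W) i' else 0).
Proof.
have E : int_fam W :|: sphere_fam W = ball_fam W.
  apply/setP => T; rewrite !inE /in_sphere; case: (T \subset W) => //=.
  have := @in_int_ball m n Uw (W :\: T).
  by case: (in_int (W :\: T)) => [/(_ isT) ->|_]; rewrite ?andbT.
have dis : [disjoint int_fam W & sphere_fam W].
  rewrite -setI_eq0; apply/eqP/setP => T; rewrite !inE /in_sphere.
  by case: (T \subset W) => //=; case: (in_int (W :\: T)); rewrite ?andbF.
have cU : is_complex (@simplex_d K n) (int_fam W :|: sphere_fam W).
  by rewrite E; apply: convex_complex; exact: ball_fam_convex.
rewrite -E; apply: (hdim_quotient (@simplex_d_deg K n) dis cU).
  move=> T T'; rewrite !inE => /andP [_ TI] /andP [_ /andP [T'B /negP T'I]].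
  apply/eqP; apply: contraT => /simplex_d_neq0 [v _ T'E]; case: T'I.
  by apply: (in_int_up UI mrn _ TI T'B); rewrite T'E setDS // subsetDl.
by move=> j; rewrite E; exact: int_ball_disjoint.
Qed.

Variable JS : pred 'X_{1..n}.
Hypothesis JSE : forall w, JS w = ~~ in_sphere (msupp_set w).

Local Notation kball := (koszul_betti K (divided_by (gen_list 2))).

Lemma kball_squarefree i k : kball i k = \sum_(W : {set 'I_n} | #|W| == k) hd (ball_fam W) i.
Proof.
rewrite (koszul_betti_squarefree K (P := in_ball) _ ball_stretch); last exact: in_ball_sub.
by apply: eq_bigr => W _; rewrite (koszul_fam_sqfree ball_stretch).
Qed.

Lemma kball_large i k : n < k -> kball i k = 0.
Proof.
move=> nk; rewrite kball_squarefree big_pred0 // => W; apply/negbTE.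
by rewrite neq_ltn (leq_ltn_trans _ nk) // -[leqRHS](card_ord n) max_card.
Qed.

(** Sum [hdim_sphere_fam] over the sets [W] of size [k]; duality turns the
    interior terms into ball terms for the complements, of size [n - k]. *)
Theorem koszul_betti_sphere i k : koszul_betti K JS i k =
  kball i k + (if (0 < i <= m.+1) && (k <= n) then kball (m.+1 - i) (n - k) else 0).
Proof.
rewrite (koszul_betti_squarefree K in_sphere_down JSE).
rewrite (eq_bigr (fun W => hd (ball_fam W) i +
    (if i is i'.+1 then hd (int_fam W) i' else 0))); last first.
  by move=> W _; rewrite (koszul_fam_sqfree JSE) -hdim_sphere_fam.
rewrite big_split /= -kball_squarefree; congr (_ + _).
case: i => [|i]; first by rewrite big1.
have [kn|nk] := leqP k n; last first.
  rewrite andbF big_pred0 // => W; apply/negbTE.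
  by rewrite neq_ltn (leq_ltn_trans _ nk) // -[leqRHS](card_ord n) max_card.
have [im|mi] := leqP i m; last first.
  by rewrite /= ltnS leqNgt mi big1 // => W _; rewrite -[W]setCK (interior_vanish mrn UI).
rewrite /= ltnS im subSS kball_squarefree (reindex_inj (inv_inj (@setCK _))) /=.
apply: eq_big => [W|W _].
  have := cardsC W; rewrite card_ord => cW; apply/eqP/eqP => e.
    by rewrite -e; move: cW; set b := #|~: W|; set c := #|W|; clear; lia.
  by move: cW; rewrite e; move: kn; set b := #|~: W|; clear; lia.
by rewrite (interior_duality mrn UI K _ (j := m - i)) ?subnKC.
Qed.

End Assembly.

(** * Monomials as words, squeezed complexes and generators of ideals *)

Section Words.
Variable m : nat.
Implicit Types (u v : 'X_{1..m}) (s t : seq nat).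

Definition word_of u : seq nat := flatten [seq nseq (u i) (nat_of_ord i) | i <- enum 'I_m].
Definition mnm_of s : 'X_{1..m} := [multinom count_mem (nat_of_ord i) s | i < m].

Lemma mnm_indicesE u : mnm_indices u = [seq x.+1 | x <- word_of u].
Proof.
rewrite /mnm_indices /word_of map_flatten -map_comp; congr flatten.
by apply: eq_map => i /=; rewrite map_nseq.
Qed.

Lemma count_word_of u x :
  count_mem x (word_of u) = if insub x is Some i then u i else 0.
Proof.
rewrite count_flatten -map_comp sumnE big_map big_enum /=.
rewrite (eq_bigr (fun i : 'I_m => (nat_of_ord i == x) * u i)); last first.
  by move=> i _; rewrite count_nseq /= eq_sym.
case: insubP => [i _ ix|nx]; last first.
  by rewrite big1 // => i _; case: eqP => // ix; rewrite -ix ltn_ord in nx.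
rewrite (bigD1 i) //= ix eqxx mul1n big1 ?addn0 // => j ji.
by rewrite -ix (inj_eq val_inj) (negbTE ji).
Qed.

Lemma word_of_valid u : valid m (word_of u).
Proof.
apply/andP; split; last first.
  by apply/allP => x /flattenP [w /mapP [i _ ->]] /nseqP [-> _].
rewrite sorted_pairwise; last exact: leq_trans.
have : pairwise leq (map (@nat_of_ord m) (enum 'I_m)).
  by rewrite -sorted_pairwise ?val_enum_ord ?iota_sorted //; exact: leq_trans.
rewrite /word_of; elim: (enum 'I_m) => //= i l IH /andP [/allP li lp].
rewrite pairwise_cat IH // andbT; apply/andP; split.
  apply/allrelP => x y /nseqP [-> _] /flattenP [w /mapP [j jl ->]] /nseqP [-> _].
  exact: (li _ (map_f _ jl)).
by elim: (u i) => //= k ->; rewrite andbT; apply/allP => x /nseqP [->].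
Qed.

Lemma mnm_of_word u : mnm_of (word_of u) = u.
Proof. by apply/mnmP => i; rewrite mnmE count_word_of valK. Qed.

Lemma word_of_mnm s : valid m s -> word_of (mnm_of s) = s.
Proof.
case/andP => so al; apply: (sorted_eq leq_trans anti_leq) => //.
  by case/andP: (word_of_valid (mnm_of s)).
apply/allP => x _ /=; rewrite count_word_of; case: insubP => [i _ <-|nx].
  by rewrite mnmE.
apply/eqP/esym/eqP; rewrite -leqn0 leqNgt -has_count; apply: contra nx.
by case/hasP => y /(allP al) ym /eqP <-.
Qed.

Lemma mdeg_mnm_of s : valid m s -> mdeg (mnm_of s) = size s.
Proof.
move=> vs; rewrite -[in RHS](word_of_mnm vs) size_flatten /shape -map_comp sumnE.
rewrite big_map big_enum mdegE; apply: eq_bigr => i _ /=.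
by rewrite size_nseq.
Qed.

Lemma mnm_of_take s k : (mnm_of (take k s) <= mnm_of s)%MM.
Proof.
apply/mnm_lepP => i; rewrite !mnmE -[X in _ <= count _ X](cat_take_drop k s).
by rewrite count_cat leq_addr.
Qed.

Lemma mnm_prec_word s t : valid m s -> valid m t -> size s = size t ->
  (forall q, idx m s q <= idx m t q) -> mnm_prec (mnm_of s) (mnm_of t).
Proof.
move=> vs vt st le; rewrite /mnm_prec !mnm_indicesE !word_of_mnm // all2E !size_map st eqxx /=.
apply/(all_nthP (0, 0)) => q; rewrite size_zip !size_map st minnn => qt.
rewrite nth_zip ?size_map //= !(nth_map 0) ?st // ltnS.
have := le q; rewrite /idx (set_nth_default 0) ?st // [X in _ <= X -> _](set_nth_default 0) //.
Qed.

End Words.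

Section Facets.
Variables (n d : nat).
Hypothesis d_lt_n : d < n.
Local Notation m := (n - d - 1).
Local Notation r := d./2.
Variable U : {pred 'X_{1..m}}.
Hypothesis U_shifted : shifted_order_ideal U.
Hypothesis U_deg : mnm_deg_at_most d./2 U.

(** The list is finite because of the bound on the degrees of [U]. *)
Definition words : seq (seq nat) :=
  [seq word_of (bmnm u) | u <- enum {: 'X_{1..m < r.+1}} & bmnm u \in U].

Lemma mem_words s : (s \in words) = valid m s && (mnm_of m s \in U).
Proof.
apply/mapP/andP => [[u]|[vs sU]].
  by rewrite mem_filter => /andP [uU _] ->; rewrite word_of_valid mnm_of_word.
have bs : mdeg (mnm_of m s) < r.+1 by rewrite ltnS; exact: U_deg.
exists (BMultinom bs); first by rewrite mem_filter /= sU mem_enum.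
by rewrite /= word_of_mnm.
Qed.

Lemma words_ideal : facet_ideal m r words.
Proof.
split=> [s|s|s t|]; rewrite !mem_words.
- by case/andP.
- by case/andP => vs /U_deg; rewrite mdeg_mnm_of.
- case/andP => vs sU vt le; rewrite vt /=.
  have ts : size t <= size s.
    rewrite leqNgt; apply/negP => lt; have := le (size s).
    by rewrite (idx_default _ (leqnn _)) leqNgt (idx_lt _ vt) lt.
  have sU' : mnm_of m (take (size t) s) \in U by exact: soi_dvd U_shifted _ _ sU (mnm_of_take _ _ _).
  apply: (soi_prec U_shifted sU'); apply: mnm_prec_word => //; first exact: valid_take.
    by rewrite size_takel.
  by move=> q; rewrite idx_take; case: ltnP => // tq; rewrite idx_default.
- have -> : mnm_of m [::] = 0%MM by apply/mnmP => i; rewrite mnm0E.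
  by rewrite (soi_one U_shifted).
Qed.

Lemma dim_bound : m + 2 * r < n.
Proof.
have := odd_double_half d; rewrite -mul2n; move: d_lt_n; clear.
by move: (odd d) => b; lia.
Qed.

Lemma squeezed_facetE (u : 'X_{1..m}) : squeezed_facet n d u = @pair_facet m n (word_of u).
Proof.
apply/setP => v; rewrite !inE mnm_indicesE size_map.
set s := word_of u; have vs : valid m s := word_of_valid u.
apply/orP/in_pairsP => [[/existsP [p]|le]|[q vq]].
- rewrite (nth_map 0) // => e; exists p; rewrite /low /idx (set_nth_default 0) //.
  by case/orP: e => /eqP; clear; lia.
- apply/in_pairsP; apply: (@in_pairs_tail m s v (size s)) => //.
  by move: le d_lt_n; clear; lia.
- have [qs|sq] := ltnP q (size s); last first.
    right; move: vq; rewrite /low idx_default //; move: sq d_lt_n; clear; lia.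
  left; apply/existsP; exists (Ordinal qs); rewrite (nth_map 0) //=.
  rewrite /low /idx (set_nth_default 0) // in vq.
  by move: vq; clear; lia.
Qed.

Lemma squeezed_ballE (H : {set 'I_n}) :
  squeezed_ball U H <-> @in_ball m n words H.
Proof.
split=> [[F [u uU ->]] HF|/in_ballP [s]].
  apply/in_ballP; exists (word_of u); first by rewrite mem_words word_of_valid mnm_of_word.
  by rewrite -squeezed_facetE.
rewrite mem_words => /andP [vs sU] HF; exists (@pair_facet m n s) => //.
by exists (mnm_of m s) => //; rewrite squeezed_facetE word_of_mnm.
Qed.

Lemma squeezed_ball_facet (F : {set 'I_n}) :
  facet (squeezed_ball U) F <-> exists2 s, s \in words & F = @pair_facet m n s.
Proof.
split=> [[/squeezed_ballE /in_ballP [s sU Fs] max]|[s sU ->]].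
  exists s => //; symmetry; apply: max => //; apply/squeezed_ballE/in_ballP.
  by exists s.
split; first by apply/squeezed_ballE/in_ballP; exists s.
move=> H /squeezed_ballE /in_ballP [t tU Ht] sH.
have st : s = t.
  apply: (facet_inj dim_bound); rewrite ?(fi_valid words_ideal) ?(fi_size words_ideal) //.
  exact: subset_trans sH Ht.
by apply/eqP; rewrite eqEsubset sH st Ht.
Qed.

Lemma squeezed_sphereE (H : {set 'I_n}) :
  squeezed_sphere U H <-> @in_sphere m n words H.
Proof.
have nm : (n - m).-1 = d by move: d_lt_n; clear; lia.
split=> [[G [cG [F [[/squeezed_ball_facet [s sU FE] GF] uF]]] HG]|].
  apply/(sphereP words_ideal dim_bound); exists G, s; rewrite nm -FE; split=> // t tU Gt.
  apply: (facet_inj dim_bound); rewrite ?(fi_valid words_ideal) ?(fi_size words_ideal) //.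
  by rewrite -FE (uF (@pair_facet m n t)) //; split=> //; apply/squeezed_ball_facet; exists t.
move/(sphereP words_ideal dim_bound) => [G [s [HG cG sU Gs us]]].
exists G => //; split; first by rewrite cG nm.
exists (@pair_facet m n s); split; first by split=> //; apply/squeezed_ball_facet; exists s.
by move=> F [/squeezed_ball_facet [t tU ->] Gt]; rewrite (us t tU Gt).
Qed.

End Facets.

Section Ideals.
Variables (K : fieldType) (n : nat).
Local Notation R := {mpoly K[n]}.

(** Membership in an ideal is reduced to combinations of finitely many monomials,
    provided that each of the given generators is a multiple of one of them. *)
Lemma ideal_generated_monomials r (mon : 'I_r -> 'X_{1..n}) (G : R -> Prop) :
  (forall q, G q -> exists l (u : R), q = (u * 'X_[mon l])%R) ->
  (forall l, G 'X_[mon l]) ->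
  forall p, ideal_generated G p <-> exists w : 'I_r -> R, (p = \sum_l w l * 'X_[mon l])%R.
Proof.
move=> Gmon monG p; split=> [[s [sG ->]]|[w ->]]; last first.
  exists [seq (w l, 'X_[mon l])%R | l <- enum 'I_r]; split.
    by move=> q /mapP [l _ ->]; exact: monG.
  by rewrite big_map big_enum.
elim: s sG => [|q s IH] sG.
  by exists (fun=> 0%R); rewrite big_nil big1 // => l _; rewrite mul0r.
have [|w we] := IH; first by move=> q' qs; apply: sG; rewrite inE qs orbT.
have [l [u qE]] := Gmon _ (sG q (mem_head _ _)).
exists (fun l' => (w l' + (l' == l)%:R * (q.1 * u))%R).
rewrite big_cons we qE -(eq_bigr _ (fun l' _ => esym (mulrDl _ _ _))) big_split /=.
rewrite addrC; congr (_ + _)%R; rewrite (bigD1 l) //= eqxx mul1r mulrA big1 ?addr0 //.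
by move=> l' /negbTE ->; rewrite !mul0r.
Qed.

Lemma prod_sqfree (F : {set 'I_n}) : (\prod_(v in F) 'X_v = 'X_[sqfree_mnm F] :> R)%R.
Proof.
rewrite mpolyXE_id big_mkcond; apply: eq_bigr => v _.
by rewrite sqfree_mnmE; case: (v \in F); rewrite ?expr1 ?expr0.
Qed.

End Ideals.

(** * Betti numbers of S-squeezed spheres *)

Lemma eq_koszul_betti (K : fieldType) n (J J' : pred 'X_{1..n}) i k : J =1 J' ->
  koszul_betti K J i k = koszul_betti K J' i k.
Proof.
move=> JJ; apply: eq_bigr => a _; congr (hdim _ _ _ i).
by apply/setP => S; rewrite !inE JJ.
Qed.

Section Betti.
Variables (K : fieldType) (n d : nat).
Hypothesis d_lt_n : d < n.
Local Notation m := (n - d - 1).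
Local Notation r := d./2.
Variable U : {pred 'X_{1..m}}.
Hypothesis U_shifted : shifted_order_ideal U.
Hypothesis U_deg : mnm_deg_at_most d./2 U.
Local Notation words := (words U).
Local Notation min_gen := (min_gen m words).
Local Notation in_sphere := (@in_sphere m n words).
Local Notation kball := (koszul_betti K (divided_by (gen_list m r n words 2))).
Local Notation I_S := (stanley_reisner (squeezed_sphere U) : {mpoly K[n]} -> Prop).
Local Notation I_U := (non_member_ideal U : {mpoly K[n]} -> Prop).
Let UI := words_ideal U_shifted U_deg.
Let mrn := dim_bound d_lt_n.

Lemma mpolyX_dvd (a b : 'X_{1..n}) : (a <= b)%MM ->
  exists u : {mpoly K[n]}, ('X_[b] = u * 'X_[a])%R.
Proof. by move=> ab; exists 'X_[b - a]%R; rewrite -mpolyXD submK. Qed.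

(** All nonfaces serve as generators; their number is finite and the Betti numbers
    depend on the ideal only. *)
Lemma betti_sphere_ideal (i : nat) (k : int) : betti I_S i k =
  if k is Posz k then
    kball i k + (if (0 < i <= m.+1) && (k <= n) then kball (m.+1 - i) (n - k) else 0)
  else 0.
Proof.
pose N : {set {set 'I_n}} := [set F | ~~ in_sphere F].
pose mon (l : 'I_#|N|) : 'X_{1..n} := sqfree_mnm (enum_val l).
have sub_supp (F : {set 'I_n}) (w : 'X_{1..n}) : (sqfree_mnm F <= w)%MM = (F \subset msupp_set w).
  apply/mnm_lepP/subsetP => [H v vF|H v].
    by have := H v; rewrite sqfree_mnmE vF inE.
  by rewrite sqfree_mnmE; case vF: (v \in F) => //; have := H v vF; rewrite inE.
have IE : forall p, I_S p <-> exists w : 'I_#|N| -> {mpoly K[n]},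
    (p = \sum_l w l * 'X_[mon l])%R.
  apply: ideal_generated_monomials => [q [F nF ->]|l].
    have FN : F \in N.
      by rewrite inE; apply/negP => Fs; apply: nF; apply/(squeezed_sphereE d_lt_n U_shifted U_deg).
    exists (enum_rank_in FN F), 1%R.
    by rewrite mul1r prod_sqfree /mon enum_rankK_in.
  exists (enum_val l); last by rewrite prod_sqfree.
  move/(squeezed_sphereE d_lt_n U_shifted U_deg) => Fs.
  by have := enum_valP l; rewrite inE Fs.
rewrite (betti_monomial IE); case: k => // k.
(* squarefree generators see only the support of a monomial *)
have JSE w : in_ideal mon w = ~~ in_sphere (msupp_set w).
  apply/existsP/idP => [[l]|nw].
    rewrite /mon sub_supp => Fw; have := enum_valP l; rewrite inE; apply: contra.
    exact: (in_sphere_down mrn UI).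
  have wN : msupp_set w \in N by rewrite inE.
  by exists (enum_rank_in wN (msupp_set w)); rewrite /mon enum_rankK_in // sub_supp.
exact: (koszul_betti_sphere mrn UI).
Qed.

Lemma mnm_extend_word s : valid m s -> mnm_extend n (mnm_of m s) = stretch_mnm m n 0 s.
Proof.
case/andP => _ /allP al; apply/mnmP => i; rewrite stretch0_count mnmE.
case: insubP => /= [i' _ <-|]; first by rewrite mnmE.
by rewrite -leqNgt => mi; apply/esym/count_memPn; apply/negP => /al; rewrite ltnNge mi.
Qed.

(** The ideal is generated by its minimal generators, which are the list of
    [gen_list] without stretching. *)
Lemma betti_shifted_ideal (i : nat) (k : int) : betti I_U i k =
  if k is Posz k then kball i k else 0.
Proof.
pose G := min_gens m words.
pose mon (l : 'I_(size G)) : 'X_{1..n} := stretch_mnm m n 0 (nth [::] G l).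
have genG (l : 'I_(size G)) : min_gen (nth [::] G l).
  by rewrite -(mem_min_gens UI) mem_nth.
have monP g : min_gen g -> exists l, mon l = stretch_mnm m n 0 g.
  rewrite -(mem_min_gens UI) => gG; have lt : index g G < size G by rewrite index_mem.
  by exists (Ordinal lt); rewrite /mon nth_index.
have IE : forall p, I_U p <-> exists w : 'I_(size G) -> {mpoly K[n]},
    (p = \sum_l w l * 'X_[mon l])%R.
  apply: ideal_generated_monomials => [q [u uU ->]|l].
    have sU : word_of u \notin words.
      by rewrite (mem_words U_deg) word_of_valid mnm_of_word.
    have [k' _ gk] := min_gen_prefix UI (word_of_valid u) sU.
    have [l le] := monP _ gk; exists l; apply: mpolyX_dvd.
    rewrite le -{2}(mnm_of_word u) mnm_extend_word ?word_of_valid //.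
    apply/mnm_lepP => j; rewrite !stretch0_count -[X in _ <= count _ X](cat_take_drop k').
    by rewrite count_cat leq_addr.
  have gg := genG l; case/and3P: (gg) => vg; rewrite (mem_words U_deg) vg /= => gU _.
  by exists (mnm_of m (nth [::] G l)) => //; rewrite mnm_extend_word.
rewrite (betti_monomial IE); case: k => // k.
rewrite (koszul_betti_stretch mrn UI); apply: eq_koszul_betti => w.
apply/existsP/hasP => [[l lw]|[x]].
  exists (stretch_mnm m n 0 (nth [::] G l), colon_vars m n 0 (nth [::] G l)) => //.
  by apply: (map_f (fun g => (stretch_mnm m n 0 g, colon_vars m n 0 g))); rewrite mem_sort mem_nth.
by case/(mem_gen_list UI) => g gg -> /= gw; have [l le] := monP _ gg; exists l; rewrite le.
Qed.

Lemma betti_shifted_regularity (i k : int) : betti I_U i k != 0 -> (k <= i + r%:Z)%R.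
Proof.
case: i => [i|i]; last by rewrite eqxx.
rewrite betti_shifted_ideal; case: k => [k|k]; last by rewrite eqxx.
rewrite (kball_squarefree mrn UI) sum_nat_eq0 negb_forall_in => /existsP [W /andP [/eqP <-]].
by move/(ball_fam_regularity mrn UI); lia.
Qed.

Lemma betti_shifted_proj_dim (i : nat) (k : int) : m < i -> betti I_U i k = 0.
Proof.
move=> mi; rewrite betti_shifted_ideal; case: k => // k.
by rewrite (koszul_betti_stretch mrn UI) (koszul_betti_proj_dim mrn UI).
Qed.

Lemma betti_shifted_large (i : int) (k : nat) : n < k -> betti I_U i k = 0.
Proof.
move=> nk; case: i => // i; rewrite betti_shifted_ideal.
exact: (kball_large mrn UI).
Qed.

(** The long exact sequence of I_S/I_B, R/I_B and R/I_S, with I_S/I_B replaced by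
    its dual.  The indices range over all integers: outside of the natural range
    both terms vanish by the bounds on the projective dimension and on the
    squarefree multidegrees. *)
Theorem betti_sphere_decomposition (i k : int) :
  betti I_S i k = betti I_U i k + betti I_U (n%:Z - d%:Z - i)%R (n%:Z - k)%R.
Proof.
case: i => [i|i]; last first.
  (* for negative [i] the index of the second term exceeds [m] *)
  have -> : (n%:Z - d%:Z - Negz i)%R = (n - d + i.+1)%N by rewrite NegzE; lia.
  rewrite [in RHS]betti_shifted_proj_dim //; lia.
case: k => [k|k]; last first.
  (* for negative [k] its degree exceeds [n] *)
  have -> : (n%:Z - Negz k)%R = (n + k.+1)%N by rewrite NegzE; lia.
  rewrite betti_sphere_ideal betti_shifted_ideal betti_shifted_large //; lia.
rewrite betti_sphere_ideal betti_shifted_ideal; congr (_ + _).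
have [kn|nk] := leqP k n; last first.
  have [e ->] : exists e, (n%:Z - k%:Z)%R = Negz e by exists (k - n).-1; rewrite NegzE; lia.
  rewrite andbF; case: (_ - _)%R => // p; by rewrite betti_shifted_ideal.
have -> : (n%:Z - k%:Z)%R = (n - k)%N by lia.
rewrite andbT; have [im|mi] := leqP i m.+1; last first.
  have [e ->] : exists e, (n%:Z - d%:Z - i%:Z)%R = Negz e.
    by exists (i - m.+1).-1; rewrite NegzE; lia.
  by rewrite andbF.
have -> : (n%:Z - d%:Z - i%:Z)%R = (m.+1 - i)%N by lia.
rewrite andbT; case: i im => [|i] im; last by rewrite betti_shifted_ideal.
by rewrite betti_shifted_proj_dim.
Qed.

End Betti.

Local Open Scope ring_scope.

Theorem theorem5p3 (K : fieldType) (n d : nat) (U : {pred 'X_{1..(n - d - 1)}})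
    (charK0 : [pchar K] =i pred0) (d_gt0 : (0 < d)%N) (d_lt_n : (d < n)%N)
    (U_shifted : shifted_order_ideal U) (U_deg : mnm_deg_at_most d./2 U)
    (i j : int) :
  let I_S : {mpoly K[n]} -> Prop := stanley_reisner (squeezed_sphere U) in
  let I_U : {mpoly K[n]} -> Prop := non_member_ideal U in
  [/\ j * 2 < d%:Z ->
        betti I_S i (i + j) = betti I_U i (i + j),
      j * 2 = d%:Z ->
        betti I_S i (i + j)
        = (betti I_U i (i + j)
           + betti I_U (n%:Z - d%:Z - i) (n%:Z - i - j))%N
    & d%:Z < j * 2 ->
        betti I_S i (i + j) = betti I_U (n%:Z - d%:Z - i) (n%:Z - i - j)].
Proof.
move=> I_S I_U.
have -> : n%:Z - i - j = n%:Z - (i + j) by rewrite opprD addrA.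
have main := betti_sphere_decomposition K d_lt_n U_shifted U_deg i (i + j).
have reg := betti_shifted_regularity d_lt_n U_shifted U_deg (K := K).
(* the regularity bound [r] is at most half of [d] *)
have half : (d./2)%:Z * 2 <= d%:Z.
  by rewrite -[in X in _ <= X](odd_double_half d) -mul2n; case: (odd d); lia.
rewrite -/I_S -/I_U in main reg.
split=> jd; rewrite main //.
  have [->|/reg] := eqVneq (betti I_U (n%:Z - d%:Z - i) (n%:Z - (i + j))) 0%N.
    by rewrite addn0.
  by move: jd half; clear; lia.
have [->|/reg] := eqVneq (betti I_U i (i + j)) 0%N; first by rewrite add0n.
by move: jd half; clear; lia.
Qed.
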